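(* Let $t\ge 6$ and $k$ be integers with $k\ge 2^{t-4}+2$. Then every noncomplete $k$-contraction-critical graph is $t$-connected.
   Context: Graphs are finite and simple. A graph $H$ is a minor of a graph $G$ if $H$ can be obtained from a subgraph of $G$ by contracting edges; it is a proper minor if it is a minor other than $G$ itself. A graph $G$ is $k$-contraction-critical if $G$ is $k$-chromatic (its chromatic number is exactly $k$) but every proper minor of $G$ is $(k-1)$-colorable. A graph is $t$-connected if it has more than $t$ vertices and deleting any set of fewer than $t$ vertices leaves a connected graph. *)

(* Defs.v *)
From mathcomp Require Import all_boot.
Set Implicit Arguments. Unset Strict Implicit. Unset Printing Implicit Defensive.

Record sgraph := SGraph {
  vertex :> finType;
  adj : rel vertex;
  adj_sym : symmetric adj;
  adj_irrefl : irreflexive adj }.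

Definition isomorphic (G H : sgraph) : Prop :=
  exists2 f : G -> H, bijective f & {mono f : x y / adj x y}.

(* Isomorphic to a (not necessarily induced) subgraph of [G]. *)
Definition subgraph (H G : sgraph) : Prop :=
  exists2 f : H -> G, injective f & {homo f : x y / adj x y}.

Section Contraction.
Variables (G : sgraph) (x y : G).

(* [x] stands for the vertex obtained by merging [x] and [y]. *)
Definition contract_adj : rel {z : G | z != y} := fun u v =>
  (u != v) && [|| adj (val u) (val v),
                  (val u == x) && adj y (val v)
                | (val v == x) && adj y (val u)].

Lemma contract_adj_sym : symmetric contract_adj.
Proof.
by move=> u v; rewrite /contract_adj eq_sym adj_sym; congr (_ && (_ || _));
   rewrite orbC.
Qed.

Lemma contract_adj_irrefl : irreflexive contract_adj.
Proof. by move=> u; rewrite /contract_adj eqxx. Qed.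

Definition contract : sgraph := SGraph contract_adj_sym contract_adj_irrefl.
End Contraction.

Inductive contracts_to (G : sgraph) : sgraph -> Prop :=
| contracts_refl : contracts_to G G
| contracts_step (H : sgraph) (x y : H) :
    contracts_to G H -> adj x y -> contracts_to G (contract x y).

Definition minor (H G : sgraph) : Prop :=
  exists K L : sgraph, [/\ subgraph K G, contracts_to K L & isomorphic L H].

(* Graphs are identified up to isomorphism, as [minor] only depends on
   isomorphism classes. *)
Definition proper_minor (H G : sgraph) : Prop :=
  minor H G /\ ~ isomorphic H G.

Definition colorable (k : nat) (G : sgraph) : bool :=
  [exists f : {ffun G -> 'I_k}, [forall x, forall y, adj x y ==> (f x != f y)]].

Lemma colorable_card (G : sgraph) : exists k, colorable k G.
Proof.
exists #|G|; apply/existsP; exists [ffun x => enum_rank x].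
apply/forallP=> x; apply/forallP=> y; apply/implyP=> xy.
rewrite !ffunE (inj_eq enum_rank_inj).
by apply: contraTneq xy => ->; rewrite adj_irrefl.
Qed.

Definition chromatic_number (G : sgraph) : nat := ex_minn (colorable_card G).

Definition contraction_critical (k : nat) (G : sgraph) : Prop :=
  chromatic_number G = k /\
  forall H : sgraph, proper_minor H G -> colorable k.-1 H.

Definition complete (G : sgraph) : Prop :=
  forall x y : G, x != y -> adj x y.

Section Deletion.
Variables (G : sgraph) (S : {set G}).

Definition delete_adj : rel {x : G | x \notin S} :=
  fun u v => adj (val u) (val v).

Lemma delete_adj_sym : symmetric delete_adj.
Proof. by move=> u v; apply: adj_sym. Qed.

Lemma delete_adj_irrefl : irreflexive delete_adj.
Proof. by move=> u; apply: adj_irrefl. Qed.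

Definition delete : sgraph := SGraph delete_adj_sym delete_adj_irrefl.
End Deletion.

Definition connected_graph (G : sgraph) : Prop :=
  0 < #|G| /\ forall x y : G, connect (@adj G) x y.

Definition t_connected (t : nat) (G : sgraph) : Prop :=
  t < #|G| /\ forall S : {set G}, #|S| < t -> connected_graph (delete S).

(* Main.v *)
(** Let [S] be an inclusion-minimal separator of size less than [t], with sides [X] and [Y], and
let [q = k - 1] colours be available, so that [2 ^ (#|S| - 3) < q].  If proper colourings of
[S :|: X] and [S :|: Y] induced the same partition of [S], they would glue to a [q]-colouring of the
graph.  Contracting disjoint connected bags of [S :|: X] that cover [S] gives, by criticality, a
colouring of [S :|: Y] that is constant on the trace of each bag and separates adjacent bags.

Starting from a colouring [c] of [S :|: X] in which every colour class on [S] is linked by Kempe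
chains, let the bags of the classes grow along further colours.  A set of classes whose bags are
pairwise nonadjacent can be merged into one class by Kempe changes.  Reserving a colour for each
pair formed by a class [b] and the set of classes preceding [b] in a candidate set takes about
[2 ^ (#|S| - 3)] colours, and then a colouring of [S :|: Y] obtained from the bags can be matched
on the side of [X].

Keep a maximum independent subset [I] of [S] as an exact class on both sides, and split the rest of
[S] by Kempe changes.  Either all other vertices of [S] get distinct colours on both sides, and the
colourings glue, or on one side a single coincidence remains, and the bag argument excludes it.  Its
counting bound fails only for [#|S| = 5]; in that case the few possible partitions of [S] are
excluded by explicit Kempe chains. *)

Require Import Defs.
From mathcomp Require Import all_boot fingroup perm zify.
Set Implicit Arguments. Unset Strict Implicit. Unset Printing Implicit Defensive.

(** * Minors of contraction-critical graphs *)

(** The two sides are coloured independently, so the difficulty is to make them agree on [S]. The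
    partition aimed at on both sides has [I] as its only class with more than one vertex. Kempe
    chains that block a change on one side are connected, so they can serve as bags that constrain
    the other side. The contracted colouring may still identify nonadjacent bags, and the side of
    the bags must then merge exactly those classes. Bags of different classes compete for vertices
    of the same colour; processing them in a suitable order settles this, and even lets a reserved
    colour ignore one class.

    This gives the constant. A linked colouring with at least two coincidences on [S] has at most
    [p = #|S| - 2] classes. Labelling a class by a set of classes before it, its predecessor left
    out, takes [2 ^ (p - 1)], hence at most [2 ^ (#|S| - 3)] labels. As [#|S| <= t - 1], this is at
    most [2 ^ (t - 4)], and [k - 1] exceeds it; the slack pays for some extra labels. *)

Section Relation.
Variables (V : finType) (e : rel V).
Hypothesis e_sym : symmetric e.

Definition inner (U : {set V}) : rel V := fun u v => [&& u \in U, v \in U & e u v].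

Lemma inner_sym U : symmetric (inner U).
Proof. by move=> u v; rewrite /inner e_sym; do 2 case: (_ \in U). Qed.

Lemma inner_csym U : connect_sym (inner U).
Proof. by apply: sym_connect_sym; exact: inner_sym. Qed.

Lemma inner_connect_sub (U W : {set V}) u v :
  U \subset W -> connect (inner U) u v -> connect (inner W) u v.
Proof.
move=> /subsetP sUW; apply: connect_sub => x y /and3P[xU yU xy].
by apply: connect1; rewrite /inner !sUW.
Qed.

Lemma inner_connect_in U u v : connect (inner U) u v -> u != v -> u \in U /\ v \in U.
Proof.
move=> uv neq; split.
  case/connectP: uv => [[|w p] /= pw lw]; first by rewrite lw eqxx in neq.
  by case/andP: pw => /and3P[].
rewrite inner_csym in uv; rewrite eq_sym in neq.
case/connectP: uv => [[|w p] /= pw lw]; first by rewrite lw eqxx in neq.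
by case/andP: pw => /and3P[].
Qed.

Lemma connect_invariant (r : rel V) (P : pred V) u v :
  (forall x y, P x -> r x y -> P y) -> P u -> connect r u v -> P v.
Proof.
move=> Pcl Pu /connectP[p pth ->]; elim: p u Pu pth => //= w p IH u Pu /andP[uw].
exact/IH/(Pcl u).
Qed.

Lemma connect_break (r : rel V) (P : pred V) u v :
  connect r u v -> P u -> ~~ P v -> exists x y, [/\ P x, ~~ P y & r x y].
Proof.
move=> uv Pu nPv.
case: (boolP [exists x, exists y, [&& P x, ~~ P y & r x y]]).
  by case/existsP=> x /existsP[y /and3P[]]; exists x, y.
rewrite negb_exists => /forallP H.
suff: P v by rewrite (negbTE nPv).
apply: connect_invariant uv => // x y Px xy.
have := H x; rewrite negb_exists => /forallP/(_ y).
by rewrite Px xy andbT /= negbK.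
Qed.

Lemma reach_connect U u v : connect (inner U) u v ->
  connect (inner [set w | connect (inner U) u w]) u v.
Proof.
pose R := [set w | connect (inner U) u w].
move=> uv; have /andP[] // : connect (inner U) u v && connect (inner R) u v.
apply: (connect_invariant (P := fun w => connect (inner U) u w && connect (inner R) u w)) uv.
  move=> x y /andP[ux Rx] xy; have uy := connect_trans ux (connect1 xy).
  rewrite uy; apply: connect_trans Rx (connect1 _).
  by case/and3P: xy => _ _ xy; rewrite /inner !inE ux uy.
by rewrite !connect0.
Qed.

End Relation.

(* Each step contracts two adjacent vertices of one fiber of [h]. *)
Lemma contract_fibers (K : sgraph) (T : eqType) (h : K -> T) :
  (forall u v : K, h u = h v ->
     connect (inner (@adj K) [set w | h w == h u]) u v) ->
  exists (L : sgraph) (pi : K -> L),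
  [/\ contracts_to K L, forall y, exists x, pi x = y,
      forall u v, h u = h v -> pi u = pi v &
      forall u v, adj u v -> h u <> h v -> adj (pi u) (pi v)].
Proof.
move=> hconn.
suff main n (L : sgraph) (pi : K -> L) : #|L| <= n -> contracts_to K L ->
    (forall y, exists x, pi x = y) -> (forall u v, pi u = pi v -> h u = h v) ->
    (forall u v, adj u v -> pi u != pi v -> adj (pi u) (pi v)) ->
  exists (L : sgraph) (pi : K -> L),
  [/\ contracts_to K L, forall y, exists x, pi x = y,
      forall u v, h u = h v -> pi u = pi v &
      forall u v, adj u v -> h u <> h v -> adj (pi u) (pi v)].
  apply: (main #|K| K id) => //; first exact: contracts_refl.
    by move=> y; exists y.
  by move=> u v /= ->.
elim: n => [|n IH] in L pi *.
  rewrite leqn0 => /eqP/card0_eq L0 KL psurj ph padj.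
  by exists L, pi; split=> // u; have := L0 (pi u).
move=> Ln KL psurj ph padj.
case: (boolP [exists u, exists v, (h u == h v) && (pi u != pi v)]); last first.
  rewrite negb_exists => /forallP hp; exists L, pi; split=> //.
    move=> u v huv; have := hp u; rewrite negb_exists => /forallP/(_ v).
    by rewrite huv eqxx /= negbK => /eqP.
  by move=> u v uv huv; apply: padj => //; apply/eqP => /ph.
case/existsP=> u0 /existsP[v0 /andP[/eqP huv0 puv0]].
have [u [v [/eqP pu pv /and3P[hu hv uv]]]] :
    exists u v, [/\ pi u == pi u0, ~~ (pi v == pi u0) &
                 inner (@adj K) [set w | h w == h u0] u v].
  apply: (@connect_break _ _ (fun u => pi u == pi u0) u0 v0) => //.
    exact: hconn.
  by rewrite eq_sym.
rewrite !inE in hu hv.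
have pvu : pi u != pi v by rewrite pu eq_sym.
pose x := pi u; pose y := pi v.
have xy : adj x y by apply: padj.
have sub w : (if pi w == y then x else pi w) != y by case: ifP => // /negbT.
pose pi' w : contract x y := Sub (if pi w == y then x else pi w) (sub w).
have pi'E a b : pi' a = pi' b -> h a = h b.
  have hxy a' b' : pi a' = x -> pi b' = y -> h a' = h b'.
    move=> /ph -> /ph ->; by rewrite (eqP hu) (eqP hv).
  move=> /(congr1 val) /=; case: eqP => [ay|ay]; case: eqP => [by_|by_].
  - by move=> _; apply: ph; rewrite ay by_.
  - by move=> bx; rewrite (hxy b a).
  - by move=> ax; apply: hxy.
  - exact: ph.
apply: (IH (contract x y) pi').
- rewrite -ltnS; apply: leq_trans Ln; rewrite card_sig.
  rewrite [X in _ < X](cardD1 y) inE add1n ltnS.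
  by apply/subset_leq_card/subsetP => z; rewrite !inE andbT.
- exact: contracts_step.
- move=> [z zy]; have [w wz] := psurj z; exists w; apply: val_inj => /=.
  by rewrite wz (negbTE zy).
- exact: pi'E.
- move=> a b ab nab; rewrite /= /contract_adj nab /=.
  have := nab; rewrite -(inj_eq val_inj) /=.
  have pab : pi a != pi b -> adj (pi a) (pi b) by apply: padj.
  case: (eqVneq (pi a) y) => ay; case: (eqVneq (pi b) y) => by_.
  + by rewrite eqxx.
  + have yb : adj y (pi b) by rewrite -ay; apply: pab; rewrite ay eq_sym.
    by move=> _; rewrite eqxx yb orbT.
  + have ya : adj y (pi a) by rewrite adj_sym -by_; apply: pab; rewrite by_.
    by move=> _; rewrite eqxx ya !orbT.
  + by move=> /pab ->.
Qed.

(* A quotient of a subgraph by connected fibers is a minor; it is a proper one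
   as soon as a vertex is dropped or two vertices are identified. *)
Lemma critical_quotient (k : nat) (G : sgraph) (U : {set G}) (h : G -> G) :
  contraction_critical k G -> U != set0 ->
  (forall u, u \in U -> h u \in U) ->
  (forall u, u \in U -> connect (inner (@adj G) [set w in U | h w == h u]) u (h u)) ->
  (exists v, v \notin U \/ h v <> v) ->
  exists f : G -> 'I_k.-1, forall u v, u \in U -> v \in U ->
    (h u = h v -> f u = f v) /\ (adj u v -> h u <> h v -> f u <> f v).
Proof.
move=> [_ crit] /set0Pn[u0 u0U] hU hconn [v0 hv0].
pose UC : {set G} := ~: U.
pose K := delete UC.
have Kin (u : K) : val u \in U by have := valP u; rewrite !inE negbK.
pose hK (u : K) := h (val u).
have [|L [pi [KL psurj pE padj]]] := @contract_fibers K _ hK.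
  move=> u v huv.
  have huvU : forall u : K, connect (inner (@adj G) [set w in U | h w == h (val u)]) (val u) (h (val u)).
    by move=> w; apply: hconn.
  have c1 := huvU u.
  have c2 := huvU v; rewrite -/(hK v) -huv /hK in c2.
  have : connect (inner (@adj G) [set w in U | h w == h (val u)]) (val u) (val v).
    apply: connect_trans c1 _; rewrite inner_csym //; exact: adj_sym.
  set F := [set w in U | h w == h (val u)] => cuv.
  have : [exists w : K, (val w == val v) &&
             connect (inner (@adj K) [set w | hK w == hK u]) u w].
    pose P a := [exists w : K, (val w == a) &&
                   connect (inner (@adj K) [set w | hK w == hK u]) u w].
    apply: (@connect_invariant _ _ P (val u) (val v)) cuv.
      move=> a b /existsP[w /andP[/eqP <- cw]] /and3P[aF bF ab].
      rewrite !inE in aF bF; case/andP: bF => bU /eqP hb.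
      case/andP: aF => _ ha.
      have bUC : b \notin UC by rewrite !inE negbK.
      apply/existsP; exists (Sub b bUC); rewrite eqxx /=.
      apply: connect_trans cw (connect1 _).
      by rewrite /inner !inE /hK /= hb eqxx ha.
    by apply/existsP; exists u; rewrite eqxx connect0.
  by case/existsP=> w /andP[/eqP/val_inj <-].
have LH : proper_minor L G.
  split.
    exists K, L; split=> //.
      by exists val => //; apply: val_inj.
    by exists id => //; exists id.
  (* An isomorphism gives [#|L| = #|G|], which forces [U] to be everything and [pi] to be injective,
     whereas [pi] identifies [v0] with [h v0]. *)
  case=> f [g fg gf] _.
  have LG : #|L| = #|G| by apply: (bij_eq_card (f := f)); exists g.
  have KU : #|K| = #|U|.
    by rewrite card_sig; apply: eq_card => x; rewrite !inE negbK.
  have imL : [seq pi x | x in K] =i L.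
    by move=> y; have [x <-] := psurj y; rewrite image_f.
  have LK : #|L| <= #|K| by rewrite -(eq_card imL) leq_image_card.
  have UG : #|U| <= #|G| by exact: max_card.
  case: (boolP (v0 \in U)) => [v0U|v0U]; last first.
    have : #|U| < #|G|.
      rewrite -(cardC (mem U)) -[X in X < _]addn0 ltn_add2l.
      by apply/card_gt0P; exists v0.
    by rewrite ltnNge -LG -KU LK.
  have hv0U := hU _ v0U.
  have {}hv0 : h v0 <> v0 by case: hv0 => [/negP|].
  have inj : {in K &, injective pi}.
    by apply/image_injP; rewrite (eq_card imL) LG KU eqn_leq UG -KU -LG LK.
  have UC1 u : u \in U -> u \notin UC by rewrite !inE negbK.
  have /(congr1 val) /= : (Sub v0 (UC1 _ v0U) : K) = Sub (h v0) (UC1 _ hv0U).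
    apply: inj => //; apply: pE; rewrite /hK /=.
    have := hconn _ v0U; have : v0 != h v0 by rewrite eq_sym; apply/eqP.
    move=> + c0 => neq; have [_] := inner_connect_in (@adj_sym G) c0 neq.
    by rewrite inE => /andP[_ /eqP].
  by move/esym.
have /existsP[f /forallP fP] := crit L LH.
have UC1 u : u \in U -> u \notin UC by rewrite !inE negbK.
exists (fun u => f (pi (insubd (Sub u0 (UC1 _ u0U) : K) u))) => u v uU vU.
have -> : u = val (Sub u (UC1 _ uU) : K) by [].
have -> : v = val (Sub v (UC1 _ vU) : K) by [].
rewrite !valKd; split; first by move=> /pE ->.
move=> uv huv; apply/eqP; move/forallP: (fP (pi (Sub u (UC1 _ uU)))).
by move/(_ (pi (Sub v (UC1 _ vU))))/implyP; apply; apply: padj.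
Qed.

(** * Kempe changes *)

Section Colouring.
Variables (V C : finType) (e : rel V).
Hypothesis e_sym : symmetric e.

Definition colouring (Z : {set V}) (c : V -> C) :=
  forall u v, u \in Z -> v \in Z -> e u v -> c u != c v.

(* The third premise makes [s] constant on the components of the subgraph coloured from [M]. *)
Lemma kempe (Z : {set V}) c (M : {set C}) (s : V -> {perm C}) :
  colouring Z c -> (forall v x, (s v x \in M) = (x \in M)) ->
  (forall u v, u \in Z -> v \in Z -> e u v -> c u \in M -> c v \in M -> s u = s v) ->
  colouring Z (fun v => if c v \in M then s v (c v) else c v).
Proof.
move=> pc sM sconst u v uZ vZ uv.
case: ifP => uM; case: ifP => vM.
- by rewrite (sconst u v) // (inj_eq perm_inj) pc.
- by apply: contraFneq vM => <-; rewrite sM.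
- by apply: contraFneq uM => ->; rewrite sM.
- exact: pc.
Qed.

Definition bichrom (Z : {set V}) (c : V -> C) a b : {set V} :=
  [set w in Z | (c w == a) || (c w == b)].

Definition chain Z c a b u : {set V} := [set v | connect (inner e (bichrom Z c a b)) u v].

Definition swap Z c a b u v := if v \in chain Z c a b u then tperm a b (c v) else c v.

Lemma chain_refl Z c a b u : u \in chain Z c a b u.
Proof. by rewrite inE connect0. Qed.

Lemma swap_colouring Z c a b u : u \in bichrom Z c a b -> colouring Z c -> colouring Z (swap Z c a b u).
Proof.
move=> uB pc x y xZ yZ xy.
have sub w : w \in chain Z c a b u -> w \in bichrom Z c a b.
  rewrite inE => cw; case: (eqVneq u w) => [<- //|neq].
  by have [] := inner_connect_in e_sym cw neq.
have step w w' : w \in chain Z c a b u -> w' \in bichrom Z c a b -> e w w' ->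
    w' \in chain Z c a b u.
  move=> wc w'B ww'; have wB := sub _ wc; rewrite !inE in wc *.
  by apply: connect_trans wc (connect1 _); rewrite /inner wB w'B.
have out w w' : w \in chain Z c a b u -> w' \notin chain Z c a b u -> w' \in Z -> e w w' ->
    tperm a b (c w) != c w'.
  move=> wc w'c w'Z ww'; apply: contraNneq w'c => eqc; apply: step ww' => //.
  have := sub _ wc; rewrite !inE w'Z /= -eqc => /andP[_ /orP[/eqP->|/eqP->]].
    by rewrite tpermL eqxx orbT.
  by rewrite tpermR eqxx.
rewrite /swap; case: ifP => xc; case: ifP => yc.
- by rewrite (inj_eq perm_inj) pc.
- by apply: out => //; apply/negbT.
- by rewrite eq_sym; apply: out => //; [apply/negbT | rewrite e_sym].
- exact: pc.
Qed.

Lemma kernel_perm (f g : V -> C) (l : seq V) :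
  (forall u v, u \in l -> v \in l -> (f u == f v) = (g u == g v)) ->
  exists s : {perm C}, forall u, u \in l -> s (f u) = g u.
Proof.
elim: l => [|x l IH] ker; first by exists 1%g.
have [|s sP] := IH; first by move=> u v ul vl; rewrite ker // inE ?ul ?vl orbT.
have ker' u : u \in l -> (f x == f u) = (g x == g u).
  by move=> ul; rewrite ker // inE ?eqxx ?ul ?orbT.
case: (boolP [exists y in l, f x == f y]).
  case/existsP=> y /andP[yl fxy]; exists s => u; rewrite inE => /orP[/eqP->|/sP //].
  by rewrite (eqP fxy) sP //; move: fxy; rewrite ker' // => /eqP.
rewrite negb_exists => /forallP nex.
(* The transposition moves none of the earlier values [g u], as they differ from both [s (f x)] and
   [g x]. *)
exists (s * tperm (s (f x)) (g x))%g => u; rewrite inE permM => /orP[/eqP->|ul].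
  by rewrite tpermL.
have := nex u; rewrite ul /= => nfx; rewrite (sP u) // tpermD //.
  by rewrite -(sP u) // (inj_eq perm_inj).
by rewrite -ker'.
Qed.

End Colouring.

(** * The two sides of a separator *)

(** The form in which criticality enters the rest of the proof: [U] spans the subgraph, [h] sends a
    vertex to the representative of its bag, and the last premise makes the minor proper. *)
Definition quotients_colourable (V : finType) (e : rel V) (q : nat) :=
  forall (U : {set V}) (h : V -> V), U != set0 ->
  (forall u, u \in U -> h u \in U) ->
  (forall u, u \in U -> connect (inner e [set w in U | h w == h u]) u (h u)) ->
  (exists v, v \notin U \/ h v <> v) ->
  exists f : V -> 'I_q, forall u v, u \in U -> v \in U ->
    (h u = h v -> f u = f v) /\ (e u v -> h u <> h v -> f u <> f v).

Section Sides.
Variables (V : finType) (e : rel V) (q : nat).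
Hypotheses (e_sym : symmetric e) (e_irr : irreflexive e)
  (quot : quotients_colourable e q)
  (ncol : forall c : V -> 'I_q, ~ colouring e setT c).

(** [X1] plays the role of a full component: contracted into one vertex, it becomes adjacent to all
    of [S]. *)
Definition full (S X : {set V}) := exists X1 : {set V},
  [/\ X1 \subset X, X1 != set0,
      forall u v, u \in X1 -> v \in X1 -> connect (inner e X1) u v &
      forall s, s \in S -> exists2 x, x \in X1 & e s x].

Definition sides (S X Y : {set V}) :=
  [/\ X :|: Y = ~: S, [disjoint X & Y],
      forall x y, x \in X -> y \in Y -> ~~ e x y, full S X & full S Y].

Lemma sidesC S X Y : sides S X Y -> sides S Y X.
Proof.
case=> XY dXY nXY fX fY; split=> //; first by rewrite setUC.
  by rewrite disjoint_sym.
by move=> x y xY yX; rewrite e_sym nXY.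
Qed.

Lemma side_notin S X Y u : sides S X Y -> u \in X -> u \notin S /\ u \notin Y.
Proof.
case=> XY dXY _ _ _ uX; split; last by rewrite (disjointFr dXY).
by have : u \in ~: S; [rewrite -XY inE uX | rewrite inE].
Qed.

Lemma glue S X Y (c1 c2 : V -> 'I_q) :
  sides S X Y -> colouring e (S :|: X) c1 -> colouring e (S :|: Y) c2 ->
  (forall u v, u \in S -> v \in S -> (c1 u == c1 v) = (c2 u == c2 v)) -> False.
Proof.
move=> sd p1 p2 ker; have [XY dXY nXY _ _] := sd.
have [|s sP] := @kernel_perm V _ c1 c2 (enum S).
  by move=> u v; rewrite !mem_enum; apply: ker.
have {}sP u : u \in S -> s (c1 u) = c2 u by move=> uS; rewrite sP // mem_enum.
apply: (ncol (c := fun u => if u \in Y then c2 u else s (c1 u))) => u v _ _ uv.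
have cov w : w \notin Y -> w \in S :|: X.
  move=> wY; rewrite inE; case: (boolP (w \in S)) => //= wS.
  have : w \in X :|: Y by rewrite XY inE.
  by rewrite inE (negbTE wY) orbF.
have mix w w' : e w w' -> w \in Y -> w' \notin Y -> c2 w != s (c1 w').
  move=> ww' wY w'Y; have := cov _ w'Y; rewrite inE => /orP[w'S|w'X].
    by rewrite sP // p2 // inE ?wY ?w'S ?orbT.
  by have := nXY _ _ w'X wY; rewrite e_sym ww'.
case: ifP => uY; case: ifP => vY.
- by rewrite p2 // inE ?uY ?vY orbT.
- by apply: mix => //; rewrite vY.
- by rewrite eq_sym mix ?uY // e_sym.
- by rewrite (inj_eq perm_inj) p1 // cov ?uY ?vY.
Qed.

(** Vertices of [X] outside the bags are deleted and those of [Y] stay as they are. As vertices of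
    [Y] carry [None], equal values of [bag] mean a common bag only outside [Y]; hence the premise
    [bag u = bag v -> u \in Y]. *)
Lemma contract_bags S X Y (T : eqType) (bag : V -> option T) :
  sides S X Y ->
  (forall v, bag v -> v \in S :|: X) ->
  (forall s, s \in S -> bag s) ->
  (forall v, bag v -> exists2 s, s \in S & bag s = bag v) ->
  (forall u v, bag u -> bag u = bag v -> connect (inner e [set w | bag w == bag u]) u v) ->
  exists f : V -> 'I_q,
    (forall u v, bag u -> bag u = bag v -> f u = f v) /\
    (forall u v, bag u || (u \in Y) -> bag v || (v \in Y) -> e u v ->
        (bag u = bag v -> u \in Y) -> f u <> f v).
Proof.
move=> sd bSX Sb bS bconn; have [XY dXY nXY [X1 [X1X /set0Pn[x0 x0X1] _ _]] [Y1 [Y1Y Y10 _ _]]] := sd.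
have bY v : v \in Y -> bag v = None.
  move=> vY; have [vS vX] := side_notin (sidesC sd) vY.
  by case E: (bag v) => [t|] //; have := bSX v; rewrite E inE (negbTE vS) (negbTE vX) => /(_ isT).
(* Representatives lie in [S], so a vertex of [X] is either deleted or moved by [h]; this makes the
   minor proper. *)
pose h v := if bag v then odflt v [pick s in S | bag s == bag v] else v.
have hb v : bag v -> h v \in S /\ bag (h v) = bag v.
  move=> bv; rewrite /h bv; case: pickP => [s /andP[sS /eqP //]|].
  by have [s sS sb] := bS v bv => /(_ s); rewrite sS sb eqxx.
have hE u v : bag u -> bag u = bag v -> h u = h v.
  move=> bu uv; have bv : bag v by rewrite -uv.
  rewrite /h bu bv uv; case: pickP => // N.
  by have [s sS sb] := bS v bv; have := N s; rewrite /= sS sb eqxx.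
pose U : {set V} := [set v | bag v || (v \in Y)].
have [||||f fP] := quot (U := U) (h := h).
- by have /set0Pn[y yY1] := Y10; apply/set0Pn; exists y; rewrite inE (subsetP Y1Y) // orbT.
- move=> u; rewrite inE; case: (boolP (bag u)) => [bu _|nbu /= uY].
    by have [_ hbu] := hb u bu; rewrite inE hbu bu.
  by rewrite /h (negbTE nbu) inE uY orbT.
- move=> u; rewrite inE; case: (boolP (bag u)) => [bu _|nbu uY]; last first.
    by rewrite /h (negbTE nbu) connect0.
  have [_ hbu] := hb u bu.
  apply: inner_connect_sub (bconn u (h u) bu (esym hbu)).
  by apply/subsetP => w; rewrite !inE => /eqP wu; rewrite wu bu /=; apply/eqP/hE; rewrite ?wu.
- have x0X := subsetP X1X _ x0X1; have [x0S x0Y] := side_notin sd x0X.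
  exists x0; case: (boolP (bag x0)) => b0; last by left; rewrite inE (negbTE b0).
  by right=> hx0; have [] := hb x0 b0; rewrite hx0 (negbTE x0S).
exists f; split=> [u v bu uv | u v bu bv uv nbag].
  by have [|| + _] := fP u v; rewrite ?inE -?uv ?bu //; apply; apply: hE.
have [|| _] := fP u v; rewrite ?inE //; apply=> // huv.
case: (boolP (u \in Y)) => uY.
  case: (boolP (v \in Y)) => vY.
    by move: huv uv; rewrite /h !bY //= => ->; rewrite e_irr.
  have bv' : bag v by move: bv; rewrite (negbTE vY) orbF.
  have [+ _] := hb v bv'; rewrite -huv /h bY //= => uS.
  by have [/negP] := side_notin (sidesC sd) uY.
have bu' : bag u by move: bu; rewrite (negbTE uY) orbF.
have [huS hub] := hb u bu'.
case: (boolP (v \in Y)) => vY.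
  by move: huS; rewrite huv /h bY //= => vS; have [/negP] := side_notin (sidesC sd) vY.
have bv' : bag v by move: bv; rewrite (negbTE vY) orbF.
have [_ hvb] := hb v bv'.
by move/negP: uY; apply; apply: nbag; rewrite -hub -hvb huv.
Qed.

(** The full part of [X] is contracted together with [I] into one vertex. It is adjacent to all
    other vertices of [S], so none of them gets the colour of [I]; independence of [I] allows the
    contraction to be undone. *)
Lemma side_class S X Y (I : {set V}) :
  sides S X Y -> I \subset S -> I != set0 ->
  (forall u v, u \in I -> v \in I -> ~~ e u v) ->
  exists c : V -> 'I_q, colouring e (S :|: Y) c /\
    forall u v, u \in I -> v \in S -> (c u == c v) = (v \in I).
Proof.
move=> sd IS /set0Pn[i0 i0I] Iind.
have [XY dXY nXY [X1 [X1X /set0Pn[x0 x0X1] X1conn X1full]] _] := sd.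
have XS v : v \in X1 -> v \notin S by move=> /(subsetP X1X)/(side_notin sd)[].
have iS v : v \in I -> v \in S by apply/subsetP.
pose bag v := if v \in X1 :|: I then Some i0 else if v \in S then Some v else None.
have [||||f [f1 f2]] := @contract_bags S X Y V bag sd.
- move=> v; rewrite /bag; case: ifP => [|_]; last by case: ifP => // vS; rewrite inE vS.
  by rewrite !inE => /orP[/(subsetP X1X) ->|/iS ->]; rewrite ?orbT.
- by move=> s sS; rewrite /bag sS; case: ifP.
- move=> v; case: (boolP (v \in S)) => vS; first by exists v.
  rewrite /bag; case: ifP => [_ _|_]; last by rewrite (negbTE vS).
  by exists i0; [apply: iS | rewrite inE i0I orbT].
- move=> u v bu uv.
  case: (boolP (u \in X1 :|: I)) => uXI; last first.
    suff -> : u = v by [].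
    move: bu uv; rewrite /bag (negbTE uXI); case: ifP => // uS _.
    case: ifP => [_ [ui]|_]; last by case: ifP => // _ [].
    by move: uXI; rewrite ui inE i0I orbT.
  have bagE w : w \in X1 :|: I -> bag w == bag u by rewrite /bag uXI => ->.
  have vXI : v \in X1 :|: I.
    apply: contraT => nv; move: uv; rewrite /bag uXI (negbTE nv).
    case: ifP => // vS [iv]; by move: nv; rewrite -iv inE i0I orbT.
  suff conn w : w \in X1 :|: I -> connect (inner e [set w | bag w == bag u]) x0 w.
    by apply: connect_trans (conn v vXI); rewrite inner_csym //; apply: conn.
  have X1b : X1 \subset [set w | bag w == bag u].
    by apply/subsetP => z zX; rewrite inE bagE // inE zX.
  move=> wXI; move: (wXI); rewrite inE => /orP[wX|wI].
    exact: inner_connect_sub X1b (X1conn _ _ x0X1 wX).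
  have [x xX wx] := X1full _ (iS _ wI).
  apply: connect_trans (inner_connect_sub X1b (X1conn _ _ x0X1 xX)) (connect1 _).
  have xXI : x \in X1 :|: I by rewrite inE xX.
  by rewrite /inner !inE !bagE //= e_sym.
have bI v : v \in I -> bag v = Some i0 by rewrite /bag !inE => ->; rewrite orbT.
have bS v : v \in S -> v \notin I -> bag v = Some v.
  move=> vS vI; rewrite /bag !inE vS (negbTE vI) orbF.
  by rewrite (negbTE (contraL (XS v) vS)).
exists f; split=> [u v|u v uI vS]; last first.
  case: (boolP (v \in I)) => vI; first by apply/eqP/f1; rewrite !bI.
  apply/negbTE/eqP; have [x xX vx] := X1full _ vS.
  have bx : bag x = Some i0 by rewrite /bag inE xX.
  have -> : f u = f x by apply: f1; rewrite bI ?bx.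
  apply: f2; rewrite ?bx ?(bS v) //; first by rewrite e_sym.
  by case=> iv; rewrite -iv i0I in vI.
rewrite !inE => uSY vSY uv; apply/eqP/f2 => //.
- by case/orP: uSY => uS; rewrite ?uS ?orbT // /bag uS; case: ifP.
- by case/orP: vSY => uS; rewrite ?uS ?orbT // /bag uS; case: ifP.
case/orP: uSY => // uS; case/orP: vSY => [vS|vY]; last first.
  have [vS vX] := side_notin (sidesC sd) vY.
  have -> : bag v = None.
    rewrite /bag (negbTE vS) inE; case: ifP => // /orP[/(subsetP X1X)|/iS].
      by rewrite (negbTE vX).
    by rewrite (negbTE vS).
  by rewrite /bag uS; case: ifP.
case: (boolP (u \in I)) => uI; case: (boolP (v \in I)) => vI.
- by have := Iind _ _ uI vI; rewrite uv.
- by rewrite bI // bS // => -[iv]; rewrite -iv i0I in vI.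
- by rewrite bS // bI // => -[iv]; rewrite iv i0I in uI.
- by rewrite !bS // => -[E]; rewrite E e_irr in uv.
Qed.

End Sides.

(** * Growing and merging bags *)

Section Key.
Variable p : nat.
Implicit Types A B : {set 'I_p}.

(** A linear order on sets of nodes that extends inclusion and compares lexicographically, the
    smallest nodes weighing most. Both features are used in [growth_scatter] to decide which item
    comes first. *)
Definition key A := \sum_(i in A) 2 ^ (p - i).

Lemma key_proper A B : A \proper B -> key A < key B.
Proof.
case/properP=> AB [i iB iA]; rewrite /key [X in _ < X](big_setID A) /= (setIidPr AB).
rewrite -[X in X < _]addn0 ltn_add2l (bigD1 i) /= ?inE ?iA //.
by rewrite ltn_addr // expn_gt0.
Qed.

Lemma sum_pow_lt (j : nat) : \sum_(i < p | j < i) 2 ^ (p - i) < 2 ^ (p - j).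
Proof.
case: (ltnP j p) => jp; last first.
  rewrite big_pred0 ?expn_gt0 // => i; apply/negbTE; rewrite -leqNgt.
  by apply: leq_trans jp; apply: ltnW.
have -> : j = p - (p - j) by lia.
have := leq_subr j p; move: (p - j) => d dp; rewrite subKn //.
elim: d dp => [|d IH] dp.
  rewrite subn0 big_pred0 // => i; apply/negbTE; rewrite -leqNgt; exact: ltnW.
have lt : p - d.+1 < p by lia.
case: d => [|d] in IH dp lt *.
  rewrite big_pred0 // => i; apply/negbTE; have := ltn_ord i; lia.
have lt' : p - d.+1 < p by lia.
rewrite (bigD1 (Ordinal lt')) /=; last by lia.
rewrite (_ : p - (p - d.+1) = d.+1); last by lia.
rewrite [X in _ < X]expnS mul2n -addnn ltn_add2l.
rewrite (eq_bigl (fun i : 'I_p => p - d.+1 < i)); first by apply: IH; lia.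
by move=> i; rewrite -val_eqE /=; lia.
Qed.

Lemma key_lt A B (j : 'I_p) : j \in B -> j \notin A ->
  (forall i : 'I_p, i < j -> (i \in A) = (i \in B)) -> key A < key B.
Proof.
move=> jB jA AB.
rewrite /key (bigID (fun i : 'I_p => i < j)) [X in _ < X](bigID (fun i : 'I_p => i < j)) /=.
have -> : \sum_(i in A | i < j) 2 ^ (p - i) = \sum_(i in B | i < j) 2 ^ (p - i).
  by apply: eq_bigl => i; case: (ltnP i j) => ij; rewrite ?andbF // !andbT AB.
rewrite ltn_add2l [X in _ < X](bigD1 j) /=; last by rewrite jB ltnn.
apply: leq_trans (leq_addr _ _).
apply: leq_ltn_trans (sum_pow_lt j); rewrite [X in X <= _]big_mkcond [X in _ <= X]big_mkcond /=.
apply: leq_sum => i _; case: ifP => //; rewrite -leqNgt => /andP[iA ji].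
by rewrite ltn_neqAle ji andbT; case: eqP => // E; move: jA; rewrite (val_inj E) iA.
Qed.

End Key.

Section Growth.
Variables (V C : finType) (e : rel V) (p : nat).
Hypothesis e_sym : symmetric e.
Variables (Z : {set V}) (c : V -> C) (own : C -> option 'I_p) (W : 'I_p -> {set V}).
Hypotheses
  (W_Z : forall t, W t \subset Z)
  (W_own : forall t v, v \in W t -> own (c v) = Some t)
  (W_closed : forall t u v, u \in W t -> v \in Z -> e u v -> own (c v) = Some t -> v \in W t)
  (W_conn : forall t u v, u \in W t -> v \in W t -> connect (inner e (W t)) u v).
(** The reserved colour [x T b] need not tell whether [r b] belongs to [T]. Leaving out this node
    about halves the number of colours to reserve, and the order of the items resolves the conflicts
    that it creates. *)
Variables (TT : pred {set 'I_p}) (x : {set 'I_p} -> 'I_p -> C) (r : 'I_p -> 'I_p).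
Hypotheses
  (x_own : forall T t, TT T -> t \in T -> own (x T t) = Some t)
  (x_pre : forall T1 T2 b, TT T1 -> TT T2 -> b \in T1 -> b \in T2 -> x T1 b = x T2 b ->
     forall j : 'I_p, j < b -> j != r b -> (j \in T1) = (j \in T2)).

(* The nodes ['I_p] stand for the colour classes on the separator, [own] splits the colours among
   them, and [W t] is the initial bag of the node [t].  [TT] is the family of candidate sets of
   nodes, and [x T t] is the colour of [t] reserved for merging [T]. *)
Definition upto (T : {set 'I_p}) (t : 'I_p) := [set j in T | j <= t].

(** In [merge] a node [t] of [T] passes only through colours reserved for the nodes [b >= t] of [T].
    Of [T] itself the item keeps just the trace up to [t], so it serves every candidate set with
    that trace. *)
Definition palette (it : {set 'I_p} * 'I_p) (col : C) :=
  [exists T : {set 'I_p}, [&& TT T, it.2 \in T, upto T it.2 == it.1 &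
     [exists b in T, (it.2 <= b) && (x T b == col)]]].

Definition unowned v := [forall t, v \notin W t].

(* [B] is the family of bags after the items [cs] have been processed in order: the item [(A, t)]
   lets the bag of [t] absorb the free vertices that it reaches with colours of [palette (A, t)]. *)
Record growth (cs : seq ({set 'I_p} * 'I_p)) (B : 'I_p -> {set V}) : Prop := Growth {
  gr_W : forall t, W t \subset B t;
  gr_Z : forall t, B t \subset Z;
  gr_conn : forall t u v, u \in B t -> v \in B t -> connect (inner e (B t)) u v;
  gr_disj : forall t t' v, v \in B t -> v \in B t' -> t = t';
  gr_pal : forall t v, v \in B t -> v \notin W t -> unowned v /\
     (exists2 it, it \in cs & it.2 = t /\ palette it (c v));
  gr_reach : forall cs1 it cs2, cs = cs1 ++ it :: cs2 -> exists R : {set V},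
     [/\ W it.2 \subset R, R \subset B it.2 &
      forall u v, u \in R -> v \in Z -> e u v -> palette it (c v) -> unowned v ->
       v \in R \/ exists it', [/\ it' \in cs1, it'.2 != it.2, v \in B it'.2 & palette it' (c v)]]
}.

Lemma W_disj t t' v : v \in W t -> v \in W t' -> t = t'.
Proof. by move=> /W_own h /W_own; rewrite h => -[]. Qed.

Lemma growth_step cs B it : growth cs B -> exists B', growth (rcons cs it) B'.
Proof.
case=> gW gZ gconn gdisj gpal greach.
pose U : {set V} := [set v in Z | [forall t, v \notin B t] && palette it (c v)].
pose N : {set V} := [set v | [exists w in U, [exists u in B it.2, e u w && connect (inner e U) w v]]].
have NU v : v \in N -> v \in U.
  rewrite inE => /existsP[w /andP[wU /existsP[u /and3P[uB uw wv]]]].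
  case: (eqVneq w v) => [<- //|neq]; by have [] := inner_connect_in e_sym wv neq.
have NB t v : v \in N -> v \notin B t.
  by move=> /NU; rewrite inE => /and3P[_ /forallP/(_ t)].
pose B' t := if t == it.2 then B t :|: N else B t.
have BB' t : B t \subset B' t by rewrite /B'; case: ifP => // _; exact: subsetUl.
have B'E t v : v \in B' t -> v \in B t \/ t = it.2 /\ v \in N.
  by rewrite /B'; case: eqP => [->|]; [rewrite in_setU => /orP[]; auto | left].
exists B'; split.
- by move=> t; apply: subset_trans (gW t) (BB' t).
- move=> t; apply/subsetP => v /B'E[/(subsetP (gZ t)) //|[_ /NU]].
  by rewrite inE => /andP[].
- move=> t.
  case: (eqVneq t it.2) => [tit|nt]; last by rewrite /B' (negbTE nt); apply: gconn.
  have NN w v : w \in N -> connect (inner e U) w v -> connect (inner e (B' t)) w v.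
    move=> wN wv; pose M z := (z \in N) && connect (inner e (B' t)) w z.
    suff : M v by case/andP.
    have Mw : M w by rewrite /M wN connect0.
    apply: (connect_invariant (P := M) _ Mw wv).
    move=> a b /andP[aN wa] /and3P[aU bU ab].
    have bN : b \in N.
      move: aN; rewrite !inE => /existsP[w' /andP[w'U /existsP[u /and3P[uB uw' w'a]]]].
      apply/existsP; exists w'; rewrite w'U; apply/existsP; exists u; rewrite uB uw' /=.
      by apply: connect_trans w'a (connect1 _); rewrite /inner aU bU.
    have NB' z : z \in N -> z \in B' t by move=> zN; rewrite /B' tit eqxx in_setU zN orbT.
    rewrite /M bN /=.
    by apply: connect_trans wa (connect1 _); rewrite /inner !NB' // inE.
  have star v : v \in B' t -> exists2 u, u \in B t & connect (inner e (B' t)) u v.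
    case/B'E => [vB|[_ vN]]; first by exists v; rewrite ?connect0.
    move: (vN); rewrite inE => /existsP[w /andP[wU /existsP[u /and3P[uB uw wv]]]].
    rewrite -tit in uB; exists u => //.
    have wN : w \in N.
      rewrite inE; apply/existsP; exists w; rewrite wU; apply/existsP; exists u.
      by rewrite -tit uB uw connect0.
    apply: connect_trans (NN _ _ wN wv); apply: connect1.
    by rewrite /inner uw (subsetP (BB' t)) // /B' tit eqxx in_setU wN orbT.
  move=> u v /star[u' u'B uu'] /star[v' v'B vv'].
  apply: connect_trans vv'; rewrite inner_csym // in uu'.
  apply: connect_trans uu' _; exact: inner_connect_sub (BB' t) (gconn _ _ _ u'B v'B).
- move=> t t' v /B'E[vt|[-> vN]] /B'E[vt'|[-> vN']] //.
  + exact: gdisj vt vt'.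
  + by have := NB t v vN'; rewrite vt.
  + by have := NB t' v vN; rewrite vt'.
- move=> t v /B'E[vt nW|[-> vN] nW].
    have [un [it' it'cs P]] := gpal t v vt nW; split=> //; exists it' => //.
    by rewrite mem_rcons inE it'cs orbT.
  have := NU v vN; rewrite inE => /and3P[vZ /forallP nB pv]; split.
    by apply/forallP => t'; apply: contra (nB t'); apply: (subsetP (gW t')).
  by exists it; rewrite // mem_rcons mem_head.
(* For the new item the witness is its bag right after the step; for an earlier item the old witness
   remains valid because bags only grow. *)
- move=> cs1 it0 cs2; case: (lastP cs2) => [|cs2' it1].
    rewrite cats1 => /rcons_inj[<- <-]; exists (B' it.2); split=> //.
      exact: subset_trans (gW _) (BB' _).
    move=> u v uR vZ uv pv unv.
    case: (boolP [forall t, v \notin B t]) => [nB|]; last first.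
      rewrite negb_forall => /existsP[t]; rewrite negbK => vt.
      case: (eqVneq t it.2) => [tit|nt]; first by left; apply: (subsetP (BB' _)); rewrite -tit.
      have [_ [it' it'cs [it't pv']]] := gpal t v vt (forallP unv t).
      by right; exists it'; rewrite it't; split=> //; apply: (subsetP (BB' t)).
    have vU : v \in U by rewrite inE vZ nB pv.
    left; rewrite /B' eqxx in_setU; apply/orP; right.
    case/B'E: uR => [uB|[_ uN]].
      rewrite inE; apply/existsP; exists v; rewrite vU; apply/existsP; exists u.
      by rewrite uB uv connect0.
    have uU := NU _ uN.
    move: uN; rewrite !inE => /existsP[w /andP[wU /existsP[u' /and3P[u'B u'w wu]]]].
    apply/existsP; exists w; rewrite wU; apply/existsP; exists u'; rewrite u'B u'w /=.
    by apply: connect_trans wu (connect1 _); rewrite /inner uU vU.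
  rewrite -rcons_cons -rcons_cat => /rcons_inj[csE _].
  have [R [WR RB HR]] := greach _ _ _ csE; exists R; split=> //.
    exact: subset_trans RB (BB' _).
  move=> u v uR vZ uv pv unv; have [|[it' [? ? vB ?]]] := HR u v uR vZ uv pv unv; first by left.
  by right; exists it'; split=> //; apply: (subsetP (BB' _)).
Qed.

Lemma growth_exists cs : exists B, growth cs B.
Proof.
elim/last_ind: cs => [|cs it [B gB]]; last exact: growth_step gB.
exists W; split=> //.
- exact: W_disj.
- by move=> t v ->.
- by case.
Qed.

Definition items := sort (fun a b => key a.1 <= key b.1) (enum {: {set 'I_p} * 'I_p}).

Definition independent (B : 'I_p -> {set V}) (T : {set 'I_p}) :=
  forall t t' u v, t \in T -> t' \in T -> t != t' -> u \in B t -> v \in B t' -> ~~ e u v.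

(* A vertex missed by the bag of [i] was taken earlier by some node [t] outside [T], for the sake of
   another candidate set agreeing with [T] below [b] except at [t]; but then the order of [key] puts
   the item of [t] after that of [i]. *)
Lemma growth_scatter B T i : growth items B -> TT T -> independent B T -> i \in T ->
  exists R : {set V}, [/\ W i \subset R, R \subset B i &
    forall u v b, u \in R -> v \in Z -> e u v -> unowned v -> b \in T -> i <= b ->
      c v = x T b -> v \in R].
Proof.
move=> gB TT_T ind iT.
have : (upto T i, i) \in items by rewrite mem_sort mem_enum.
case/path.splitPr E: {1}items / => [cs1 cs2].
have [R [WR RB HR]] := gr_reach gB E; exists R; split=> // u v b uR vZ uv unv bT ib cv.
have pv : palette (upto T i, i) (c v).
  apply/existsP; exists T; rewrite TT_T iT eqxx /=; apply/existsP; exists b.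
  by rewrite bT ib cv eqxx.
have [//|[[A t] [/= Acs1 nti vBt]]] := HR u v uR vZ uv pv unv.
case/existsP=> T2 /and4P[/= TT2 tT2 /eqP AE /existsP[b2 /and3P[b2T2 tb2 /eqP xb2]]].
have eqb : b2 = b.
  by have := x_own TT2 b2T2; rewrite xb2 cv x_own // => -[].
subst b2; have agree := x_pre TT_T TT2 bT b2T2 (etrans (esym cv) (esym xb2)).
exfalso.
have tT : t \notin T.
  apply/negP => tT; have := ind i t u v iT tT.
  by rewrite eq_sym nti (subsetP RB) // vBt uv => /(_ isT isT isT).
have tb : t < b.
  by rewrite ltn_neqAle tb2 andbT; apply: contraNneq tT => /val_inj->.
have tr : t = r b.
  by apply/eqP; apply: contraNT tT => ntr; rewrite agree.
suff : key (upto T i) < key A.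
  rewrite ltnNge => /negP; apply.
  have : sorted (fun a b => key a.1 <= key b.1) items.
    by apply: sort_sorted => a b'; apply: leq_total.
  rewrite sorted_pairwise; last by move=> a b' d; apply: leq_trans.
  rewrite E pairwise_cat => /and3P[/allrelP H _ _].
  by apply: (H (A, t) (upto T i, i)); rewrite ?mem_head.
(* If [i < t], the trace of [T] up to [i] is a proper subset of [A]. If [t < i], the two traces
   agree below [t], and only [A] contains [t]. *)
case: (ltngtP i t) => [it|ti|E']; last by move: tT; rewrite -(val_inj E') iT.
- apply: key_proper; apply/properP; split; last first.
    exists t; first by rewrite -AE inE tT2 /=.
    by rewrite inE (negbTE tT).
  apply/subsetP => j; rewrite -AE !inE => /andP[jT ji].
  have jt := leq_ltn_trans ji it.
  rewrite -agree ?jT ?(ltnW jt) //; first exact: ltn_trans jt tb.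
  by rewrite -tr -val_eqE /= neq_ltn jt.
- apply: (key_lt (j := t)); first by rewrite -AE inE tT2 /=.
    by rewrite inE (negbTE tT).
  move=> j jt; rewrite -AE !inE (ltnW (ltn_trans jt ti)) (ltnW jt) !andbT.
  apply: agree; first exact: ltn_trans jt tb.
  by rewrite -tr -val_eqE /= neq_ltn jt.
Qed.

Variables (S : {set V}) (base : 'I_p -> C).
Hypotheses (c_col : colouring e Z c) (base_own : forall t, own (base t) = Some t)
  (S_Z : S \subset Z)
  (S_W : forall s t, s \in S -> c s = base t -> s \in W t).

Definition owned_in (T : {set 'I_p}) (col : C) := if own col is Some t then t \in T else false.

(* Each class of [T] is first moved to its own colour [x T t]; then, from the
   largest node downwards, a Kempe change gives it the colour of the last node. *)
Lemma merge B T : growth items B -> TT T -> independent B T -> T != set0 ->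
  exists (c' : V -> C) (col : C),
  [/\ colouring e Z c',
      forall v, owned_in T (c' v) = owned_in T (c v),
      forall v, ~~ owned_in T (c v) -> c' v = c v,
      owned_in T col &
      forall s t, s \in S -> t \in T -> c s = base t -> c' s = col].
Proof.
move=> gB TT_T ind /set0Pn[t0 t0T].
(* [W t] is closed under adjacency through colours owned by [t], so exchanging [base t] and [x T t]
   on it alone keeps the colouring proper. *)
pose c0 v := if own (c v) is Some t then
    if (t \in T) && (v \in W t) then tperm (base t) (x T t) (c v) else c v else c v.
have own0 v : own (c0 v) = own (c v).
  rewrite /c0; case E: (own (c v)) => [t|//]; case: ifP => // /andP[tT _].
  by case: tpermP => // _; rewrite ?base_own ?x_own.
have c0_col : colouring e Z c0.
  move=> u v uZ vZ uv; apply: contra_neq (c_col uZ vZ uv) => E.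
  have : own (c u) = own (c v) by rewrite -!own0 E.
  move: E; rewrite /c0; case Eu: (own (c u)) => [t|] + Ev; rewrite -Ev //.
  case: (boolP (t \in T)) => //= tT.
  have -> : (u \in W t) = (v \in W t).
    by apply/idP/idP => h; apply: W_closed h _ _ _; rewrite // e_sym.
  by case: ifP => // _ /perm_inj.
have [j jT jmax] : exists2 j, j \in T & forall t, t \in T -> t <= j.
  by exists [arg max_(j > t0 | j \in T) (j : nat)]; case: arg_maxnP => // j jT jm.
pose f := x T j.
(* The colours reserved for the nodes of [T] from [m] on. The stage of node [i] recolours only
   vertices coloured from [Col i], and stays within [Col i]. *)
pose Col (m : nat) col := [exists b in T, (m <= b) && (x T b == col)].
have ColS m m' col : m <= m' -> Col m' col -> Col m col.
  move=> mm /existsP[b /and3P[bT mb xb]]; apply/existsP; exists b.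
  by rewrite bT xb (leq_trans mm).
have Colf m : m <= j -> Col m f.
  by move=> mj; apply/existsP; exists j; rewrite jT mj eqxx.
have Col_own m col t : Col m col -> own col = Some t -> t \in T /\ m <= t.
  by case/existsP=> b /and3P[bT mb /eqP <-]; rewrite x_own // => -[<-].
suff [c' [c'col P1 P2 P3]] : exists c', [/\ colouring e Z c',
    forall v, ~~ Col 0 (c0 v) -> c' v = c0 v, forall v, Col 0 (c0 v) -> Col 0 (c' v) &
    forall s t, s \in S -> t \in T -> 0 <= t -> c s = base t -> c' s = f].
  have Col_ow col : Col 0 col -> owned_in T col.
    by case/existsP=> b /and3P[bT _ /eqP <-]; rewrite /owned_in x_own.
  have ow0 v : owned_in T (c0 v) = owned_in T (c v) by rewrite /owned_in own0.
  exists c', f; split=> //.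
  - move=> v; rewrite -ow0; case: (boolP (Col 0 (c0 v))) => h; last by rewrite P1.
    by rewrite (Col_ow _ h) (Col_ow _ (P2 _ h)).
  - move=> v nv; rewrite P1; last by apply: contra nv => /Col_ow; rewrite ow0.
    move: nv; rewrite /owned_in /c0; case: (own (c v)) => // t tT.
    by rewrite (negbTE tT).
  - exact: Col_ow (Colf 0 _).
  - by move=> s t sS tT; apply: P3.
have {}main : forall d, exists c', [/\ colouring e Z c',
    forall v, ~~ Col (p - d) (c0 v) -> c' v = c0 v,
    forall v, Col (p - d) (c0 v) -> Col (p - d) (c' v) &
    forall s t, s \in S -> t \in T -> p - d <= t -> c s = base t -> c' s = f];
  last by have := main p; rewrite subnn.
elim=> [|d [c1 [c1_col Q1 Q2 Q3]]].
  exists c0; split=> // s t; rewrite subn0 => _ _ pt; have := ltn_ord t; lia.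
case: (leqP p d) => pd.
  by exists c1; rewrite (_ : p - d.+1 = p - d) //; lia.
have mp : p - d.+1 < p by lia.
pose i := Ordinal mp; have ei : p - d = (i : nat).+1 by rewrite /=; lia.
rewrite ei in Q1 Q2 Q3; rewrite -[p - d.+1]/(i : nat).
case: (boolP (i \in T)) => iT; last first.
  have ColE col : Col i col = Col i.+1 col.
    apply/existsP/existsP => -[b /and3P[bT mb xb]]; exists b; rewrite bT xb ?andbT.
      rewrite ltn_neqAle mb andbT; apply: contraNneq iT => /val_inj -> //.
    exact: ltnW.
  exists c1; split=> //.
  + by move=> v; rewrite ColE; apply: Q1.
  + by move=> v; rewrite !ColE; apply: Q2.
  + move=> s t sS tT it; apply: Q3 => //.
    rewrite ltn_neqAle it andbT; apply: contraNneq iT => /val_inj -> //.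
have [R [WR RB HR]] := growth_scatter gB TT_T ind iT.
pose A : {set V} := [set v in Z | Col i (c0 v)].
(* [Y] is a union of components of the subgraph that [c0] colours from [Col i]; earlier stages moved
   colours only within [Col i.+1], so this also holds for [c1]. By [growth_scatter] it stays inside
   the bag of [i], hence misses the initial bags of the other nodes of [T]. *)
pose Y : {set V} := [set v in A | [exists u in W i, connect (inner e A) u v]].
have YR v : v \in Y -> v \in R.
  rewrite inE => /andP[vA /existsP[u /andP[uW uv]]].
  apply: (connect_invariant (P := fun z => z \in R) _ _ uv); last exact: (subsetP WR).
  move=> a b aR /and3P[_ bA ab]; move: (bA); rewrite inE => /andP[bZ Cb].
  case: (boolP (unowned b)) => [ub|].
    have cb : c b = c0 b.
      rewrite /c0; case: (own (c b)) => // t; by rewrite (negbTE (forallP ub t)) andbF.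
    move: (Cb) => /existsP[k /and3P[kT ik /eqP xk]].
    by apply: (HR a b k) => //; rewrite cb xk.
  rewrite negb_forall => /existsP[t]; rewrite negbK => bW.
  have ob := W_own bW; have [tT it] := Col_own _ _ _ Cb (etrans (own0 b) ob).
  case: (eqVneq t i) => [ti|nti]; first by apply: (subsetP WR); rewrite -ti.
  have := ind i t a b iT tT; rewrite eq_sym nti (subsetP RB) // ab.
  by rewrite (subsetP (gr_W gB t)) // => /(_ isT isT isT).
have YW t v : t \in T -> t != i -> v \in W t -> v \notin Y.
  move=> tT ti vW; apply/negP => /YR/(subsetP RB) vB.
  by move: ti; rewrite (gr_disj gB (subsetP (gr_W gB t) _ vW) vB) eqxx.
have YA v : v \in Y -> v \in A by rewrite inE => /andP[].
have Yout u v : u \in Y -> v \notin Y -> v \in Z -> e u v -> ~~ Col i (c0 v).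
  move=> uY vY vZ uv; apply: contra vY => Cv.
  have vA : v \in A by rewrite inE vZ.
  move: (uY); rewrite !inE => /andP[_ /existsP[w /andP[wW wu]]].
  rewrite vZ Cv /=; apply/existsP; exists w; rewrite wW.
  by apply: connect_trans wu (connect1 _); rewrite /inner (YA _ uY) vA.
pose c2 v := if v \in Y then tperm (x T i) f (c1 v) else c1 v.
have Ci : Col i (x T i) by apply/existsP; exists i; rewrite iT leqnn eqxx.
have Cf : Col i f by apply: Colf; apply: jmax.
have Ct col : Col i col -> Col i (tperm (x T i) f col) by case: tpermP.
have C1 v : Col i (c0 v) -> Col i (c1 v).
  move=> Cv; case: (boolP (Col i.+1 (c0 v))) => h; last by rewrite Q1.
  exact: ColS (leqnSn i) (Q2 _ h).
have C1n v : ~~ Col i (c0 v) -> c1 v = c0 v.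
  by move=> h; apply: Q1; apply: contra h; apply: ColS (leqnSn i).
exists c2; split.
- move=> u v uZ vZ uv; rewrite /c2; case: ifP => uY; case: ifP => vY.
  + by rewrite (inj_eq perm_inj) c1_col.
  + have nv := Yout u v uY (negbT vY) vZ uv; apply: contraNneq nv => E.
    rewrite -C1n // -?E; last exact: Yout uY (negbT vY) vZ uv.
    by apply: Ct; apply: C1; move/YA: uY; rewrite inE => /andP[].
  + have nu : ~~ Col i (c0 u) by apply: Yout vY (negbT uY) uZ _; rewrite e_sym.
    rewrite eq_sym; apply: contraNneq (nu) => E; rewrite -C1n // -E.
    by apply: Ct; apply: C1; move/YA: vY; rewrite inE => /andP[].
  + exact: c1_col.
- move=> v nv; rewrite /c2 C1n //; case: ifP => // /YA; rewrite inE.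
  by rewrite (negbTE nv) andbF.
- by move=> v Cv; rewrite /c2; case: ifP => _; [apply: Ct|]; apply: C1.
- move=> s t sS tT it cs; have sW := S_W sS cs.
  have c0s : c0 s = x T t by rewrite /c0 cs base_own tT sW tpermL.
  case: (eqVneq t i) => [ti|ti]; last first.
    rewrite /c2 (negbTE (YW t s tT ti sW)); apply: Q3 cs => //.
    by rewrite ltn_neqAle it andbT eq_sym.
  have sY : s \in Y.
    rewrite inE inE (subsetP S_Z) // c0s ti Ci /=; apply/existsP; exists s.
    by rewrite -ti sW connect0.
  rewrite /c2 sY Q1 c0s ti ?tpermL //; apply/negP => /Col_own/(_ (x_own TT_T iT))[_].
  by rewrite ltnn.
Qed.

(** Merging a fibre of [f] affects only colours owned by its nodes, so all fibres can be merged at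
    once: a vertex follows the recolouring of the fibre that owns its colour. *)
Lemma merge_all B (D : eqType) (f : 'I_p -> D) : growth items B ->
  (forall t, TT [set t' | f t' == f t]) ->
  (forall t, independent B [set t' | f t' == f t]) ->
  exists c' : V -> C, colouring e Z c' /\
    forall s s' t t', s \in S -> s' \in S -> c s = base t -> c s' = base t' ->
      (c' s == c' s') = (f t == f t').
Proof.
move=> gB fTT find; pose F t := [set t' | f t' == f t].
pose rp t := odflt t [pick t' in F t].
have rpF t : f (rp t) = f t.
  by rewrite /rp; case: pickP => //= t'; rewrite inE => /eqP.
have rpE t t' : f t = f t' -> rp t = rp t'.
  move=> E; rewrite /rp; have -> : F t = F t' by apply/setP=> z; rewrite !inE E.
  by case: pickP => // /(_ t'); rewrite inE eqxx.
have /fin_all_exists[G GP] t : exists y : (V -> C) * C,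
  [/\ colouring e Z y.1, forall v, owned_in (F t) (y.1 v) = owned_in (F t) (c v),
      owned_in (F t) y.2 &
      forall s t', s \in S -> t' \in F t -> c s = base t' -> y.1 s = y.2].
  have T0 : F t != set0 by apply/set0Pn; exists t; rewrite inE.
  have [c' [col [h1 h2 _ h4 h5]]] := merge gB (fTT t) (find t) T0.
  by exists (c', col).
pose c' v := if own (c v) is Some t then (G (rp t)).1 v else c v.
have inF t : t \in F (rp t) by rewrite inE rpF.
have own' v t : own (c v) = Some t -> owned_in (F (rp t)) (c' v).
  move=> ot; rewrite /c' ot; have [_ -> _ _] := GP (rp t).
  by rewrite /owned_in ot.
have own'_inv v t : owned_in (F t) (c' v) -> exists2 t', own (c v) = Some t' & f t' = f t.
  move=> h; case E: (own (c v)) => [t'|]; last by move: h; rewrite /c' E /owned_in E.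
  exists t' => //; have := own' _ _ E; move: h; rewrite /owned_in.
  by case: (own (c' v)) => // z; rewrite !inE rpF => /eqP <- /eqP.
exists c'; split.
- move=> u v uZ vZ uv; apply/negP => /eqP E.
  case Eu: (own (c u)) => [t|].
    have [t' Ev ft] : exists2 t', own (c v) = Some t' & f t' = f (rp t).
      by apply: own'_inv; rewrite -E; apply: own'.
    have [col _ _ _] := GP (rp t); have := col u v uZ vZ uv.
    by move: E; rewrite /c' Eu Ev (rpE t' t) ?ft ?rpF // => ->; rewrite eqxx.
  case Ev: (own (c v)) => [t|].
    by have [t'] : exists2 t', own (c u) = Some t' & f t' = f (rp t);
       [apply: own'_inv; rewrite E; apply: own' | rewrite Eu].
  by move: E (c_col uZ vZ uv); rewrite /c' Eu Ev => ->; rewrite eqxx.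
- move=> s s' t t' sS sS' cs cs'; have os : own (c s) = Some t by rewrite cs.
  have os' : own (c s') = Some t' by rewrite cs'.
  apply/eqP/eqP => [E|E].
    have [t2] : exists2 t2, own (c s') = Some t2 & f t2 = f (rp t).
      by apply: own'_inv; rewrite -E; apply: own'.
    by rewrite os' rpF => -[->].
  have [_ _ _ H] := GP (rp t).
  rewrite /c' os os' -(rpE _ _ E) (H s t) // (H s' t') //.
  by rewrite inE rpF E.
Qed.

End Growth.

(** * Contracting the bags for the other side *)

Section Engine.
Variables (V : finType) (e : rel V) (q : nat).
Hypotheses (e_sym : symmetric e) (e_irr : irreflexive e)
  (quot : quotients_colourable e q)
  (ncol : forall c : V -> 'I_q, ~ colouring e setT c).

(* [psi] comes from contracting the bags.  Distinct classes with the same [psi] have nonadjacent bags,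
   so a colouring [g] with kernel between those of [c] and [psi] can be reproduced on [S :|: X] by
   merging bags. *)
Lemma engine S X Y (c : V -> 'I_q) p (base : 'I_p -> 'I_q) (own : 'I_q -> option 'I_p)
    (TT : pred {set 'I_p}) x (r : 'I_p -> 'I_p) :
  sides e S X Y -> colouring e (S :|: X) c ->
  (forall t, own (base t) = Some t) ->
  (forall s, s \in S -> exists t, c s = base t) ->
  (forall t, exists2 s, s \in S & c s = base t) ->
  (forall T t, TT T -> t \in T -> own (x T t) = Some t) ->
  (forall T1 T2 b, TT T1 -> TT T2 -> b \in T1 -> b \in T2 -> x T1 b = x T2 b ->
     forall j : 'I_p, j < b -> j != r b -> (j \in T1) = (j \in T2)) ->
  (forall t s s', s \in S -> s' \in S -> c s = base t -> c s' = base t ->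
     connect (inner e [set w in S :|: X | own (c w) == Some t]) s s') ->
  exists psi : V -> 'I_q, [/\ colouring e (S :|: Y) psi,
    forall u v, u \in S -> v \in S -> c u = c v -> psi u = psi v &
    forall g : V -> 'I_q, colouring e (S :|: Y) g ->
      (forall u v, u \in S -> v \in S -> c u = c v -> g u = g v) ->
      (forall u v, u \in S -> v \in S -> g u = g v -> psi u = psi v) ->
      (forall s, s \in S -> TT [set t | [exists s' in S, (c s' == base t) && (g s' == g s)]]) ->
      False].
Proof.
move=> sd c_col base_own S_base base_S x_own x_pre link.
pose Z := S :|: X.
pose A t := [set w in Z | own (c w) == Some t].
(* By [link], the vertices of the class of [t] lie in one component of the subgraph with colours
   owned by [t]; this component is the initial bag. *)
pose W t := [set v in A t | [exists s in S, (c s == base t) && connect (inner e (A t)) s v]].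
have SZ : S \subset Z by exact: subsetUl.
have W_Z t : W t \subset Z by apply/subsetP => v; rewrite !inE => /andP[/andP[]].
have W_own t v : v \in W t -> own (c v) = Some t.
  by rewrite !inE => /andP[/andP[_ /eqP]].
have W_closed t u v : u \in W t -> v \in Z -> e u v -> own (c v) = Some t -> v \in W t.
  rewrite inE => /andP[uA /existsP[s /and3P[sS cs su]]] vZ uv ov.
  have vA : v \in A t by rewrite inE vZ ov eqxx.
  rewrite inE vA /=; apply/existsP; exists s; rewrite sS cs /=.
  by apply: connect_trans su (connect1 _); rewrite /inner uA vA.
have S_W s t : s \in S -> c s = base t -> s \in W t.
  move=> sS cs; rewrite inE inE (subsetP SZ) // cs base_own eqxx /=.
  by apply/existsP; exists s; rewrite sS cs eqxx connect0.
have W_conn t u v : u \in W t -> v \in W t -> connect (inner e (W t)) u v.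
  have reach s w : s \in S -> c s = base t -> connect (inner e (A t)) s w ->
      connect (inner e (W t)) s w.
    move=> sS cs sw; pose M z := (z \in W t) && connect (inner e (W t)) s z.
    suff : M w by case/andP.
    apply: (connect_invariant (P := M) _ _ sw); last by rewrite /M S_W ?connect0.
    move=> a b /andP[aW sa] /and3P[_ bA ab].
    have bW : b \in W t.
      by move: bA; rewrite inE => /andP[bZ /eqP ob]; apply: W_closed aW _ ab _.
    by rewrite /M bW; apply: connect_trans sa (connect1 _); rewrite /inner aW bW.
  rewrite [u \in _]inE [v \in _]inE.
  case/andP=> uA /existsP[s /and3P[sS /eqP cs su]].
  case/andP=> vA /existsP[s' /and3P[s'S /eqP cs' sv]].
  apply: connect_trans (reach _ _ sS cs (connect_trans (link _ _ _ sS s'S cs cs') sv)).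
  by rewrite inner_csym //; apply: reach.
have [B gB] := growth_exists e_sym W_Z W_own W_conn TT x (items p).
pose bag v := [pick t | v \in B t].
have bagP v t : (bag v == Some t) = (v \in B t).
  rewrite /bag; case: pickP => [t' vB|->//].
  apply/eqP/idP => [[<-//]|vB']; congr Some; exact: gr_disj gB _ _ _ vB vB'.
have bag1 v : bag v -> exists t, bag v = Some t /\ v \in B t.
  by case E: (bag v) => [t|//] _; exists t; rewrite -bagP E.
have S_bag s t : s \in S -> c s = base t -> bag s = Some t.
  by move=> sS cs; apply/eqP; rewrite bagP (subsetP (gr_W gB t)) // S_W.
have [||||psi [psi1 psi2]] := contract_bags e_sym e_irr quot (bag := bag) sd.
- by move=> v /bag1[t [_ vB]]; apply: (subsetP (gr_Z gB t)).
- by move=> s sS; have [t /(S_bag _ _ sS) ->] := S_base s sS.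
- move=> v /bag1[t [-> _]]; have [s sS cs] := base_S t; exists s => //.
  exact: S_bag.
- move=> u v /bag1[t [ut uB]]; rewrite ut => vt.
  have vB : v \in B t by rewrite -bagP -vt eqxx.
  apply: inner_connect_sub (gr_conn gB uB vB).
  by apply/subsetP => z zB; rewrite inE bagP.
have psi_col : colouring e (S :|: Y) psi.
  move=> u v; rewrite !inE => uSY vSY uv; apply/eqP; apply: psi2 => //.
  - case/orP: uSY => [uS|->]; last by rewrite orbT.
    by have [t /(S_bag _ _ uS) ->] := S_base u uS.
  - case/orP: vSY => [uS|->]; last by rewrite orbT.
    by have [t /(S_bag _ _ uS) ->] := S_base v uS.
  case/orP: uSY => // uS; case/orP: vSY => [vS|vY].
    have [t ct] := S_base u uS; have [t' ct'] := S_base v vS.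
    rewrite (S_bag _ _ uS ct) (S_bag _ _ vS ct') => -[tt].
    by have := c_col u v; rewrite !inE uS vS ct ct' tt eqxx => /(_ isT isT uv).
  have [t /(S_bag _ _ uS) ->] := S_base u uS.
  move/esym => vb; have /bag1[t' [_]] : bag v by rewrite vb.
  move/(subsetP (gr_Z gB t')); have [vS vX] := side_notin (sidesC e_sym sd) vY.
  by rewrite inE (negbTE vS) (negbTE vX).
exists psi; split=> //.
  move=> u v uS vS cuv; have [t ct] := S_base u uS.
  by apply: psi1; rewrite !(@S_bag _ t) // -cuv.
move=> g g_col gc gpsi gTT.
have /fin_all_exists2[root rS rc] := base_S.
have fiberE t : [set t' | g (root t') == g (root t)] =
    [set t' | [exists s' in S, (c s' == base t') && (g s' == g (root t))]].
  apply/setP => t'; rewrite !inE; apply/eqP/existsP => [E|[s /and3P[sS /eqP cs /eqP <-]]].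
    by exists (root t'); rewrite rS rc E !eqxx.
  by apply: gc; rewrite ?rS ?rc.
have [||c' [c'_col c'ker]] := merge_all e_sym W_own W_closed x_own x_pre c_col base_own SZ S_W (f := fun t => g (root t)) gB.
- by move=> t; rewrite fiberE gTT ?rS.
- move=> t0 t1 t2 u v; rewrite !inE => /eqP E1 /eqP E2 nt uB vB; apply/negP => uv.
  have bu : bag u = Some t1 by apply/eqP; rewrite bagP.
  have bv : bag v = Some t2 by apply/eqP; rewrite bagP.
  have := psi2 u v; rewrite bu bv /= => /(_ isT isT uv); apply.
    by case=> tt; rewrite tt eqxx in nt.
  have pr w t : bag w = Some t -> psi w = psi (root t).
    by move=> bw; apply: psi1; rewrite bw // (S_bag _ t).
  by rewrite (pr _ _ bu) (pr _ _ bv); apply: gpsi; rewrite ?rS // E1 E2.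
apply: (glue e_sym ncol sd c'_col g_col) => u v uS vS.
have [t ct] := S_base u uS; have [t' ct'] := S_base v vS.
rewrite (c'ker u v t t') //.
have -> : g u = g (root t) by apply: gc; rewrite ?rS ?rc.
by have -> : g v = g (root t') by apply: gc; rewrite ?rS ?rc.
Qed.

Definition before p (r : 'I_p -> 'I_p) (T : {set 'I_p}) (b : 'I_p) :=
  [set j in T | (j < b) && (j != r b)].

Definition strongly_linked (S X : {set V}) (c : V -> 'I_q) u v :=
  forall j, (forall s, s \in S -> c s != j) ->
    connect (inner e (bichrom (S :|: X) c (c u) j)) u v.

(* The colour [x T b] only has to determine [b] and [before r T b], so one colour per label suffices;
   the first label of each node [t] is represented by [base t] itself. *)
Lemma engine_labels S X Y (c : V -> 'I_q) p (base : 'I_p -> 'I_q)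
    (TT : pred {set 'I_p}) (r : 'I_p -> 'I_p) (Lab : {set 'I_p * {set 'I_p}}) :
  0 < p -> sides e S X Y -> colouring e (S :|: X) c ->
  injective base ->
  (forall s, s \in S -> exists t, c s = base t) ->
  (forall t, exists2 s, s \in S & c s = base t) ->
  (forall u v, u \in S -> v \in S -> c u = c v -> strongly_linked S X c u v) ->
  (forall T b, TT T -> b \in T -> (b, before r T b) \in Lab) ->
  (forall t, exists F, (t, F) \in Lab) ->
  (forall t u v, u \in S -> v \in S -> u != v -> c u = base t -> c v = base t ->
     1 < #|[set F | (t, F) \in Lab]|) ->
  #|Lab| <= q ->
  exists psi : V -> 'I_q, [/\ colouring e (S :|: Y) psi,
    forall u v, u \in S -> v \in S -> c u = c v -> psi u = psi v &
    forall g : V -> 'I_q, colouring e (S :|: Y) g ->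
      (forall u v, u \in S -> v \in S -> c u = c v -> g u = g v) ->
      (forall u v, u \in S -> v \in S -> g u = g v -> psi u = psi v) ->
      (forall s, s \in S -> TT [set t | [exists s' in S, (c s' == base t) && (g s' == g s)]]) ->
      False].
Proof.
move=> p_gt0 sd c_col base_inj S_base base_S link labTT lab1 lab2 labq.
have /fin_all_exists[F0 F0P] := lab1.
pose Mn := [set (t, F0 t) | t : 'I_p].
pose Rest := Lab :\: Mn.
pose spare := ~: [set base t | t : 'I_p].
have cMn : #|Mn| = p by rewrite card_imset ?card_ord // => t t' [].
have sMn : Mn \subset Lab by apply/subsetP => _ /imsetP[t _ ->].
have cRest : #|Rest| <= #|spare|.
  have cb : #|[set base t | t : 'I_p]| = p by rewrite card_imset ?card_ord.
  have := cardsC [set base t | t : 'I_p]; rewrite cb card_ord -/spare.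
  rewrite cardsD (setIidPr sMn) cMn; lia.
pose d0 := base (Ordinal p_gt0).
pose lam (l : 'I_p * {set 'I_p}) : 'I_q :=
  if l \in Mn then base l.1 else nth d0 (enum spare) (index l (enum Rest)).
have lamR l : l \in Rest -> lam l \in spare.
  move=> lR; rewrite /lam; have := lR; rewrite inE => /andP[/negbTE-> _].
  by rewrite -mem_enum mem_nth // -cardE (leq_trans _ cRest) // cardE index_mem mem_enum.
have lam_inj : {in Lab &, injective lam}.
  move=> l l' lL l'L.
  have RM z : z \in Lab -> z \notin Mn -> z \in Rest by move=> zL zM; rewrite inE zM.
  have MS z z' : z \in Mn -> z' \in Lab -> z' \notin Mn -> lam z <> lam z'.
    move=> zM z'L z'M E; have := lamR z' (RM _ z'L z'M).
    by rewrite -E /lam zM inE imset_f.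
  case: (boolP (l \in Mn)) => lM; case: (boolP (l' \in Mn)) => l'M.
  - case/imsetP: (lM) => t _ lE; case/imsetP: (l'M) => t' _ l'E.
    by rewrite /lam lM l'M lE l'E /= => /base_inj ->.
  - by move/MS; case.
  - by move/esym/MS; case.
  - rewrite /lam (negbTE lM) (negbTE l'M) => /eqP.
    have idx z : z \in Lab -> z \notin Mn -> index z (enum Rest) < size (enum spare).
      move=> zL zM; rewrite -cardE (leq_trans _ cRest) // cardE index_mem mem_enum.
      exact: RM.
    rewrite nth_uniq ?idx ?enum_uniq // => /eqP E.
    have := nth_index l (_ : l \in enum Rest); rewrite E mem_enum => /(_ (RM _ lL lM)) <-.
    by rewrite nth_index // mem_enum RM.
pose own col := [pick t | [exists F, ((t, F) \in Lab) && (lam (t, F) == col)]].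
have ownE t F : (t, F) \in Lab -> own (lam (t, F)) = Some t.
  move=> tF; rewrite /own; case: pickP => [t'|/(_ t)/existsP[]]; last by exists F; rewrite tF eqxx.
  by case/existsP=> F' /andP[tF' /eqP /lam_inj E]; have [] := E tF' tF => ->.
have lamF0 t : lam (t, F0 t) = base t by rewrite /lam imset_f.
have own_base t : own (base t) = Some t by rewrite -lamF0 ownE.
apply: (@engine S X Y c p base own TT (fun T t => lam (t, before r T t)) r) => //.
- by move=> T t TT_T tT; apply/ownE/labTT.
- move=> T1 T2 b h1 h2 b1 b2 /lam_inj E j jb jr.
  have [] := E (labTT _ _ h1 b1) (labTT _ _ h2 b2) => /setP/(_ j).
  by rewrite !inE jb jr !andbT.
- move=> t s s' sS s'S cs cs'.
  case: (eqVneq s s') => [->|ss']; first exact: connect0.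
  (* A class with two vertices has a second label, so it owns a colour that does not occur on [S];
     the Kempe chains for that colour connect the class. *)
  have := lab2 t s s' sS s'S ss' cs cs'; rewrite (cardD1 (F0 t)) inE F0P.
  rewrite -[1 < _]/(0 < _) => /card_gt0P[F]; rewrite !inE => /andP[FF0 tF].
  have jR : lam (t, F) \in spare.
    apply: lamR; rewrite inE tF andbT; apply/imsetP => -[t' _ [E1 E2]].
    by rewrite E1 E2 eqxx in FF0.
  have /link : c s = c s' by rewrite cs cs'.
  move/(_ sS s'S (lam (t, F))) => L; apply: inner_connect_sub (L _).
    apply/subsetP => w; rewrite !inE cs => /andP[-> /orP[/eqP->|/eqP->]].
      by rewrite own_base eqxx.
    by rewrite ownE ?eqxx.
  move=> z zS; have [t' ->] := S_base z zS; apply: contraTneq jR => <-.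
  by rewrite inE negbK imset_f.
Qed.

End Engine.

Lemma card_dep_pairs (I J : finType) (P : I -> pred J) :
  #|[set l : I * J | P l.1 l.2]| = \sum_i #|[set j | P i j]|.
Proof.
rewrite -sum1_card (eq_bigl (fun l : I * J => xpredT l.1 && P l.1 l.2)); last first.
  by move=> l; rewrite inE.
rewrite -(pair_big_dep xpredT P (fun _ _ => 1)) /=.
by apply: eq_bigr => i _; rewrite sum1_card; apply: eq_card => j; rewrite !inE.
Qed.

Lemma card_fibers (I J : finType) (f : I -> J) (A : {set I}) :
  #|A| = \sum_(y in f @: A) #|[set x in A | f x == y]|.
Proof.
rewrite -sum1_card (partition_big f (mem (f @: A))) /=; last by move=> x xA; rewrite imset_f.
by apply: eq_bigr => y _; rewrite -sum1_card; apply: eq_bigl => x; rewrite inE.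
Qed.

(** Since [0.-1 = 0], both [t = 0] and [t = 1] contribute 1, which makes the sum an exact power of
    two. *)
Lemma sum_pow_half p : 0 < p -> \sum_(t < p) 2 ^ t.-1 = 2 ^ p.-1.
Proof.
case: p => // p _; elim: p => [|p IH]; first by rewrite big_ord_recl big_ord0.
by rewrite big_ord_recr /= IH; case: p {IH} => //= p; rewrite addnn -mul2n -expnS.
Qed.

Section Fine.
Variables (V : finType) (e : rel V) (q : nat).
Hypotheses (e_sym : symmetric e) (e_irr : irreflexive e)
  (quot : quotients_colourable e q)
  (ncol : forall c : V -> 'I_q, ~ colouring e setT c).

Definition ordp p (t : 'I_p) : 'I_p := Ordinal (leq_ltn_trans (leq_pred t) (ltn_ord t)).

(* With all sets of nodes as candidates and [r b = b - 1] there are only [2 ^ (p - 1)] labels. *)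
Lemma linked_fine S X Y (c : V -> 'I_q) :
  sides e S X Y -> colouring e (S :|: X) c ->
  4 < q -> 2 ^ (#|S| - 3) < q ->
  (forall u v, u \in S -> v \in S -> c u = c v -> strongly_linked e S X c u v) ->
  #|S| <= #|c @: S|.+1.
Proof.
move=> sd c_col q4 qS link; rewrite leqNgt; apply/negP => Sbig.
have [[u v] /= [uS vS uv cuv]] : exists uv : V * V,
    [/\ uv.1 \in S, uv.2 \in S, uv.1 != uv.2 & c uv.1 = c uv.2].
  case: (boolP [exists u in S, exists v in S, (u != v) && (c u == c v)]).
    by case/existsP=> u /andP[uS /existsP[v /and3P[vS uv /eqP cuv]]]; exists (u, v).
  rewrite negb_exists => /forallP H; suff inj : {in S &, injective c}.
    by move: Sbig; rewrite card_in_imset // => /ltnW; rewrite ltnn.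
  move=> u v uS vS cuv; apply/eqP; apply: contraT => uv.
  have := H u; rewrite uS negb_exists => /forallP/(_ v).
  by rewrite vS uv cuv eqxx.
pose a := c u; pose P := c @: S; pose p := #|P|.
have aP : a \in P by rewrite imset_f.
(* A class with at least two vertices is placed last, where labels are most numerous: from [p = 3]
   on it has a second label at no extra cost. *)
pose l := rcons (enum (P :\ a)) a.
have lP z : (z \in l) = (z \in P).
  by rewrite mem_rcons inE mem_enum !inE; case: eqP => [->|].
have l_uniq : uniq l by rewrite rcons_uniq mem_enum !inE eqxx enum_uniq.
have l_size : size l = p.
  by rewrite -(card_uniqP l_uniq); apply: eq_card.
have p_gt0 : 0 < p by rewrite -l_size size_rcons.
pose base (t : 'I_p) := nth a l t.
have base_inj : injective base.
  by move=> t t' /eqP; rewrite nth_uniq ?l_size // => /eqP/val_inj.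
have baseP t : base t \in P by rewrite -lP mem_nth ?l_size.
have last_base (t : 'I_p) : t.+1 = p -> base t = a.
  move=> tp; rewrite /base /l nth_rcons.
  have := etrans l_size (esym tp); rewrite size_rcons => -[->].
  by rewrite ltnn eqxx.
pose nontriv (col : 'I_q) := 1 < #|[set s in S | c s == col]|.
pose N := [set col in P | nontriv col].
have NS : p + #|N| <= #|S|.
  have hP : p = \sum_(y in P) 1 by rewrite sum1_card.
  have hN : #|N| = \sum_(y in P) nontriv y.
    rewrite -sum1_card big_mkcond [RHS]big_mkcond; apply: eq_bigr => y _.
    by rewrite inE; case: (y \in P); case: (nontriv y).
  rewrite hP hN -big_split (card_fibers c S) -/P.
  apply: leq_sum => y /imsetP[s sS ->].
  rewrite /nontriv /=; case: ltnP => //= _; rewrite addn0; apply/card_gt0P.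
  by exists s; rewrite inE sS eqxx.
have aN : a \in N.
  rewrite inE aP /nontriv (cardD1 u) (cardD1 v) !inE uS vS /a cuv eqxx.
  by rewrite eq_sym uv.
pose Lab1 := [set l : 'I_p * {set 'I_p} | l.2 \subset [set j : 'I_p | j.+1 < l.1]].
(* The sets [[set t]] never occur as [before r T t]; they only provide a second label, and so a
   linking colour, for classes with several vertices. *)
pose X0 := [set t : 'I_p | nontriv (base t) && ((p < 3) || (t.+1 < p))].
pose Lab := Lab1 :|: [set (t, [set t]) | t in X0].
have cLab1 : #|Lab1| = 2 ^ p.-1.
  rewrite -sum_pow_half // (card_dep_pairs (fun (i : 'I_p) (F : {set 'I_p}) => F \subset [set j : 'I_p | j.+1 < i])).
  apply: eq_bigr => t _.
  rewrite -/(powerset [set j : 'I_p | j.+1 < t]) card_powerset; congr (2 ^ _).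
  have tp := ltn_ord t.
  have le : t.-1 <= p by lia.
  have winj : injective (widen_ord le) by move=> i k /(congr1 val)/= /val_inj.
  rewrite -[RHS]card_ord -(card_imset predT winj).
  apply: eq_card => j; rewrite !inE; apply/idP/imsetP => [jt|[k _ ->]].
    have jt' : j < t.-1 by lia.
    by exists (Ordinal jt') => //; apply: val_inj.
  by have := ltn_ord k; rewrite /=; lia.
have cX0 : #|X0| + (2 < p) <= #|N|.
  have sub : base @: X0 \subset N.
    by apply/subsetP => _ /imsetP[t tX ->]; move: tX; rewrite !inE baseP => /andP[].
  rewrite -(card_imset _ base_inj); case: ltnP => p3; last by rewrite addn0 subset_leq_card.
  rewrite addn1 (cardD1 a N) aN ltnS; apply/subset_leq_card/subsetP => y yX.
  rewrite inE /= (subsetP sub y yX) andbT.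
  case/imsetP: yX => t; rewrite inE => /andP[_]; rewrite ltnNge p3 /= => tp ->.
  apply/eqP => E; have pp : p.-1 < p by lia.
  have := last_base (Ordinal pp); rewrite -E /= prednK // => /(_ erefl)/base_inj/(congr1 val)/=.
  lia.
have labq : #|Lab| <= q.
  have : #|Lab| <= #|Lab1| + #|X0|.
    rewrite cardsU (leq_trans (leq_subr _ _)) // leq_add2l; exact: leq_imset_card.
  rewrite cLab1 => h; apply: leq_trans h _.
  (* With [#|S| = p + d + 2] and [2 < p] there are at most [d.+1] extra labels, and [2 ^ p.-1 + d.+1
     <= (2 ^ p.-1 * 2 ^ d).+1 <= q]. With [p <= 2] there are at most four labels, and [4 < q]
     suffices. *)
  case: (ltnP 2 p) => p3.
    move: cX0; rewrite p3 addn1 => cX0.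
    have {}qS : 2 ^ (#|S| - 3) < q := qS.
    have [d dS] : exists d, #|S| = p + d + 2 by exists (#|S| - p - 2); move: Sbig; rewrite -/P -/p; lia.
    apply: leq_trans qS; have -> : #|S| - 3 = p.-1 + d by lia.
    have X0d : #|X0| <= d.+1 by move: NS cX0; lia.
    rewrite expnD; have := ltn_expl d (isT : 1 < 2).
    have A0 : 0 < 2 ^ p.-1 by rewrite expn_gt0.
    move: (2 ^ p.-1) (2 ^ d) X0d A0 => A D X0d A0 dD.
    have : A * d.+1 <= A * D by rewrite leq_mul2l dD orbT.
    have : d <= A * d by exact: leq_pmull.
    rewrite mulnS; lia.
  have Np : #|N| <= p by apply: subset_leq_card; apply/subsetP => y; rewrite inE => /andP[].
  have : 2 ^ p.-1 <= 2 by rewrite -[X in _ <= X](expn1 2) leq_exp2l //; lia.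
  lia.
have [|||||||psi [psi_col psi_c psi_fin]] :=
  @engine_labels V e q e_sym e_irr quot ncol S X Y c p base predT (@ordp p) Lab p_gt0 sd c_col base_inj.
- move=> s sS; have : c s \in l by rewrite lP imset_f.
  move=> /(nthP a)[i]; rewrite l_size => ip E; by exists (Ordinal ip).
- by move=> t; have /imsetP[s sS ->] := baseP t; exists s.
- exact: link.
- move=> T b _ _; rewrite inE inE /=; apply/orP; left.
  apply/subsetP => j; rewrite !inE => /and3P[_ jb]; rewrite -val_eqE /=; lia.
- by move=> t; exists set0; rewrite !inE sub0set.
- move=> t s s' sS s'S ss' cs cs'.
  have nt : nontriv (base t).
    by rewrite /nontriv (cardD1 s) (cardD1 s') !inE sS s'S cs cs' eqxx eq_sym ss'.
  have two F : F != set0 -> (t, F) \in Lab -> 1 < #|[set F | (t, F) \in Lab]|.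
    move=> F0 FL; rewrite (cardD1 set0) (cardD1 F) [F \in _]inE [F \in _]inE F0 inE FL.
    by rewrite !inE sub0set.
  case: (boolP ((p < 3) || (t.+1 < p))) => tp.
    apply: (two [set t]); first by apply/set0Pn; exists t; rewrite inE.
    by rewrite inE; apply/orP; right; apply: imset_f; rewrite inE nt tp.
  apply: (two [set Ordinal p_gt0]); first by apply/set0Pn; exists (Ordinal p_gt0); rewrite inE.
  rewrite inE inE sub1set inE /=; apply/orP; left.
  by case/norP: tp; rewrite -!leqNgt => p3 tp; rewrite -ltnS (leq_trans p3).
- exact: labq.
(* Every set of nodes is a candidate, so the contracted colouring [psi] itself serves as [g]. *)
by apply: (psi_fin psi).
Qed.

End Fine.

(** * Splitting all classes but one *)

(** Removing [i'] does not change the image, so no room is left for a second coincidence. *)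
Lemma near_injective (V C : finType) (S : {set V}) (f : V -> C) i i' :
  #|S| <= #|f @: S|.+1 -> i \in S -> i' \in S -> i != i' -> f i = f i' ->
  forall u v, u \in S -> v \in S -> f u = f v ->
    u = v \/ (u \in [set i; i']) && (v \in [set i; i']).
Proof.
move=> SfS iS i'S ii' fii'.
have eqim : f @: (S :\ i') = f @: S.
  apply/setP => y; apply/imsetP/imsetP => -[z zS ->].
    by exists z => //; move: zS; rewrite inE => /andP[].
  case: (eqVneq z i') => [->|zi']; first by exists i; rewrite // !inE ii'.
  by exists z; rewrite // !inE zi'.
have inj : {in S :\ i' &, injective f}.
  apply/imset_injP; rewrite eqim eqn_leq -{1}eqim leq_imset_card /=.
  by move: SfS; rewrite (cardsD1 i' S) i'S.
move=> u v uS vS fuv; rewrite !inE.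
case: (eqVneq u v) => [|uv]; [by left | right].
case: (eqVneq u i') => [ui|ui]; case: (eqVneq v i') => [vi|vi].
- by rewrite ui vi eqxx in uv.
- rewrite orbT orbF /=; apply/eqP/inj; rewrite ?inE ?vi ?ii' //.
  by rewrite -fuv ui fii'.
- rewrite orbT orbF andbT; apply/eqP/inj; rewrite ?inE ?ui ?ii' //.
  by rewrite fuv vi fii'.
- by rewrite (inj u v) ?inE ?ui ?vi // eqxx in uv.
Qed.

Section Keep.
Variables (V : finType) (e : rel V) (q : nat).
Hypotheses (e_sym : symmetric e) (e_irr : irreflexive e)
  (quot : quotients_colourable e q)
  (ncol : forall c : V -> 'I_q, ~ colouring e setT c).
Implicit Types (S X Y I : {set V}) (c : V -> 'I_q).

(** As [j] does not occur on [S], the change separates [u] from [v] without merging any classes of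
    [S]. The growing number of colours on [S] is the measure for the recursions in [keep_refine] and
    [shatter]. *)
Lemma swap_split S X c u v j (c1 := swap e (S :|: X) c (c u) j u) :
  colouring e (S :|: X) c -> u \in S -> v \in S -> c u = c v ->
  (forall s, s \in S -> c s != j) ->
  ~~ connect (inner e (bichrom (S :|: X) c (c u) j)) u v ->
  [/\ colouring e (S :|: X) c1,
      forall s, s \in S -> c1 s = if s \in chain e (S :|: X) c (c u) j u then j else c s,
      forall s, s \in chain e (S :|: X) c (c u) j u -> c s = c u \/ c s = j,
      c1 u = j /\ c1 v = c v & #|c @: S| < #|c1 @: S|].
Proof.
move=> c_col uS vS cuv jS nuv.
have uB : u \in bichrom (S :|: X) c (c u) j by rewrite !inE uS eqxx.
have inch s : s \in chain e (S :|: X) c (c u) j u -> c s = c u \/ c s = j.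
  rewrite inE => us; case: (eqVneq u s) => [<-|neq]; first by left.
  have [_] := inner_connect_in e_sym us neq.
  by rewrite inE => /andP[_ /orP[]/eqP]; auto.
have c1S s : s \in S -> c1 s = if s \in chain e (S :|: X) c (c u) j u then j else c s.
  move=> sS; rewrite /c1 /swap; case: ifP => // /inch[->|E]; first by rewrite tpermL.
  by have := jS s sS; rewrite E eqxx.
have c1u : c1 u = j by rewrite c1S // chain_refl.
have c1v : c1 v = c v by rewrite c1S // inE (negbTE nuv).
split=> //; first exact: swap_colouring.
apply: proper_card; apply/properP; split.
  apply/subsetP => _ /imsetP[s sS ->].
  case: (boolP (s \in chain e (S :|: X) c (c u) j u)) => [/inch[->|E]|ns].
  - by rewrite cuv -c1v imset_f.
  - by have := jS s sS; rewrite E eqxx.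
  - by rewrite -[c s]/(if false then j else c s) -(negbTE ns) -c1S // imset_f.
exists j; first by rewrite -c1u imset_f.
by apply/imsetP => -[s sS E]; have := jS s sS; rewrite -E eqxx.
Qed.

Definition exact_class S I c := forall u v, u \in I -> v \in S -> (c u == c v) = (v \in I).

Definition refines S c c' := forall u v, u \in S -> v \in S -> c' u = c' v -> c u = c v.

Lemma linked_or_not S X c (A : {set V}) :
  (forall u v, u \in A -> v \in A -> c u = c v -> strongly_linked e S X c u v) \/
  exists uv : V * V, [/\ uv.1 \in A, uv.2 \in A, c uv.1 = c uv.2 &
   (exists2 j, (forall s, s \in S -> c s != j) &
    ~~ connect (inner e (bichrom (S :|: X) c (c uv.1) j)) uv.1 uv.2)].
Proof.
case: (boolP [forall u in A, [forall v in A, (c u == c v) ==>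
   [forall j, [forall s in S, c s != j] ==>
      connect (inner e (bichrom (S :|: X) c (c u) j)) u v]]]).
  move/forall_inP => H; left=> u v uS vS /eqP cuv j jS.
  have /forall_inP/(_ v vS)/implyP/(_ cuv)/forallP/(_ j)/implyP := H u uS.
  by apply; apply/forall_inP.
rewrite negb_forall_in => /exists_inP[u uS]; rewrite negb_forall_in => /exists_inP[v vS].
rewrite negb_imply => /andP[/eqP cuv]; rewrite negb_forall => /existsP[j].
rewrite negb_imply => /andP[/forall_inP jS nuv].
by right; exists (u, v); split=> //; exists j.
Qed.

(** A chain that starts in [S] outside [I] and uses a colour absent from [S] contains no vertex of
    [I], so the class [I] survives every split. *)
Lemma keep_refine S X c I :
  colouring e (S :|: X) c -> I \subset S -> exact_class S I c ->
  exists c', [/\ colouring e (S :|: X) c', exact_class S I c', refines S c c' &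
    forall u v, u \in S :\: I -> v \in S :\: I -> c' u = c' v -> strongly_linked e S X c' u v].
Proof.
move=> + IS; have [n] := ubnP (q - #|c @: S|); elim: n c => // n IH c cn c_col cI.
have [|[[u v] /= [uSI vSI cuv [j jS nuv]]]] :
    (forall u v, u \in S :\: I -> v \in S :\: I -> c u = c v -> strongly_linked e S X c u v) \/
    exists uv : V * V, [/\ uv.1 \in S :\: I, uv.2 \in S :\: I, c uv.1 = c uv.2 &
     (exists2 j, (forall s, s \in S -> c s != j) &
      ~~ connect (inner e (bichrom (S :|: X) c (c uv.1) j)) uv.1 uv.2)].
- exact: linked_or_not.
- by move=> H; exists c; split.
have uS : u \in S by move: uSI; rewrite inE => /andP[].
have vS : v \in S by move: vSI; rewrite inE => /andP[].
have [c1_col c1S inch [c1u c1v] c1big] := swap_split c_col uS vS cuv jS nuv.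
set c1 := swap _ _ _ _ _ _ in c1_col c1S c1u c1v c1big.
have ref1 : refines S c c1.
  move=> s s' sS s'S; rewrite !c1S //; case: ifP => [/inch h|_]; case: ifP => [/inch h'|_] //.
  - move=> _; have nj w : w \in S -> c w = j -> False by move=> wS E; have := jS w wS; rewrite E eqxx.
    by case: h => [->|/nj] //; case: h' => [->|/nj] //; move=> /(_ s'S).
  - by move=> E; have := jS s' s'S; rewrite -E eqxx.
  - by move=> E; have := jS s sS; rewrite E eqxx.
have c1I : exact_class S I c1.
  move=> x y xI yS; have xS := subsetP IS x xI.
  have nx : x \notin chain e (S :|: X) c (c u) j u.
    apply/negP => /inch[E|E]; last by have := jS x xS; rewrite E eqxx.
    have := cI x u xI uS; rewrite E eqxx; move: uSI; rewrite inE => /andP[/negbTE-> _]; done.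
  rewrite (c1S x) // (negbTE nx) c1S //; case: ifP => [/inch h|_]; last exact: cI.
  rewrite (negbTE (jS x xS)); apply/esym/negP => yI.
  case: h => [E|E]; last by have := jS y yS; rewrite E eqxx.
  have := cI y u yI uS; rewrite E eqxx; move: uSI; rewrite inE => /andP[/negbTE-> _]; done.
have [|c' [h1 h2 h3 h4]] := IH c1 _ c1_col c1I.
  have : #|c1 @: S| <= q by rewrite -[q in _ <= q]card_ord max_card.
  lia.
by exists c'; split=> // s s' sS s'S /(h3 s s' sS s'S); apply: ref1.
Qed.

(* The class [I] is shattered by Kempe changes with unused colours only, so that
   the links inside the other classes are not affected. *)
Lemma shatter S X c I a :
  colouring e (S :|: X) c -> I \subset S -> I != set0 -> (forall s, s \in S -> (c s == a) = (s \in I)) ->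
  exists c' (U : {set 'I_q}),
  [/\ colouring e (S :|: X) c', a \in U,
      forall v, (c' v \in U) = (c v \in U) /\ (c v \notin U -> c' v = c v),
      (forall s, s \in S -> c s \in U -> c s = a) /\ c' @: I = U &
      forall u v, u \in I -> v \in I -> c' u = c' v -> strongly_linked e S X c' u v].
Proof.
move=> c_col IS I0 Ia.
have IinS x : x \in I -> x \in S by apply/subsetP.
(* [U] collects [a] and the colours consumed so far: the vertices coloured from [U] are the same as
   for [c], and all others keep their colour. *)
suff main : forall n c1 (U : {set 'I_q}), q - #|c1 @: S| < n -> colouring e (S :|: X) c1 -> a \in U ->
   (forall v, (c1 v \in U) = (c v \in U) /\ (c v \notin U -> c1 v = c v)) ->
   (forall s, s \in S -> c s \in U -> c s = a) -> c1 @: I = U ->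
  exists c' (U : {set 'I_q}),
  [/\ colouring e (S :|: X) c', a \in U,
      forall v, (c' v \in U) = (c v \in U) /\ (c v \notin U -> c' v = c v),
      (forall s, s \in S -> c s \in U -> c s = a) /\ c' @: I = U &
      forall u v, u \in I -> v \in I -> c' u = c' v -> strongly_linked e S X c' u v].
  apply: (main (q - #|c @: S|).+1 c [set a]) => //; first by rewrite inE.
    by move=> s _; rewrite inE => /eqP.
  have /set0Pn[x xI] := I0.
  have cI y : y \in I -> c y = a by move=> yI; apply/eqP; rewrite Ia ?IinS.
  apply/setP => z; rewrite inE; apply/imsetP/eqP => [[y yI ->]|->]; first exact: cI.
  by exists x; rewrite ?cI.
elim=> // n IH c1 U cn c1_col aU c1U US IU.
have [|[[u v] /= [uI vI cuv [j jS nuv]]]] :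
    (forall u v, u \in I -> v \in I -> c1 u = c1 v -> strongly_linked e S X c1 u v) \/
    exists uv : V * V, [/\ uv.1 \in I, uv.2 \in I, c1 uv.1 = c1 uv.2 &
     (exists2 j, (forall s, s \in S -> c1 s != j) &
      ~~ connect (inner e (bichrom (S :|: X) c1 (c1 uv.1) j)) uv.1 uv.2)].
- exact: linked_or_not.
- by move=> H; exists c1, U; split.
have [c2_col c2S inch [c2u c2v] c2big] := swap_split c1_col (IinS u uI) (IinS v vI) cuv jS nuv.
set c2 := swap _ _ _ _ _ _ in c2_col c2S c2u c2v c2big.
have jU : j \notin U.
  by rewrite -IU; apply/imsetP => -[y yI E]; have := jS y (IinS y yI); rewrite E eqxx.
have uU : c1 u \in U by rewrite -IU imset_f.
have c1j w : (c1 w == j) = (c w == j).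
  case: (c1U w) => h1 h2; apply/eqP/eqP => E; last by rewrite h2 E.
  by rewrite -h2 // -h1 E.
apply: (IH c2 (j |: U)) => //.
- have : #|c2 @: S| <= q by rewrite -[q in _ <= q]card_ord max_card.
  lia.
- by rewrite inE aU orbT.
- move=> w; have c2w : (c2 w \in j |: U) = (c1 w \in j |: U).
    rewrite /c2 /swap; case: ifP => // /inch[->|->]; rewrite ?tpermL ?tpermR !inE ?uU ?eqxx ?orbT //.
  have -> : (c2 w \in j |: U) = (c w \in j |: U).
    by rewrite c2w !inE c1j (proj1 (c1U w)).
  split=> //; rewrite !inE negb_or -c1j => /andP[wj wU].
  rewrite /c2 /swap; case: ifP => [/inch[E|E]|_]; last exact: (proj2 (c1U w)).
    by move: wU; rewrite -(proj1 (c1U w)) E uU.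
  by rewrite E eqxx in wj.
- move=> s sS; rewrite !inE -c1j => /orP[/eqP E|]; last exact: US.
  by have := jS s sS; rewrite E eqxx.
- apply/setP => z; rewrite !inE; apply/imsetP/orP => [[y yI ->]|].
    rewrite c2S ?IinS //; case: ifP => _; [by left; rewrite eqxx | right].
    by rewrite -IU imset_f.
  case=> [/eqP->|]; first by exists u.
  rewrite -IU => /imsetP[y yI ->].
  case: (boolP (y \in chain e (S :|: X) c1 (c1 u) j u)) => [/inch[E|E]|ny].
  + by exists v; rewrite // E c2v.
  + by have := jS y (IinS y yI); rewrite E eqxx.
  + by exists y; rewrite // c2S ?IinS // (negbTE ny).
Qed.

(* [c'] splits the classes other than [I] until they are linked; [c''] also shatters [I], and
   [linked_fine] bounds the coincidences that it leaves. *)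
Lemma keep S X Y c I :
  4 < q -> 2 ^ (#|S| - 3) < q -> sides e S X Y ->
  colouring e (S :|: X) c -> I \subset S -> I != set0 -> exact_class S I c ->
  exists c', [/\ colouring e (S :|: X) c', exact_class S I c', refines S c c' &
    (forall u v, u \in S :\: I -> v \in S :\: I -> c' u = c' v -> u = v) \/
    exists i i', [/\ [/\ i \in S :\: I, i' \in S :\: I, i != i' & c' i = c' i'],
      forall u v, u \in S :\: I -> v \in S :\: I -> c' u = c' v ->
        u = v \/ (u \in [set i; i']) && (v \in [set i; i']),
      strongly_linked e S X c' i i' &
      exists c'', [/\ colouring e (S :|: X) c'', c'' i = c'' i',
        forall u v, u \in S -> v \in S -> c'' u = c'' v ->
          u = v \/ (u \in [set i; i']) && (v \in [set i; i']) &
        forall u v, u \in S -> v \in S -> c'' u = c'' v -> strongly_linked e S X c'' u v]]].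
Proof.
move=> q4 qS sd c_col IS I0 cI.
have [c' [c'_col c'I ref link]] := keep_refine c_col IS cI.
exists c'; split=> //.
have /set0Pn[x0 x0I] := I0.
have [|c2 [U [c2_col aU c2U [US IU] link2]]] := shatter c'_col IS I0 (a := c' x0).
  by move=> s sS; rewrite eq_sym c'I.
have IinS x : x \in I -> x \in S by apply/subsetP.
have UI s : s \in S -> (c' s \in U) = (s \in I).
  move=> sS; apply/idP/idP => [/(US s sS)/eqP|sI]; first by rewrite eq_sym c'I.
  by have := c'I x0 s x0I sS; rewrite sI => /eqP <-.
have c2E s : s \in S :\: I -> c2 s = c' s.
  by rewrite inE => /andP[sI sS]; apply: (proj2 (c2U s)); rewrite UI.
have inSI s : s \in S -> s \notin I -> s \in S :\: I by rewrite inE => -> ->.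
have link3 u v : u \in S -> v \in S -> c2 u = c2 v -> strongly_linked e S X c2 u v.
  move=> uS vS cuv; have uvI : (u \in I) = (v \in I).
    by rewrite -!UI // -!(proj1 (c2U _)) cuv.
  case: (boolP (u \in I)) => uI; first by apply: link2; rewrite -?uvI.
  have uSI := inSI u uS uI; have vI : v \notin I by rewrite -uvI.
  have vSI := inSI v vS vI.
  have cuv' : c' u = c' v by rewrite -!c2E.
  move=> j jS; have jU : j \notin U.
    by rewrite -IU; apply/imsetP => -[y yI E]; have := jS y (IinS y yI); rewrite E eqxx.
  have uU : c' u \notin U by rewrite UI.
  have EU b w : b \notin U -> (c2 w == b) = (c' w == b).
    move=> bU; have [h1 h2] := c2U w; apply/eqP/eqP => E; last by rewrite h2 E.
    by rewrite -h2 // -h1 E.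
  have -> : bichrom (S :|: X) c2 (c2 u) j = bichrom (S :|: X) c' (c' u) j.
    by apply/setP => w; rewrite !inE (c2E u uSI) !EU.
  apply: link => // s sS; case: (boolP (s \in I)) => sI.
    by apply: contraNneq jU => <-; rewrite UI.
  by rewrite -c2E ?inSI // jS.
have fine := linked_fine e_sym e_irr quot ncol sd c2_col q4 qS link3.
case: (boolP [exists i in S :\: I, exists i' in S :\: I, (i != i') && (c' i == c' i')]); last first.
  rewrite negb_exists => /forallP H; left=> u v uS vS cuv; apply/eqP; apply: contraT => uv.
  have := H u; rewrite uS negb_exists => /forallP/(_ v).
  by rewrite vS uv cuv eqxx.
case/existsP=> i /andP[iSI /existsP[i' /and3P[i'SI ii' /eqP cii']]]; right.
have [iS i'S] : i \in S /\ i' \in S by move: iSI i'SI; rewrite !inE => /andP[_ ->] /andP[_ ->].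
have c2ii' : c2 i = c2 i' by rewrite !c2E.
have near := near_injective fine iS i'S ii' c2ii'.
exists i, i'; split=> //.
- move=> u v uSI vSI cuv; apply: near; rewrite ?c2E //.
    by move: uSI; rewrite inE => /andP[].
  by move: vSI; rewrite inE => /andP[].
- exact: link.
- by exists c2; split.
Qed.

End Keep.

(** * Counting labels for a single coincidence *)

Lemma ltn_neq_pred j k : j < k -> j != k.-1 -> j.+1 < k.
Proof. lia. Qed.

Lemma card_ord_lt p m : m <= p -> #|[set j : 'I_p | j < m]| = m.
Proof.
move=> mp; have winj : injective (widen_ord mp) by move=> i k /(congr1 val)/= /val_inj.
rewrite -[RHS]card_ord -(card_imset predT winj).
apply: eq_card => j; rewrite !inE; apply/idP/imsetP => [jt|[k _ ->]]; last exact: (valP k).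
by exists (Ordinal jt) => //; apply: val_inj.
Qed.

Lemma card_ord_lt1 p (b : nat) : b <= p -> #|[set j : 'I_p | j.+1 < b]| = b.-1.
Proof.
move=> bp; rewrite -(@card_ord_lt p b.-1); last by lia.
by apply: eq_card => j; rewrite !inE; apply/idP/idP; lia.
Qed.

Lemma card_small_subsets (T : finType) (A : {set T}) :
  #|[set F : {set T} | (F \subset A) && (#|F| <= 1)]| <= #|A|.+1.
Proof.
apply: (@leq_trans #|[set set0] :|: set1 @: A|); last first.
  by rewrite cardsU cards1 (leq_trans (leq_subr _ _)) // add1n (card_imset A set1_inj).
apply/subset_leq_card/subsetP => F; rewrite !inE => /andP[FA].
rewrite leq_eqVlt ltnS leqn0 cards_eq0 => /orP[/cards1P[x FE]|->//].
by apply/orP; right; rewrite FE imset_f // (subsetP FA) // FE inE.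
Qed.

(** The number of labels of node [b] in [linked_pair_false], where [k] nodes are not adjacent to the
    pair and [n] is the node of the pair. A node below [k] takes all sets of admissible
    predecessors, a node between takes sets of at most one, and node [n] takes subsets of the first
    [k.-1] nodes; if [k < 2] it gets an artificial second label, so that its class has a linking
    colour. *)
Definition label_bound k n b :=
  if b < k then 2 ^ b.-1 else if b < n then b.-1.+1 else if k < 2 then 2 else 2 ^ k.-1.

(** For [k < 2] the sum is 4, 6, 9 at [n = 2, 3, 4], while the premises guarantee only 5, 5, 9
    colours. The failure at [n = 3] is the exceptional case of five separator vertices, as
    [#|S| = n.+2] in the application. *)
Lemma label_count k n q : k.+2 <= n -> n != 3 -> 4 < q -> 2 ^ n.-1 < q ->
  \sum_(b < n.+1) label_bound k n b <= q.
Proof.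
move=> kn n3 q4 nq.
have nk : (n < k) = false by lia.
rewrite big_ord_recr /= /label_bound ltnn nk.
have E1 : \sum_(b < n) (if b < k then 2 ^ b.-1 else if b < n then b.-1.+1 else if k < 2 then 2 else 2 ^ k.-1)
    = \sum_(b < n) (if b < k then 2 ^ b.-1 else b.-1.+1).
  by apply: eq_bigr => b _; rewrite ltn_ord.
rewrite E1; case: (ltnP k 2) => k2.
  suff : \sum_(b < n) (if b < k then 2 ^ b.-1 else b.-1.+1) + 2 <= maxn 5 (2 ^ n.-1).+1.
    by move/leq_trans; apply; rewrite geq_max q4.
  have E2 : \sum_(b < n) (if b < k then 2 ^ b.-1 else b.-1.+1) = \sum_(b < n) b.-1.+1.
    apply: eq_bigr => b _; case: ltnP => // bk.
    by have -> : (b : nat) = 0 by lia.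
  rewrite {E1}E2; case: n {nk} kn n3 nq => [|[|[|[|n]]]] // kn _ _.
    by rewrite !big_ord_recr big_ord0.
  rewrite leq_max; apply/orP; right.
  elim: n {kn} => [|n IH]; first by rewrite !big_ord_recr big_ord0.
  rewrite big_ord_recr /=.
  have : n.+4 <= 2 ^ n.+3.
    by elim: n {IH} => // n IH; rewrite expnS; lia.
  move: IH; rewrite /= [2 ^ n.+4]expnS; lia.
apply: leq_trans nq.
have [d ->] : exists d, n = k + d.+2 by exists (n - k - 2); lia.
elim: d {n nk kn n3 E1} => [|d IH].
  have h1 : (k.+1 < k) = false by lia.
  rewrite !addnS addn0 !big_ord_recr /= h1 ltnn.
  have -> : \sum_(b < k) (if b < k then 2 ^ b.-1 else b.-1.+1) = \sum_(b < k) 2 ^ b.-1.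
    by apply: eq_bigr => b _; rewrite ltn_ord.
  rewrite sum_pow_half; last by lia.
  case: k k2 {h1} => [|[|k]] //= _.
  have : k.+2 <= 2 ^ k.+1 by elim: k => // k IH; rewrite expnS; lia.
  rewrite !expnS; lia.
have kk : (k + d.+2 < k) = false by lia.
rewrite addnS big_ord_recr /= kk.
have : k + d.+2 <= 2 ^ (k + d.+2).-1.
  have [m ->] : exists m, k + d.+2 = m.+1 by exists (k + d.+1); lia.
  by rewrite /=; elim: m => // m IHm; rewrite expnS; lia.
move: IH; have [m ->] : exists m, k + d.+2 = m.+1 by exists (k + d.+1); lia.
rewrite [in X in _ -> _ -> _ <= X]/= expnS /=; lia.
Qed.

Section Main.
Variables (V : finType) (e : rel V) (q : nat).
Hypotheses (e_sym : symmetric e) (e_irr : irreflexive e)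
  (quot : quotients_colourable e q)
  (ncol : forall c : V -> 'I_q, ~ colouring e setT c).
Implicit Types (S X Y I : {set V}) (c : V -> 'I_q).

(* The class [i, i'] is the last node, and the first nodes are the vertices not adjacent to it.  The
   candidates are the sets of these nodes with the last one, and the other sets of at most two nodes. *)
Lemma linked_pair_false S X Y c i i' :
  4 < q -> 2 ^ (#|S| - 3) < q -> #|S| != 5 -> sides e S X Y ->
  colouring e (S :|: X) c -> i \in S -> i' \in S -> i != i' -> c i = c i' ->
  (forall u v, u \in S -> v \in S -> c u = c v ->
     u = v \/ (u \in [set i; i']) && (v \in [set i; i'])) ->
  (forall u v, u \in S -> v \in S -> c u = c v -> strongly_linked e S X c u v) ->
  1 < #|[set x in S | e x i || e x i']| -> False.
Proof.
move=> q4 qS S5 sd c_col iS i'S ii' cii' only link N2.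
pose N := [set x in S | e x i || e x i'].
pose TJ := [set x in S | [&& x != i, x != i', ~~ e x i & ~~ e x i']].
have SX x : x \in S -> x \in S :|: X by move=> xS; rewrite inE xS.
have nii' : ~~ e i i'.
  by apply/negP => eii'; have := c_col i i' (SX i iS) (SX i' i'S) eii'; rewrite cii' eqxx.
have iN : i \notin N by rewrite inE e_irr (negbTE nii') !andbF.
have i'N : i' \notin N by rewrite inE e_irr e_sym (negbTE nii') !andbF.
pose l := enum TJ ++ enum N ++ [:: i].
pose k := #|TJ|; pose n := k + #|N|.
have l_size : size l = n.+1 by rewrite !size_cat -!cardE /= addnA addn1.
have inS x : x \in l = (x \in S) && (x != i').
  rewrite !mem_cat !mem_enum !inE.
  case: (eqVneq x i) => [->|xi]; first by rewrite iS ii' !orbT.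
  case: (eqVneq x i') => [->|xi']; first by rewrite e_irr e_sym (negbTE nii') !andbF.
  by case: (x \in S) => //=; case: (e x i); case: (e x i').
have TJN x : x \in TJ -> x \notin N.
  by rewrite !inE => /and5P[-> _ _ /negbTE-> /negbTE->].
have l_uniq : uniq l.
  rewrite !cat_uniq !enum_uniq /= !andbT has_cat /= !mem_enum orbF.
  rewrite (negbTE iN) andbT negb_or; apply/andP; split; last by rewrite !inE eqxx andbF.
  apply/hasPn => x; rewrite mem_enum => xN; rewrite mem_enum.
  by apply: contraL xN; exact: TJN.
have Sn : #|S| = n.+2.
  have -> : #|S| = #|i' |: [set x in l]|.
    apply: eq_card => x; rewrite !inE inS.
    by case: eqVneq => [->|]; rewrite ?i'S ?andbT.
  rewrite cardsU1 inE inS i'S eqxx /= add1n cardsE (card_uniqP l_uniq) l_size //.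
have kn : k.+2 <= n by rewrite /n -addn2 leq_add2l.
have nq : 2 ^ n.-1 < q by move: qS; rewrite Sn; have -> : n.+2 - 3 = n.-1 by lia.
have n3 : n != 3 by move: S5; rewrite Sn.
have kn0 : (n < k) = false by rewrite ltnNge leq_addr.
pose base (t : 'I_n.+1) := c (nth i l t).
have nthl (t : 'I_n.+1) : nth i l t \in l by rewrite mem_nth // l_size.
have c_inj : {in l &, injective c}.
  move=> u v; rewrite !inS => /andP[uS ui'] /andP[vS vi'] cuv.
  case: (only u v uS vS cuv) => // /andP[]; rewrite !inE (negbTE ui') (negbTE vi') !orbF.
  by move=> /eqP -> /eqP ->.
have base_inj : injective base.
  move=> t t' /(c_inj _ _ (nthl t) (nthl t')) /eqP.
  by rewrite nth_uniq ?l_size // => /eqP/val_inj.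
have base_S t : exists2 s, s \in S & c s = base t.
  by exists (nth i l t) => //; have := nthl t; rewrite inS => /andP[].
have S_base s : s \in S -> exists t, c s = base t.
  have in_l u : u \in l -> exists t, c u = base t.
    move=> /(nthP i)[t]; rewrite l_size => tn <-; by exists (Ordinal tn).
  move=> sS; case: (eqVneq s i') => [->|si']; last by apply: in_l; rewrite inS sS.
  by rewrite -cii'; apply: in_l; rewrite inS iS.
pose last : 'I_n.+1 := ord_max.
have base_last : base last = c i.
  by rewrite /base /l catA nth_cat size_cat -!cardE ltnn subnn.
(* A candidate set with the last node contains otherwise only nodes below [k], so the last node does
   better to ignore [k.-1] than its predecessor. *)
pose r (t : 'I_n.+1) : 'I_n.+1 := if t == last then inord k.-1 else ordp t.
pose TT (T : {set 'I_n.+1}) := if last \in T then [forall j in T, (j == last) || (j < k)] else #|T| <= 2.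
pose okl (b : 'I_n.+1) (F : {set 'I_n.+1}) :=
  if b < k then F \subset [set j : 'I_n.+1 | j.+1 < b]
  else if b < n then (F \subset [set j : 'I_n.+1 | j.+1 < b]) && (#|F| <= 1)
  else (F \subset [set j : 'I_n.+1 | j.+1 < k]) || ((k < 2) && (F == [set last])).
pose Lab := [set L : 'I_n.+1 * {set 'I_n.+1} | okl L.1 L.2].
have labq : #|Lab| <= q.
  rewrite (card_dep_pairs okl); apply: leq_trans (label_count kn n3 q4 nq).
  apply: leq_sum => b _; rewrite /okl /label_bound.
  have pw m : m <= n.+1 -> #|[set F : {set 'I_n.+1} | F \subset [set j : 'I_n.+1 | j.+1 < m]]| = 2 ^ m.-1.
    by move=> mn; rewrite -(@card_ord_lt1 n.+1 m) // -card_powerset.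
  have bn := ltn_ord b.
  case: ifP => bk; first by rewrite pw // ltnW.
  case: ifP => bn'.
    by apply: leq_trans (card_small_subsets _) _; rewrite card_ord_lt1 // ltnW.
  have kn' : k <= n.+1 by rewrite (leq_trans (leq_addr #|N| k)).
  case: ltnP => k2 /=; last first.
    by under eq_finset => F do rewrite orbF; rewrite pw.
  apply: (@leq_trans #|[set F : {set 'I_n.+1} | F \subset [set j : 'I_n.+1 | j.+1 < k]] :|: [set [set last]]|).
    by apply/subset_leq_card/subsetP => F; rewrite !inE.
  rewrite cardsU cards1 pw // (leq_trans (leq_subr _ _)) //.
  by have -> : k.-1 = 0 by lia.
have last_n (b : 'I_n.+1) : ~~ (b < n) -> b = last.
  by move=> bn; apply: val_inj => /=; have := ltn_ord b; lia.
have [|||||||psi [psi_col psi_c psi_fin]] :=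
  @engine_labels V e q e_sym e_irr quot ncol S X Y c n.+1 base TT r Lab isT sd c_col base_inj.
- exact: S_base.
- exact: base_S.
- exact: link.
- move=> T b; rewrite /TT inE /= /okl; case: ifP => [lT /forall_inP Tk|lT T2] bT.
    case: (eqVneq b last) => [bl|bl].
      rewrite bl /= ltnn; rewrite kn0.
      apply/orP; left; apply/subsetP => j; rewrite !inE /r eqxx => /and3P[jT jn].
      rewrite -val_eqE /= inordK; last by rewrite ltnS (leq_trans (leq_pred k)) // leq_addr.
      have := Tk j jT; case: (eqVneq j last) => [jl|_ /= jk jk']; last exact: ltn_neq_pred.
      by move: jn; rewrite jl ltnn.
    have := Tk b bT; rewrite (negbTE bl) /= => bk; rewrite bk.
    apply/subsetP => j; rewrite !inE /r (negbTE bl) => /and3P[jT jb].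
    by rewrite -val_eqE /=; apply: ltn_neq_pred.
  have bl : b != last by apply: contraTneq bT => ->; rewrite lT.
  have sub : before r T b \subset [set j : 'I_n.+1 | j.+1 < b].
    apply/subsetP => j; rewrite !inE /r (negbTE bl) => /and3P[jT jb].
    by rewrite -val_eqE /=; apply: ltn_neq_pred.
  case: ifP => // _; case: ifP => bn; last by move: bl; rewrite (last_n b) ?eqxx // bn.
  rewrite sub /= -ltnS; apply: leq_trans T2; rewrite (cardsD1 b T) bT ltnS.
  apply/subset_leq_card/subsetP => j; rewrite !inE => /and3P[-> jb _].
  by rewrite andbT -val_eqE /= neq_ltn jb.
- move=> t; exists set0; rewrite inE /okl /= !sub0set cards0.
  by case: ifP => // _; case: ifP.
- move=> t u v uS vS uv cu cv.
  have tl : t = last.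
    apply: base_inj; rewrite base_last -cu.
    case: (only u v uS vS (etrans cu (esym cv))) => [E|]; first by rewrite E eqxx in uv.
    by rewrite !inE => /andP[/orP[/eqP->|/eqP->]].
  rewrite tl; have nk : (last < k) = false := kn0.
  have two F : F != set0 -> (last, F) \in Lab -> 1 < #|[set F | (last, F) \in Lab]|.
    move=> F0 FL; rewrite (cardD1 set0) (cardD1 F) [F \in _]inE [F \in _]inE F0 inE FL.
    by rewrite !inE /okl nk /= ltnn sub0set.
  case: (ltnP k 2) => k2.
    apply: (two [set last]); first by apply/set0Pn; exists last; rewrite inE.
    by rewrite inE /okl nk /= ltnn k2 eqxx orbT.
  apply: (two [set ord0]); first by apply/set0Pn; exists ord0; rewrite inE.
  by rewrite inE /okl nk /= ltnn sub1set inE /= k2.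
- exact: labq.
(* The class of the pair in [psi] is kept, and [keep] splits the rest on the side of [Y]. Apart from
   the pair, [T] has only vertices not adjacent to it, and every other class ends up with at most
   two vertices, so all classes are candidates. *)
pose T := [set s in S | psi s == psi i].
have TS : T \subset S by apply/subsetP => s; rewrite inE => /andP[].
have iT : i \in T by rewrite inE iS eqxx.
have i'T : i' \in T by rewrite inE i'S (psi_c i' i) ?eqxx.
have T0 : T != set0 by apply/set0Pn; exists i.
have psiT : exact_class S T psi.
  by move=> u v; rewrite !inE => /andP[_ /eqP ->] ->; rewrite eq_sym.
have [g [g_col gT gref gcase]] := keep e_sym e_irr quot ncol q4 qS (sidesC e_sym sd) psi_col TS T0 psiT.
have gii' : g i = g i' by apply/eqP; rewrite gT.
apply: (psi_fin g g_col) => //.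
  move=> u v uS vS /(only u v uS vS)[->//|]; rewrite !inE.
  by case/andP=> /orP[]/eqP-> /orP[]/eqP->.
move=> s sS; set A := [set t | _]; rewrite /TT.
have lastA : (last \in A) = (s \in T).
  rewrite inE base_last; apply/existsP/idP => [[s' /and3P[s'S /eqP cs' /eqP gs']]|sT].
    have s'T : s' \in T.
      case: (only s' i s'S iS cs') => [->//|]; rewrite !inE => /andP[/orP[]/eqP-> _].
        by rewrite iS eqxx.
      by move: i'T; rewrite inE.
    by have := gT s' s s'T sS; rewrite gs' eqxx => /esym.
  by exists i; rewrite iS eqxx /= gT.
rewrite lastA; case: (boolP (s \in T)) => sT.
  apply/forall_inP => j; rewrite inE => /existsP[s' /and3P[s'S /eqP cs' /eqP gs']].
  case: (eqVneq j last) => //= jl.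
  have wl := nthl j; set w := nth i l j in wl; have := wl; rewrite inS => /andP[wS wi'].
  have sw : s' = w.
    case: (only s' w s'S wS cs') => // /andP[_]; rewrite !inE (negbTE wi') orbF => /eqP wi.
    by case/eqP: jl; apply: base_inj; rewrite base_last /base -/w wi.
  have wT : w \in T by have := gT s w sT wS; rewrite -sw gs' eqxx => /esym.
  rewrite ltnNge; apply/negP => kj.
  have wN : w \in N.
    have jn : j < n by rewrite ltn_neqAle -ltnS ltn_ord andbT; apply: contraNneq jl => jn; apply/eqP/val_inj.
    rewrite /w /l nth_cat -cardE -/k ltnNge kj /= nth_cat -cardE.
    have -> : j - k < #|N| by rewrite ltn_subLR.
    by rewrite -mem_enum mem_nth // -cardE ltn_subLR.
  have SY z : z \in S -> z \in S :|: Y by move=> zS; rewrite inE zS.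
  move: wT wN; rewrite !inE => /andP[_ /eqP pw] /andP[_ /orP[]] ew.
    by have := psi_col w i (SY w wS) (SY i iS) ew; rewrite pw eqxx.
  by have := psi_col w i' (SY w wS) (SY i' i'S) ew; rewrite pw (psi_c i i') ?eqxx.
have notT z : z \in S -> g z = g s -> z \in S :\: T.
  move=> zS gz; rewrite inE zS andbT; apply: contra sT => zT.
  by have := gT z s zT sS; rewrite gz eqxx => <-.
have [M M2 MP] : exists2 M : {set V}, #|M| <= 2 & forall z, z \in S -> g z = g s -> z \in M.
  have sST := notT s sS erefl.
  case: gcase => [inj|[i1 [i2 [_ ginj _ _]]]].
    exists [set s]; first by rewrite cards1.
    by move=> z zS gz; rewrite inE; apply/eqP/inj => //; apply: notT.
  case: (boolP (s \in [set i1; i2])) => s12.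
    exists [set i1; i2]; first by rewrite cards2; case: eqP.
    by move=> z zS gz; case: (ginj z s (notT z zS gz) sST gz) => [->//|/andP[]].
  exists [set s]; first by rewrite cards1.
  move=> z zS gz; case: (ginj z s (notT z zS gz) sST gz) => [->|/andP[_]]; first by rewrite inE.
  by rewrite (negbTE s12).
rewrite -(card_imset _ base_inj); apply: leq_trans M2; apply: leq_trans (leq_imset_card c M).
apply/subset_leq_card/subsetP => _ /imsetP[t tA ->]; move: tA; rewrite inE.
case/existsP=> s' /and3P[s'S /eqP <- /eqP gs']; apply: imset_f; exact: MP.
Qed.

End Main.

(** * Separators of size five *)

Lemma spare_colour q (l : seq 'I_q) : size l < q -> exists j, j \notin l.
Proof.
move=> lq; suff /card_gt0P[j] : 0 < #|[predC l]| by exists j.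
rewrite -(ltn_add2l #|l|) addn0 cardC card_ord.
exact: leq_ltn_trans (card_size l) lq.
Qed.

Section Five.
Variables (V : finType) (e : rel V) (q : nat).
Hypotheses (e_sym : symmetric e) (e_irr : irreflexive e)
  (quot : quotients_colourable e q)
  (ncol : forall c : V -> 'I_q, ~ colouring e setT c).
Implicit Types (S X Y I J : {set V}) (c : V -> 'I_q).

Definition only_pair S (x y : V) c := forall u v, u \in S -> v \in S ->
  (c u == c v) = (u == v) || (u \in [set x; y]) && (v \in [set x; y]).

Lemma glue_class S X Y J c1 c2 :
  sides e S X Y -> colouring e (S :|: X) c1 -> colouring e (S :|: Y) c2 ->
  exact_class S J c1 -> exact_class S J c2 ->
  (forall u v, u \in S :\: J -> v \in S :\: J -> (c1 u == c1 v) = (c2 u == c2 v)) -> False.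
Proof.
move=> sd col1 col2 J1 J2 ker; apply: (glue e_sym ncol sd col1 col2) => u v uS vS.
case: (boolP (u \in J)) => uJ; first by rewrite J1 // J2.
case: (boolP (v \in J)) => vJ; first by rewrite [c1 u == _]eq_sym [c2 u == _]eq_sym J1 // J2.
by apply: ker; rewrite inE ?uJ ?vJ.
Qed.

(** If [keep] made all vertices off [J] distinct, the result would have the kernel of [c] and the
    two would glue; so one coincidence remains off [J]. *)
Lemma contract_pair S X Y c i i' (J := [set i; i']) :
  4 < q -> 2 ^ (#|S| - 3) < q -> sides e S X Y ->
  colouring e (S :|: X) c -> J \subset S -> exact_class S J c ->
  (forall u v, u \in S :\: J -> v \in S :\: J -> c u = c v -> u = v) ->
  exists g a b, [/\ colouring e (S :|: Y) g, exact_class S J g,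
    [/\ a \in S :\: J, b \in S :\: J & a != b] & only_pair (S :\: J) a b g].
Proof.
move=> q4 qS sd c_col JS cJ inj.
have iJ : i \in J by rewrite !inE eqxx.
have J0 : J != set0 by apply/set0Pn; exists i.
have [|f [f_col fJ]] := side_class e_sym e_irr quot sd JS J0.
  move=> u v uJ vJ; apply/negP => uv.
  have [uS vS] := (subsetP JS u uJ, subsetP JS v vJ).
  have := c_col u v; rewrite !inE uS vS => /(_ isT isT uv).
  by have := cJ u v uJ vS; rewrite vJ => ->.
have [g [g_col gJ _ gcase]] := keep e_sym e_irr quot ncol q4 qS (sidesC e_sym sd) f_col JS J0 fJ.
case: gcase => [ginj|[a [b [[aS bS ab gab] gonly _ _]]]].
  exfalso; apply: (glue_class sd c_col g_col cJ gJ) => u v uS vS.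
  apply/eqP/eqP => [/inj E|/ginj E]; first by rewrite E.
  by rewrite E.
exists g, a, b; split=> // u v uS vS.
apply/eqP/idP => [/(gonly u v uS vS)[->|->]|]; rewrite ?eqxx ?orbT //.
case/orP => [/eqP->//|]; rewrite !inE.
by case/andP=> /orP[]/eqP-> /orP[]/eqP->.
Qed.

(* The kernel of [g] must be the class [J] and the pair [x, w], so [x] and [w] are linked.  Contracting
   the Kempe chain of [J] and the component of [x] in the [x]-[w] chain without [w] leaves only the
   kernels of [c0] and [c] for the other side. *)
Lemma five_two S X Y c c0 i i' x y w (J := [set i; i']) :
  4 < q -> 2 ^ (#|S| - 3) < q -> sides e S X Y ->
  S :\: J = [set x; y; w] -> i != i' -> J \subset S -> x != y -> x != w -> e y w ->
  (forall s, s \in S :\: J -> e s i || e s i') ->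
  colouring e (S :|: X) c0 -> exact_class S J c0 -> only_pair (S :\: J) x y c0 ->
  colouring e (S :|: X) c -> exact_class S J c ->
  (forall u v, u \in S :\: J -> v \in S :\: J -> c u = c v -> u = v) ->
  strongly_linked e S X c i i' -> False.
Proof.
move=> q4 qS sd SJ ii' JS xy xw yw dom c0_col c0J c0xy c_col cJ cinj link.
have [xSJ ySJ wSJ] : [/\ x \in S :\: J, y \in S :\: J & w \in S :\: J].
  by rewrite SJ !inE !eqxx !orbT.
have yw' : y != w by apply: contraTneq yw => ->; rewrite e_irr.
have SJS s : s \in S :\: J -> s \in S by rewrite inE => /andP[].
have inSJ s : s \in S -> s \notin J -> s \in S :\: J by rewrite [s \in _ :\: _]inE => -> ->.
have iJ : i \in J by rewrite !inE eqxx.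
have i'J : i' \in J by rewrite !inE eqxx orbT.
have iS := subsetP JS i iJ; have i'S := subsetP JS i' i'J.
have SX s : s \in S -> s \in S :|: X by move=> sS; rewrite inE sS.
have SY s : s \in S -> s \in S :|: Y by move=> sS; rewrite inE sS.
have cii' : c i = c i' by apply/eqP; rewrite cJ.
have ciN s : s \in S :\: J -> (c s == c i) = false.
  by rewrite inE => /andP[sJ sS]; rewrite eq_sym cJ // (negbTE sJ).
have cE u v : u \in S :\: J -> v \in S :\: J -> (c u == c v) = (u == v).
  by move=> uS vS; apply/eqP/eqP => [/cinj->//|->].
have nJ u v : u \in J -> v \in J -> ~~ e u v.
  move=> uJ vJ; apply/negP => uv; have [uS vS] := (subsetP JS u uJ, subsetP JS v vJ).
  by have := c_col u v (SX u uS) (SX v vS) uv; rewrite cJ // vJ.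
have [g [a [b [g_col gJ [aS bS ab] gonly]]]] := contract_pair q4 qS sd c_col JS cJ cinj.
have gab : g a = g b by apply/eqP; rewrite gonly // !inE !eqxx !orbT.
(* The pair [y], [w] is an edge, and the pair [x], [y] would give the kernel of [c0]. *)
have abxw : [set a; b] = [set x; w].
  have nab : ~~ e a b.
    apply/negP => eab; have := g_col a b (SY a (SJS a aS)) (SY b (SJS b bS)) eab.
    by rewrite gab eqxx.
  have nxy : [set a; b] != [set x; y].
    apply/eqP => E; apply: (glue_class sd c0_col g_col c0J gJ) => u v uS vS.
    by rewrite c0xy // gonly // E.
  move: aS bS; rewrite SJ !inE -!orbA => /or3P[]/eqP aE /or3P[]/eqP bE;
    move: ab nab nxy; rewrite aE bE ?eqxx ?yw //=.
  - by rewrite setUC eqxx.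
  - by rewrite setUC.
  - by rewrite e_sym yw.
have gxw u v : u \in S :\: J -> v \in S :\: J ->
    (g u == g v) = (u == v) || (u \in [set x; w]) && (v \in [set x; w]).
  by move=> uS vS; rewrite gonly // abxw.
pose K := bichrom (S :|: X) c (c x) (c w).
have KZ s : s \in S :\: J -> s \in K = (s == x) || (s == w).
  move=> sS; rewrite inE SX ?SJS //=.
  by congr (_ || _); apply/eqP/eqP => [/cinj->//|->].
have iK s : s \in J -> s \notin K.
  move=> sJ; rewrite inE negb_and negb_or !(cJ s) ?SJS //.
  by move: xSJ wSJ; rewrite !inE => /andP[-> _] /andP[-> _]; rewrite orbT.
(* Otherwise a Kempe change at [w] would give it the colour of [x] and produce the kernel of [g] on
   the side of [X]. *)
have xw_link : connect (inner e K) x w.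
  apply: contraT => nxw.
  have wB : w \in bichrom (S :|: X) c (c x) (c w) by rewrite inE SX ?SJS // eqxx orbT.
  have c1_col := swap_colouring e_sym wB c_col.
  set c1 := swap _ _ _ _ _ _ in c1_col.
  have chw s : s \in S -> s \in chain e (S :|: X) c (c x) (c w) w = (s == w).
    move=> sS; apply/idP/eqP => [|->]; last exact: chain_refl.
    rewrite inE => ws; apply/eqP; apply: contraNT nxw; rewrite eq_sym => ws'.
    have [_ sK] := inner_connect_in e_sym ws ws'.
    have sSJ : s \in S :\: J.
      by rewrite inE sS andbT; apply: contraL sK; exact: iK.
    move: sK; rewrite -/K KZ // => /orP[/eqP sx|/eqP sw]; last by rewrite sw eqxx in ws'.
    by rewrite inner_csym // -sx.
  have c1E s : s \in S -> c1 s = if s == w then c x else c s.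
    by move=> sS; rewrite /c1 /swap chw //; case: eqP => // ->; rewrite tpermR.
  have wJ : w \notin J by move: wSJ; rewrite inE => /andP[].
  have JnE s t : s \in J -> t \in S :\: J -> s == t = false.
    by move=> sJ tS; apply/eqP => E; move: tS; rewrite -E inE sJ.
  exfalso; apply: (glue_class sd c1_col g_col _ gJ).
    move=> s t sJ tS; rewrite (c1E s (subsetP JS s sJ)) (c1E t tS) (JnE s w) //.
    case: (eqVneq t w) => [->|_]; last exact: cJ.
    by rewrite cJ ?SJS // (negbTE wJ); move: xSJ; rewrite inE => /andP[/negbTE->].
  move=> u v uS vS; rewrite gxw // !c1E ?SJS // !inE.
  case: (eqVneq u w) => [->|uw]; case: (eqVneq v w) => [->|vw]; rewrite ?eqxx ?orbT //=.
  - by rewrite cE // orbF eq_sym.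
  - by rewrite cE // (negbTE uw) orbF andbT.
  - rewrite cE // !orbF; case: (eqVneq u x) => [->|_] /=; last by rewrite orbF.
    by rewrite [v == x]eq_sym orbb.
(* On [S] the colouring [c] uses four colours, so [4 < q] leaves one for the chain of [J]. *)
have [|j jN] := @spare_colour q [:: c i; c x; c y; c w]; first exact: q4.
have Sall s : s \in S -> s \in J \/ [\/ s = x, s = y | s = w].
  move=> sS; case: (boolP (s \in J)) => sJ; [by left | right].
  have : s \in S :\: J by rewrite inE sJ.
  by rewrite SJ !inE -orbA => /or3P[]/eqP->; [constructor 1|constructor 2|constructor 3].
pose N := chain e (S :|: X) c (c i) j i.
pose R := [set v | connect (inner e (K :\ w)) x v].
have jS s : s \in S -> c s != j.
  move=> sS; have := jN; rewrite !inE !negb_or => /and4P[j1 j2 j3 j4].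
  have [sJ|[]->] := Sall s sS; rewrite eq_sym //.
  by have /eqP <- : c i == c s by rewrite cJ.
have NB v : v \in N -> v \in bichrom (S :|: X) c (c i) j.
  rewrite inE => iv; case: (eqVneq i v) => [<-|neq]; first by rewrite inE SX // eqxx.
  by have [] := inner_connect_in e_sym iv neq.
have RK v : v \in R -> v \in K :\ w.
  rewrite inE => xv; case: (eqVneq x v) => [<-|neq]; first by rewrite inE in_set1 xw KZ // eqxx.
  by have [] := inner_connect_in e_sym xv neq.
have NJ s : s \in S -> s \in N = (s \in J).
  move=> sS; apply/idP/idP => [/NB|sJ].
    by rewrite inE (negbTE (jS s sS)) orbF eq_sym cJ // => /andP[].
  move: sJ; rewrite !inE => /orP[/eqP->|/eqP->]; first exact: connect0.
  exact: link.
have RS s : s \in S -> s \in R = (s == x).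
  move=> sS; apply/idP/eqP => [/RK|->]; last by rewrite inE connect0.
  rewrite inE in_set1 => /andP[sw sK].
  have sSJ : s \in S :\: J by rewrite inE sS andbT; apply: contraL sK; apply: iK.
  by move: sK; rewrite KZ // (negbTE sw) orbF => /eqP.
have NR v : v \in N -> v \notin R.
  move=> /NB; rewrite inE => /andP[_ vN]; apply/negP => /RK.
  rewrite inE => /andP[_]; rewrite inE => /andP[_ vK].
  have [jx jw] : c x != j /\ c w != j by rewrite !jS ?SJS.
  move: vN vK => /orP[]/eqP-> /orP[] /eqP E.
  - by have := ciN x xSJ; rewrite E eqxx.
  - by have := ciN w wSJ; rewrite E eqxx.
  - by rewrite E eqxx in jx.
  - by rewrite E eqxx in jw.
pose bag v := if v \in N then Some i else if v \in R then Some x else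
  if v == w then Some w else if v == y then Some y else None.
have notJ s : s \in S :\: J -> s \notin J by rewrite inE => /andP[].
have bJ s : s \in J -> bag s = Some i by move=> sJ; rewrite /bag NJ ?(subsetP JS) // sJ.
have bSJ s : s \in S :\: J -> bag s = Some s.
  move=> sSJ; rewrite /bag NJ ?RS ?SJS // (negbTE (notJ s sSJ)).
  move: sSJ; rewrite SJ !inE => /orP[/orP[]|]/eqP->; rewrite ?eqxx //.
    by rewrite eq_sym (negbTE xy) (negbTE yw').
  by rewrite eq_sym (negbTE xw).
have bagS s : s \in S -> bag s.
  by move=> sS; case: (boolP (s \in J)) => sJ; [rewrite bJ | rewrite bSJ // inSJ].
have [||||f [f1 f2]] := contract_bags e_sym e_irr quot (bag := bag) sd.
- move=> v; rewrite /bag; case: ifP => [/NB|_]; first by rewrite inE => /andP[].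
  case: ifP => [/RK|_]; first by rewrite inE => /andP[_]; rewrite inE => /andP[].
  by case: eqP => [-> _|_]; [rewrite SX ?SJS | case: eqP => // -> _; rewrite SX ?SJS].
- exact: bagS.
- move=> v; rewrite {1 3}/bag; case: ifP => [_ _|_]; first by exists i; rewrite ?bJ.
  case: ifP => [_ _|_]; first by exists x; rewrite ?bSJ ?SJS.
  case: ifP => [_ _|_]; first by exists w; rewrite ?bSJ ?SJS.
  by case: ifP => [_ _|//]; exists y; rewrite ?bSJ ?SJS.
- have bagN v : v \in N -> bag v = Some i by rewrite /bag => ->.
  have bagR v : v \in R -> bag v = Some x.
    by move=> vR; rewrite /bag (negbTE (contraL (@NR v) vR)) vR.
  have conn v d : bag v = Some d -> connect (inner e [set z | bag z == Some d]) d v.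
    rewrite {1}/bag; case: ifP => [vN [<-]|_].
      have /reach_connect : connect (inner e (bichrom (S :|: X) c (c i) j)) i v.
        by move: vN; rewrite inE.
      by apply: inner_connect_sub; apply/subsetP => z zN; rewrite inE bagN.
    case: ifP => [vR [<-]|_].
      have /reach_connect : connect (inner e (K :\ w)) x v by move: vR; rewrite inE.
      by apply: inner_connect_sub; apply/subsetP => z zR; rewrite inE bagR.
    case: eqP => [-> [->]|_]; first exact: connect0.
    by case: eqP => [-> [->]|_] //; exact: connect0.
  move=> u v; case E : (bag u) => [d|//] _ /esym vE.
  by apply: connect_trans (conn v d vE); rewrite inner_csym //; apply: conn.
have f_col : colouring e (S :|: Y) f.
  move=> u v uSY vSY uv; apply/eqP; apply: f2 => //.
  - by move: uSY; rewrite inE => /orP[/bagS->|->]; rewrite ?orbT.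
  - by move: vSY; rewrite inE => /orP[/bagS->|->]; rewrite ?orbT.
  move=> buv; move: uSY; rewrite inE => /orP[uS|//].
  move: vSY; rewrite inE => /orP[vS|vY]; last first.
    have [vS vX] := side_notin (sidesC e_sym sd) vY.
    have : bag v by rewrite -buv bagS.
    rewrite /bag; case: ifP => [/NB|_]; first by rewrite inE inE (negbTE vS) (negbTE vX).
    case: ifP => [/RK|_].
      by rewrite inE => /andP[_]; rewrite inE inE (negbTE vS) (negbTE vX).
    case: eqP => [E|_]; first by move: vS; rewrite E SJS.
    by case: eqP => // E; move: vS; rewrite E SJS.
  exfalso; move: buv.
  case: (boolP (u \in J)) => uJ; case: (boolP (v \in J)) => vJ.
  - by have := nJ u v uJ vJ; rewrite uv.
  - by rewrite bJ // bSJ ?inSJ // => -[E]; rewrite -E iJ in vJ.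
  - by rewrite bSJ ?inSJ // bJ // => -[E]; rewrite E iJ in uJ.
  - by rewrite !bSJ ?inSJ // => -[E]; rewrite E e_irr in uv.
(* By [dom], every vertex of [S :\: J] is adjacent to the bag of [J]. *)
have fJ : exact_class S J f.
  have fi s : s \in J -> f s = f i by move=> sJ; apply: f1; rewrite !bJ.
  move=> u v uJ vS; case: (boolP (v \in J)) => vJ; first by rewrite !fi ?eqxx.
  have vSJ : v \in S :\: J by rewrite inSJ.
  have nb : Some v = Some i -> v \in Y by case=> E; rewrite E iJ in vJ.
  apply/negbTE; rewrite fi // eq_sym; apply/eqP; case/orP: (dom v vSJ) => vi.
    by apply: f2 => //; rewrite ?(bSJ v vSJ) ?(bJ i iJ).
  by rewrite -(fi i' i'J); apply: f2 => //; rewrite ?(bSJ v vSJ) ?(bJ i' i'J).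
have fyw : f y <> f w.
  by apply: f2 => //; rewrite ?bSJ // => -[E]; rewrite E eqxx in yw'.
have fxw : f x <> f w.
  have xR : x \in R by rewrite inE connect0.
  have wR : w \notin R by rewrite RS ?SJS // eq_sym.
  have [a' [b' [aR bR /and3P[aK bK ab']]]] := connect_break (P := fun v => v \in R) xw_link xR wR.
  have bw : b' = w.
    apply/eqP; apply: contraNT bR => bw; move: (aR) (RK _ aR) => + aKw.
    rewrite !inE => xa; apply: connect_trans xa (connect1 _).
    by rewrite /inner aKw ab' 2!inE bw bK.
  have ba : bag a' = Some x by rewrite /bag (negbTE (contraL (@NR a') aR)) aR.
  have <- : f a' = f x by apply: f1; rewrite ba ?(bSJ x xSJ).
  rewrite bw in ab'; apply: f2; rewrite ?ba ?(bSJ w wSJ) //.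
  by case=> E; rewrite E eqxx in xw.
have fw s : s \in S :\: J -> s != w -> (f s == f w) = false.
  rewrite SJ !inE -orbA => /or3P[]/eqP-> //; last by rewrite eqxx.
    by move=> _; apply/eqP.
  by move=> _; apply/eqP.
have S3 u : u \in S :\: J -> [\/ u = x, u = y | u = w].
  by rewrite SJ !inE -orbA => /or3P[]/eqP->; [constructor 1|constructor 2|constructor 3].
have wxy : (w == x = false) * (w == y = false) by rewrite ![w == _]eq_sym (negbTE xw) (negbTE yw').
have fwE s : s \in S :\: J -> s != w -> (f w == f s) = false.
  by move=> sS sw; rewrite eq_sym fw.
have yx : (y == x) = false by rewrite eq_sym (negbTE xy).
(* In [f] the vertex [w] differs from both [x] and [y]; whether these two agree decides between [c0]
   and [c]. *)
case: (eqVneq (f x) (f y)) => fxy.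
  apply: (glue_class sd c0_col f_col c0J fJ) => u v uS vS; rewrite c0xy // !inE.
  by have [->|->|->] := S3 u uS; have [->|->|->] := S3 v vS;
    rewrite ?eqxx ?(negbTE xy) ?yx ?wxy ?(negbTE xw) ?(negbTE yw') ?fxy ?fw ?fwE ?eqxx ?orbT.
apply: (glue_class sd c_col f_col cJ fJ) => u v uS vS; rewrite cE //.
have fyx : (f y == f x) = false by rewrite eq_sym (negbTE fxy).
by have [->|->|->] := S3 u uS; have [->|->|->] := S3 v vS;
  rewrite ?eqxx ?(negbTE xy) ?yx ?wxy ?(negbTE xw) ?(negbTE yw') ?(negbTE fxy) ?fyx ?fw ?fwE.
Qed.

End Five.

(** * Five vertices split into an independent triple and a pair *)

Section Triple.
Variables (V : finType) (e : rel V) (q : nat).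
Hypotheses (e_sym : symmetric e) (e_irr : irreflexive e)
  (quot : quotients_colourable e q)
  (ncol : forall c : V -> 'I_q, ~ colouring e setT c).
Variables (S X Y I : {set V}) (i i' : V) (c : V -> 'I_q) (a d : 'I_q).
Let J := [set i; i'].
Hypotheses (sd : sides e S X Y) (c_col : colouring e (S :|: X) c)
  (SE : S = I :|: J) (cI : forall s, s \in I -> c s = a)
  (cJ : forall s, s \in J -> c s = d) (ad : a != d).

(** The chain of [J] for the colours [d] and [j] is disjoint from this set, so its components can be
    contracted, or recoloured, independently of that chain. *)
Definition avoiding j := [set v in S :|: X | (c v != d) && (c v != j)].

(* The components of [avoiding j] that meet [I] are contracted together with the chain of [J]; the
   resulting partition of [I] is reproduced on [S :|: X] by recolouring whole components. *)
Lemma triple_spread j :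
  #|I|.+2 <= q -> j != a -> j != d ->
  connect (inner e (bichrom (S :|: X) c d j)) i i' ->
  (forall x, x \in I -> exists y, [/\ y \in I, connect (inner e (avoiding j)) x y & e y i || e y i']) ->
  False.
Proof.
move=> Iq ja jd link dom.
pose A := avoiding j; pose D := ~: [set d; j].
have iJ : i \in J by rewrite !inE eqxx.
have i'J : i' \in J by rewrite !inE eqxx orbT.
have SX s : s \in S -> s \in S :|: X by move=> sS; rewrite inE sS.
have IS s : s \in I -> s \in S by move=> sI; rewrite SE inE sI.
have JS s : s \in J -> s \in S by move=> sJ; rewrite SE inE sJ orbT.
have IJ s : s \in I -> s \notin J.
  by move=> sI; apply/negP => sJ; move: ad; rewrite -(cI sI) (cJ sJ) eqxx.
have Scase s : s \in S -> s \in I \/ s \in J by rewrite SE inE => /orP.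
have IA s : s \in I -> s \in A by move=> sI; rewrite inE SX ?IS // cI // ad eq_sym ja.
have JA s : s \in J -> s \notin A by move=> sJ; rewrite inE cJ // eqxx andbF.
have aD : a \in D by rewrite !inE negb_or ad eq_sym ja.
pose N := chain e (S :|: X) c d j i.
have iB : i \in bichrom (S :|: X) c d j by rewrite inE SX ?JS // cJ // eqxx.
have NB v : v \in N -> v \in bichrom (S :|: X) c d j.
  rewrite inE => iv; case: (eqVneq i v) => [<-//|neq].
  by have [] := inner_connect_in e_sym iv neq.
have NA v : v \in N -> v \notin A.
  move=> /NB; rewrite !inE => /andP[_ /orP[]] ->; rewrite ?andbF //.
have JN s : s \in J -> s \in N.
  by rewrite !inE => /orP[/eqP->|/eqP->]; [exact: connect0 | exact: link].
pose rt := root (inner e A).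
have csym : connect_sym (inner e A) := inner_csym e_sym A.
have rtE u v : connect (inner e A) u v -> rt u = rt v by move/(rootP csym).
have rtA v : v \in A -> rt v \in A.
  move=> vA; case: (eqVneq v (rt v)) => [<-//|neq].
  by have [] := inner_connect_in e_sym (connect_root _ v) neq.
pose touch v := [exists z in I, connect (inner e A) z v].
have touchI z : z \in I -> touch z by move=> zI; apply/existsP; exists z; rewrite zI connect0.
have touchA v : touch v -> v \in A.
  case/existsP=> z /andP[zI zv]; case: (eqVneq z v) => [<-|neq]; first exact: IA.
  by have [] := inner_connect_in e_sym zv neq.
pose bag v := if v \in N then Some i else if touch v then Some (rt v) else None.
have bN v : v \in N -> bag v = Some i by rewrite /bag => ->.
have bT v : touch v -> bag v = Some (rt v).
  by move=> tv; rewrite /bag tv (negbTE (contraL (@NA v) (touchA v tv))).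
have bJ s : s \in J -> bag s = Some i by move=> sJ; rewrite bN ?JN.
have bI s : s \in I -> bag s = Some (rt s) by move=> sI; rewrite bT ?touchI.
have rti v : v \in A -> rt v != i.
  by move=> /rtA vA; apply: contraTneq vA => ->; apply: JA.
have bagS s : s \in S -> bag s by case/Scase => sI; [rewrite bI | rewrite bJ].
have bagSX v : bag v -> v \in S :|: X.
  rewrite /bag; case: ifP => [/NB|_]; first by rewrite inE => /andP[].
  by case: ifP => // /touchA; rewrite inE => /andP[].
have [||||f [f1 f2]] := contract_bags e_sym e_irr quot (bag := bag) sd.
- exact: bagSX.
- exact: bagS.
- move=> v; case: (boolP (v \in N)) => vN; first by exists i; [exact: JS | rewrite (bN v) // (bJ i)].
  case: (boolP (touch v)) => tv; last by rewrite /bag (negbTE vN) (negbTE tv).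
  case/existsP: (tv) => z /andP[zI zv] _; exists z; first exact: IS.
  by rewrite (bI z) // (bT v) // (rtE z v).
- move=> u v; case: (boolP (u \in N)) => uN.
    rewrite (bN u uN) => _; rewrite {1}/bag; case: (boolP (v \in N)) => vN; last first.
      by case: ifP => // /touchA/rti vi [E]; rewrite -E eqxx in vi.
    move=> _; suff conn w : w \in N -> connect (inner e [set z | bag z == Some i]) i w.
      by apply: connect_trans (conn v vN); rewrite inner_csym //; apply: conn.
    rewrite inE => /reach_connect; apply: inner_connect_sub.
    by apply/subsetP => z zN; rewrite inE bN.
  case: (boolP (touch u)) => tu; last by rewrite /bag (negbTE uN) (negbTE tu).
  rewrite (bT u tu) => _; rewrite {1}/bag; case: ifP => _.
    by case=> E; have := rti u (touchA u tu); rewrite E eqxx.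
  case: (boolP (touch v)) => // tv [uv].
  have : connect (inner e A) u v by apply/(rootP csym).
  move=> /reach_connect; apply: inner_connect_sub; apply/subsetP => z; rewrite !inE => uz.
  have tz : touch z.
    case/existsP: tu => y /andP[yI yu]; apply/existsP; exists y.
    by rewrite yI; apply: connect_trans uz.
  by rewrite bT // (rtE u z).
have f_col : colouring e (S :|: Y) f.
  move=> u v uSY vSY uv; apply/eqP; apply: f2 => //.
  - by move: uSY; rewrite inE => /orP[/bagS->|->]; rewrite ?orbT.
  - by move: vSY; rewrite inE => /orP[/bagS->|->]; rewrite ?orbT.
  move=> buv; move: uSY; rewrite inE => /orP[uS|//].
  move: vSY; rewrite inE => /orP[vS|vY]; last first.
    have [vS vX] := side_notin (sidesC e_sym sd) vY.
    have : bag v by rewrite -buv bagS.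
    by move=> /bagSX; rewrite inE (negbTE vS) (negbTE vX).
  exfalso; have := c_col (SX u uS) (SX v vS) uv; move: buv.
  have [uI|uJ] := Scase u uS; have [vI|vJ] := Scase v vS.
  - by rewrite !cI // eqxx.
  - by rewrite (bI u) // (bJ v) // => -[E]; have := rti u (IA u uI); rewrite E eqxx.
  - by rewrite (bI v) // (bJ u) // => -[E]; have := rti v (IA v vI); rewrite E eqxx.
  - by rewrite !cJ // eqxx.
have fi s : s \in J -> f s = f i by move=> sJ; apply: f1; rewrite !bJ.
have fIJ s t : s \in I -> t \in J -> f s == f t = false.
  move=> sI tJ; rewrite (fi t tJ); have [y [yI sy yi]] := dom s sI.
  have -> : f s = f y by apply: f1; rewrite !bI // (rtE s y).
  have ny : bag y = bag i -> y \in Y.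
    by rewrite (bI y) // (bJ i) // => -[E]; have := rti y (IA y yI); rewrite E eqxx.
  apply/eqP; case/orP: yi => yi; first by apply: f2; rewrite ?(bI y yI) ?(bJ i iJ) // -(bI y yI) -(bJ i iJ).
  rewrite -(fi i') //; apply: f2; rewrite ?(bI y yI) ?(bJ i' i'J) //.
  by rewrite -(bI y yI) -(bJ i iJ).
pose l := enum (f @: I).
have sl : size l <= #|D|.
  have := cardsC [set d; j]; rewrite cards2 eq_sym jd card_ord => Dq.
  rewrite -cardE; apply: leq_trans (leq_imset_card f I) _.
  by rewrite -(leq_add2l 2) Dq.
have fl s : s \in I -> f s \in l by move=> sI; rewrite mem_enum imset_f.
(* One colour of [D] for each value of [f] on [I]; [D] has [q - 2] colours, enough for [#|I|]
   values. *)
pose delta s := nth a (enum D) (index (f s) l).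
have ltD s : s \in I -> index (f s) l < size (enum D).
  by move=> sI; rewrite -cardE; apply: leq_trans sl; rewrite index_mem fl.
have dD s : s \in I -> delta s \in D by move=> sI; rewrite -mem_enum mem_nth ?ltD.
have dE s t : s \in I -> t \in I -> (delta s == delta t) = (f s == f t).
  move=> sI tI; rewrite nth_uniq ?ltD ?enum_uniq //.
  apply/eqP/eqP => [E|->//].
  by rewrite -(nth_index (f s) (fl s sI)) -(nth_index (f s) (fl t tI)) E.
(* Each component of [avoiding j] that meets [I] gets one transposition, chosen by a vertex of [I]
   in it. Two such vertices share a bag, so they have the same value of [f] and of [delta]. *)
pose sg v := if [pick z in I | connect (inner e A) z v] is Some z then tperm a (delta z) else 1%g.
have cA v : v \in S :|: X -> c v \in D -> v \in A.
  by move=> vZ; rewrite in_setC in_set2 negb_or => vD; rewrite in_set vZ.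
pose c2 v := if c v \in D then sg v (c v) else c v.
have c2_col : colouring e (S :|: X) c2.
  apply: (kempe c_col) => [v y|u v uZ vZ uv uD vD].
    rewrite /sg; case: pickP => [z /andP[zI _]|_]; last by rewrite perm1.
    by case: tpermP => // ->; rewrite ?aD ?dD.
  have uv' : inner e A u v by rewrite /inner !cA.
  rewrite /sg (@eq_pick _ _ (fun z => (z \in I) && connect (inner e A) z v)) // => z.
  congr (_ && _); apply/idP/idP => zc; apply: connect_trans zc (connect1 _) => //.
  by rewrite inner_sym.
have c2J s : s \in J -> c2 s = d.
  by move=> sJ; rewrite /c2 cJ // in_setC in_set2 eqxx.
have c2I s : s \in I -> c2 s = delta s.
  move=> sI; rewrite /c2 cI // aD /sg; case: pickP => [z /andP[zI zs]|/(_ s)]; last first.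
    by rewrite sI connect0.
  rewrite tpermL; apply/eqP; rewrite dE //; apply/eqP/f1; rewrite !bI //.
  by rewrite (rtE z s).
have dJ s : s \in I -> (delta s == d) = false.
  by move=> /dD; apply: contraTF => /eqP->; rewrite in_setC in_set2 eqxx.
apply: (glue e_sym ncol sd c2_col f_col) => u v uS vS.
have [uI|uJ] := Scase u uS; have [vI|vJ] := Scase v vS.
- by rewrite !c2I // dE.
- by rewrite c2I // c2J // dJ // fIJ.
- by rewrite c2J // c2I // [d == _]eq_sym [f u == _]eq_sym dJ // fIJ.
- by rewrite !c2J // (fi u) // (fi v) // !eqxx.
Qed.

Lemma swap_off s j (c1 := swap e (S :|: X) c a j s) :
  s \in I -> j != a -> j != d ->
  (forall t, t \in I -> t != s -> ~~ connect (inner e (bichrom (S :|: X) c a j)) s t) ->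
  colouring e (S :|: X) c1 /\ forall t, t \in S -> c1 t = if t == s then j else c t.
Proof.
move=> sI ja jd sep.
have sB : s \in bichrom (S :|: X) c a j by rewrite inE SE !inE sI cI // eqxx.
split; first exact: swap_colouring.
move=> t tS; rewrite /c1 /swap; case: (eqVneq t s) => [->|ts].
  by rewrite chain_refl cI // tpermL.
case: ifP => // tc; exfalso; move: tc; rewrite inE => st.
move: (tS); rewrite SE inE => /orP[tI|tJ]; first by have := sep t tI ts; rewrite st.
rewrite eq_sym in ts; have [_] := inner_connect_in e_sym st ts.
by rewrite inE cJ // [d == a]eq_sym [d == j]eq_sym (negbTE ad) (negbTE jd) andbF.
Qed.

(** Recolouring [s] alone turns the partition of [c] into that of [g]: the class [J], the pair [u],
    [v], and [s] by itself. *)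
Lemma glue_off (g : V -> 'I_q) s u v j :
  s \in I -> j != a -> j != d ->
  (forall t, t \in I -> t != s -> ~~ connect (inner e (bichrom (S :|: X) c a j)) s t) ->
  colouring e (S :|: Y) g -> exact_class S J g -> only_pair I u v g ->
  I = [set s; u; v] -> s != u -> s != v -> False.
Proof.
move=> sI ja jd sep g_col gJ gonly IE su sv.
have [c1_col c1E] := swap_off sI ja jd sep.
set c1 := swap _ _ _ _ _ _ in c1_col c1E.
have IJ t : t \in I -> t \notin J.
  by move=> tI; apply/negP => tJ; move: ad; rewrite -(cI tI) (cJ tJ) eqxx.
have SJ t : t \in S :\: J -> t \in I by rewrite SE in_setD in_setU => /andP[/negbTE->]; rewrite orbF.
have IS t : t \in I -> t \in S by rewrite SE in_setU => ->.
have JS t : t \in J -> t \in S by rewrite SE in_setU orbC => ->.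
have c1J t : t \in J -> c1 t = d.
  move=> tJ; rewrite c1E ?JS //; case: eqP => [E|_]; last exact: cJ.
  by have := IJ t; rewrite E sI -E tJ => /(_ isT).
have c1I t : t \in I -> c1 t = if t == s then j else a.
  by move=> tI; rewrite c1E ?IS // cI.
apply: (glue_class e_sym ncol sd c1_col g_col _ gJ) => [t t' tJ t'S|t t' /SJ tI /SJ t'I].
  move: (t'S); rewrite SE in_setU => /orP[t'I|t'J]; last by rewrite !c1J // t'J eqxx.
  rewrite c1J // c1I // (negbTE (IJ t' t'I)).
  by case: ifP => _; rewrite eq_sym ?(negbTE jd) ?(negbTE ad).
rewrite gonly // !c1I //.
have I3 w : w \in I -> [\/ w = s, w = u | w = v].
  by rewrite IE !inE -orbA => /or3P[]/eqP->; [constructor 1|constructor 2|constructor 3].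
have us : (u == s) = false by rewrite eq_sym (negbTE su).
have vs : (v == s) = false by rewrite eq_sym (negbTE sv).
have aj : (a == j) = false by rewrite eq_sym (negbTE ja).
have [->|->|->] := I3 t tI; have [->|->|->] := I3 t' t'I;
  by rewrite !inE ?eqxx ?us ?vs ?(negbTE su) ?(negbTE sv) ?aj ?(negbTE ja) ?eqxx ?orbT.
Qed.

(* Swapping the chain of a single vertex of [I] excludes each pair [u, v]; if this is impossible
   because [x] and [y] are linked, swapping the chain of [z] contradicts [linked_fine]. *)
Lemma triple_alone (g : V -> 'I_q) z x y u v :
  4 < q -> #|S| = 5 -> I = [set z; x; y] -> z != x -> z != y -> x != y ->
  strongly_linked e S X c i i' ->
  (forall j t, j != a -> j != d -> t \in [set x; y] -> ~~ connect (inner e (avoiding j)) z t) ->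
  colouring e (S :|: Y) g -> exact_class S J g ->
  u \in I -> v \in I -> u != v -> only_pair I u v g -> False.
Proof.
move=> q4 S5 IE zx zy xy link alone g_col gJ uI vI uv gonly.
have [zI xI yI] : [/\ z \in I, x \in I & y \in I] by rewrite IE !inE !eqxx !orbT.
have sub j k : k != a -> k != d -> k != j -> j != d ->
    bichrom (S :|: X) c a j \subset avoiding k.
  move=> ka kd kj jd; apply/subsetP => w; rewrite [w \in bichrom _ _ _ _]in_set [w \in avoiding _]in_set => /andP[-> /orP[]/eqP->] /=.
    by rewrite ad eq_sym ka.
  by rewrite jd eq_sym kj.
have zsep j t : j != a -> j != d -> t \in [set x; y] ->
    ~~ connect (inner e (bichrom (S :|: X) c a j)) z t.
  move=> ja jd txy; have [|k] := @spare_colour q [:: a; d; j]; first exact: leq_trans q4.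
  rewrite !inE !negb_or => /and3P[ka kd kj].
  by apply: contra (alone k t ka kd txy); apply: inner_connect_sub; apply: sub.
have Icase t : t \in I -> [\/ t = z, t = x | t = y].
  by rewrite IE !inE -orbA => /or3P[]/eqP->; [constructor 1|constructor 2|constructor 3].
have [|j1] := @spare_colour q [:: a; d]; first exact: leq_trans q4.
rewrite !inE !negb_or => /andP[j1a j1d].
have zsep' t : t \in I -> t != z -> ~~ connect (inner e (bichrom (S :|: X) c a j1)) z t.
  move=> tI tz; apply: zsep => //.
  by move: tI; rewrite IE !inE (negbTE tz).
have nxy : ~ only_pair I x y g.
  by move=> gxy; apply: (glue_off zI j1a j1d zsep' g_col gJ gxy).
(* If [x] and [y] are not linked for some colour [l], each of them can be split off like [z], and no
   pair is left for [g]. *)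
case: (boolP [exists l, [&& l != a, l != d & ~~ connect (inner e (bichrom (S :|: X) c a l)) x y]]).
  case/existsP=> l /and3P[la ld nl].
  have nyz : ~ only_pair I z y g.
    move=> gzy; apply: (glue_off xI la ld _ g_col gJ gzy) => //; last 1 first.
    - by rewrite eq_sym.
    - move=> t /Icase[]->; rewrite ?eqxx // => _.
      by rewrite inner_csym // zsep // !inE eqxx.
    by rewrite IE [[set z; x]]setUC.
  have nxz : ~ only_pair I z x g.
    move=> gzx; apply: (glue_off yI la ld _ g_col gJ gzx); last 2 first.
    - by rewrite eq_sym.
    - by rewrite eq_sym.
    - move=> t /Icase[]->; rewrite ?eqxx // => _; rewrite inner_csym //.
      by rewrite zsep // !inE eqxx orbT.
    by rewrite IE setUC setUA.
  have sym w t : only_pair I w t g -> only_pair I t w g.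
    by move=> gwt p p' pI p'I; rewrite gwt // [[set w; t]]setUC.
  have [E|E|E] := Icase u uI; have [E'|E'|E'] := Icase v vI; move: uv gonly;
    rewrite E E' ?eqxx // => _ gp.
  - exact: nxz (sym _ _ gp).
  - exact: nyz (sym _ _ gp).
  - exact: nxy (sym _ _ gp).
rewrite negb_exists => /forallP linked.
have {}linked l : l != a -> l != d -> connect (inner e (bichrom (S :|: X) c a l)) x y.
  by move=> la ld; have := linked l; rewrite la ld negbK.
have [c1_col c1E] := swap_off zI j1a j1d zsep'.
set c1 := swap _ _ _ _ _ _ in c1_col c1E.
have Scase s : s \in S -> s \in I \/ s \in J by rewrite SE inE => /orP.
have IS s : s \in I -> s \in S by move=> sI; rewrite SE inE sI.
have JS s : s \in J -> s \in S by move=> sJ; rewrite SE in_setU sJ orbT.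
have IJ s : s \in I -> s \notin J.
  by move=> sI; apply/negP => sJ; move: ad; rewrite -(cI sI) (cJ sJ) eqxx.
have c1J s : s \in J -> c1 s = d.
  move=> sJ; rewrite c1E ?JS //; case: eqP => [E|_]; last exact: cJ.
  by have := IJ s; rewrite E zI -E sJ => /(_ isT).
have c1I s : s \in I -> c1 s = if s == z then j1 else a.
  by move=> sI; rewrite c1E ?IS // cI.
have SX s : s \in S -> s \in S :|: X by move=> sS; rewrite inE sS.
have ja1 : (j1 == a) = false := negbTE j1a.
suff : #|S| <= #|c1 @: S|.+1.
  rewrite S5 ltnS => C4.
  have : #|c1 @: S| <= 3.
    apply: leq_trans (card_size [:: a; d; j1]); apply: subset_leq_card.
    apply/subsetP => _ /imsetP[s sS ->]; rewrite !inE.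
    have [sI|sJ] := Scase s sS; first by rewrite c1I //; case: ifP; rewrite eqxx ?orbT.
    by rewrite c1J // eqxx orbT.
  by rewrite leqNgt C4.
apply: (linked_fine e_sym e_irr quot ncol sd c1_col q4).
  by rewrite S5; exact: q4.
have transfer p p' b j : c p = b -> p \in S ->
    (forall w, connect (inner e (bichrom (S :|: X) c b j)) p w ->
       w \notin chain e (S :|: X) c a j1 z) ->
    connect (inner e (bichrom (S :|: X) c b j)) p p' ->
    connect (inner e (bichrom (S :|: X) c1 b j)) p p'.
  move=> cp pS out /reach_connect; apply: inner_connect_sub; apply/subsetP => w.
  rewrite in_set => pw; have nw := out w pw.
  have : w \in bichrom (S :|: X) c b j.
    case: (eqVneq p w) => [<-|neq]; first by rewrite in_set SX // cp eqxx.
    by have [] := inner_connect_in e_sym pw neq.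
  by rewrite [w \in bichrom _ c _ _]in_set [w \in bichrom _ c1 _ _]in_set /c1 /swap (negbTE nw).
have zch w : w \in chain e (S :|: X) c a j1 z -> c w = a \/ c w = j1.
  rewrite in_set => zw; case: (eqVneq z w) => [<-|neq]; first by left; rewrite cI.
  have [_] := inner_connect_in e_sym zw neq.
  by rewrite in_set => /andP[_ /orP[]/eqP]; auto.
have Jlink p p' j : p \in J -> p' \in J -> (forall s, s \in S -> c1 s != j) ->
    connect (inner e (bichrom (S :|: X) c1 d j)) p p'.
  move=> pJ p'J jS.
  have jd : d != j by rewrite -(c1J p pJ) jS ?JS.
  have jj1 : j1 != j by have := jS z (IS z zI); rewrite c1I // eqxx.
  have jaa : a != j by have := jS x (IS x xI); rewrite c1I // [x == z]eq_sym (negbTE zx).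
  apply: transfer; rewrite ?JS //; first exact: cJ.
    move=> w pw; apply/negP => /zch zw.
    have : w \in bichrom (S :|: X) c d j.
      case: (eqVneq p w) => [<-|neq]; first by rewrite in_set SX ?JS // cJ // eqxx.
      by have [] := inner_connect_in e_sym pw neq.
    rewrite in_set => /andP[_]; case: zw => ->.
      by rewrite (negbTE ad) (negbTE jaa).
    by rewrite (negbTE j1d) (negbTE jj1).
  have ii'l : connect (inner e (bichrom (S :|: X) c d j)) i i'.
    have := link j; rewrite (cJ (s := i)) ?inE ?eqxx //; apply=> s /Scase[sI|sJ].
      by rewrite cI.
    by rewrite cJ.
  move: pJ p'J; rewrite !inE => /orP[]/eqP-> /orP[]/eqP->; rewrite ?connect0 //.
  by rewrite inner_csym.
have Ilink j : (forall s, s \in S -> c1 s != j) ->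
    connect (inner e (bichrom (S :|: X) c1 a j)) x y.
  move=> jS.
  have iJ : i \in J by rewrite !inE eqxx.
  have jd : d != j by rewrite -(c1J i iJ) jS ?JS.
  have jj1 : j1 != j by have := jS z (IS z zI); rewrite c1I // eqxx.
  have jaa : a != j by have := jS x (IS x xI); rewrite c1I // [x == z]eq_sym (negbTE zx).
  apply: transfer; rewrite ?IS //; first exact: cI; last by apply: linked; rewrite eq_sym.
  move=> w xw; rewrite in_set; apply/negP => zw.
  (* A fifth colour exists because [4 < q]. Both chains lie in [avoiding k], so if they met, [z]
     would be connected to [x] there. *)
  have [|k] := @spare_colour q [:: a; d; j1; j]; first exact: q4.
  rewrite !inE !negb_or => /and4P[ka kd kj1 kj].
  have := alone k x ka kd; rewrite !inE eqxx => /(_ isT)/negP; apply.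
  apply: connect_trans (inner_connect_sub _ zw) _; first exact: sub.
  rewrite inner_csym //; apply: inner_connect_sub xw; apply: sub => //.
  by rewrite eq_sym.
move=> p p' pS p'S.
have [pI|pJ] := Scase p pS; have [p'I|p'J] := Scase p' p'S; last 1 first.
- by move=> _ j jS; rewrite c1J //; apply: Jlink.
- have [->|->|->] := Icase p pI; have [->|->|->] := Icase p' p'I;
    rewrite !c1I // ?eqxx ?[x == z]eq_sym ?[y == z]eq_sym ?(negbTE zx) ?(negbTE zy) => E j jS;
    rewrite ?connect0 //.
  + by rewrite E eqxx in ja1.
  + by rewrite E eqxx in ja1.
  + by rewrite -E eqxx in ja1.
  + by rewrite c1I // [x == z]eq_sym (negbTE zx); apply: Ilink.
  + by rewrite -E eqxx in ja1.
  + by rewrite c1I // [y == z]eq_sym (negbTE zy) inner_csym //; apply: Ilink.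
- rewrite c1I // c1J //; case: ifP => _ E; first by rewrite E eqxx in j1d.
  by move: ad; rewrite E eqxx.
- rewrite c1J // c1I //; case: ifP => _ E; first by rewrite E eqxx in j1d.
  by move: ad; rewrite E eqxx.
Qed.

End Triple.

(** * Excluding the last coincidence *)

Section Separator.
Variables (V : finType) (e : rel V) (q : nat).
Hypotheses (e_sym : symmetric e) (e_irr : irreflexive e)
  (quot : quotients_colourable e q)
  (ncol : forall c : V -> 'I_q, ~ colouring e setT c).
Implicit Types (S X Y I : {set V}) (c : V -> 'I_q).

Lemma exact_pair S c i i' : i \in S -> i' \in S -> c i = c i' ->
  (forall u v, u \in S -> v \in S -> c u = c v ->
    u = v \/ (u \in [set i; i']) && (v \in [set i; i'])) ->
  exact_class S [set i; i'] c.
Proof.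
move=> iS i'S ci only u v uJ vS.
have uS : u \in S by move: uJ; rewrite !inE => /orP[]/eqP->.
apply/eqP/idP => [/(only u v uS vS)[<-//|/andP[]//]|].
by move: uJ; rewrite !inE => /orP[]/eqP-> /orP[]/eqP->.
Qed.

Lemma exact_pair_off S I c i i' : exact_class S I c ->
  i \in S :\: I -> i' \in S :\: I -> c i = c i' ->
  (forall u v, u \in S :\: I -> v \in S :\: I -> c u = c v ->
    u = v \/ (u \in [set i; i']) && (v \in [set i; i'])) ->
  exact_class S [set i; i'] c.
Proof.
move=> cI iS i'S ci only u v uJ vS.
have uS : u \in S :\: I by move: uJ; rewrite !inE => /orP[]/eqP->; rewrite -in_setD.
case: (boolP (v \in I)) => vI; last first.
  have H := exact_pair iS i'S ci only.
  by apply: H => //; rewrite inE vI.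
have vJ : v \notin [set i; i'].
  apply: contraL vI; rewrite !inE => /orP[]/eqP->.
    by move: iS; rewrite inE => /andP[].
  by move: i'S; rewrite inE => /andP[].
have [uI uS'] : u \notin I /\ u \in S by move: uS; rewrite inE => /andP[].
by rewrite (negbTE vJ) eq_sym cI // (negbTE uI).
Qed.

(** Two vertices [x], [y] of [I] are adjacent to the pair. If the third vertex [z] reaches such a
    neighbour within [avoiding] for some colour, [triple_spread] applies; otherwise [z] is cut off
    from [x] and [y] for every colour, and [triple_alone] applies to the colouring [g] obtained from
    [c'']. *)
Lemma five_three S X Y I c c'' i i' :
  4 < q -> sides e S X Y -> #|S| = 5 -> #|I| = 3 -> I \subset S ->
  colouring e (S :|: X) c -> exact_class S I c ->
  i \in S :\: I -> i' \in S :\: I -> i != i' -> c i = c i' ->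
  strongly_linked e S X c i i' ->
  colouring e (S :|: X) c'' -> c'' i = c'' i' ->
  (forall u v, u \in S -> v \in S -> c'' u = c'' v ->
    u = v \/ (u \in [set i; i']) && (v \in [set i; i'])) ->
  1 < #|[set x in S | e x i || e x i']| -> False.
Proof.
move=> q4 sd S5 I3 IS c_col cI iSI i'SI ii' ci link c2_col c2i c2only.
pose J := [set i; i']; have SE : S = I :|: J.
  apply/esym/eqP; rewrite eqEcard; apply/andP; split.
    rewrite subUset IS; apply/subsetP => s; rewrite !inE => /orP[]/eqP->.
      by move: iSI; rewrite inE => /andP[].
    by move: i'SI; rewrite inE => /andP[].
  rewrite cardsU S5 I3 cards2 ii' (_ : I :&: J = set0) ?cards0 //.
  apply/eqP; rewrite setI_eq0 disjoint_sym disjoint_subset; apply/subsetP => s.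
  rewrite !inE => /orP[]/eqP->.
    by move: iSI; rewrite inE => /andP[].
  by move: i'SI; rewrite inE => /andP[].
have [iS i'S] : i \in S /\ i' \in S.
  by split; [move: iSI | move: i'SI]; rewrite inE => /andP[].
have IinS s : s \in I -> s \in S by apply/subsetP.
have IJ s : s \in I -> s \notin J.
  move=> sI; apply: contraL sI; rewrite !inE => /orP[]/eqP->.
    by move: iSI; rewrite inE => /andP[].
  by move: i'SI; rewrite inE => /andP[].
have SJ : S :\: J = I.
  apply/setP => s; rewrite in_setD SE in_setU; case: (boolP (s \in I)) => [/IJ->//|_].
  by rewrite andNb.
have JS : J \subset S by rewrite SE subsetUr.
have [x0 x0I] : exists x0, x0 \in I by apply/card_gt0P; rewrite I3.
have cIa s : s \in I -> c s = c x0.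
  by move=> sI; apply/eqP; rewrite eq_sym cI // IinS.
have cJd s : s \in J -> c s = c i by rewrite !inE => /orP[]/eqP->.
have ad : c x0 != c i by rewrite cI //; move: iSI; rewrite inE => /andP[].

have c2J : exact_class S J c'' := exact_pair iS i'S c2i c2only.
have c2inj u v : u \in S :\: J -> v \in S :\: J -> c'' u = c'' v -> u = v.
  rewrite !in_setD => /andP[uJ uS] /andP[vJ vS] /(c2only u v uS vS)[//|].
  by rewrite -/J (negbTE uJ).
have qS : 2 ^ (#|S| - 3) < q by rewrite S5.
have [g [u [v [g_col gJ [uI vI uv] gonly]]]] :=
  contract_pair e_sym e_irr quot ncol q4 qS sd c2_col JS c2J c2inj.
rewrite -/J SJ in uI vI gonly.
move=> dom2.
have domI s : s \in S -> e s i || e s i' -> s \in I.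
  rewrite SE in_setU => /orP[//|sJ] sii'.
  have {}sii' : exists2 t, t \in J & e s t.
    by case/orP: sii' => st; [exists i | exists i']; rewrite ?inE ?eqxx ?orbT.
  case: sii' => t tJ st; have [sS tS] := (subsetP JS s sJ, subsetP JS t tJ).
  by have := c_col s t; rewrite !inE sS tS !cJd // eqxx => /(_ isT isT st).
have linkd j : j != c x0 -> j != c i ->
    connect (inner e (bichrom (S :|: X) c (c i) j)) i i'.
  move=> ja jd; apply: link => s; rewrite SE in_setU => /orP[/cIa->|/cJd->]; by rewrite eq_sym.
pose spread j x := [exists y in I, connect (inner e (avoiding S X c (c i) j)) x y && (e y i || e y i')].
case: (boolP [exists j, [&& j != c x0, j != c i & [forall x in I, spread j x]]]).
  case/existsP=> j /and3P[ja jd /forallP sp].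
  apply: (triple_spread e_sym e_irr quot ncol sd c_col SE cIa cJd ad _ ja jd (linkd j ja jd)).
    by rewrite I3.
  move=> x xI; have := sp x; rewrite xI => /existsP[y /and3P[yI xy yi]]; by exists y.
rewrite negb_exists => /forallP nsp.
have [x [y [xd yd xy]]] := card_gt1P dom2.
rewrite !inE in xd yd; case/andP: xd => xS xd; case/andP: yd => yS yd.
have [xI yI] := (domI x xS xd, domI y yS yd).
have [z zI] : exists z, z \in I :\ x :\ y.
  apply/card_gt0P; have := I3.
  by rewrite (cardsD1 x) xI (cardsD1 y (I :\ x)) in_setD1 eq_sym xy yI !add1n => -[->].
have [zy zx zI'] : [/\ z != y, z != x & z \in I] by move: zI; rewrite !in_setD1 => /and3P[].
have IE : I = [set z; x; y].
  apply/esym/eqP; rewrite eqEcard I3 -setUA cardsU1 cards2 !inE negb_or zx zy xy leqnn andbT.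
  by apply/subsetP => s; rewrite !inE => /or3P[]/eqP->.
apply: (triple_alone e_sym e_irr quot ncol sd c_col SE cIa cJd ad q4 S5 IE zx zy xy link _
  g_col gJ uI vI uv gonly).
move=> j t ja jd txy; apply/negP => zt.
have := nsp j; rewrite ja jd /= => /negP; apply; apply/forallP => w; apply/implyP.
have self s : s \in I -> e s i || e s i' -> spread j s.
  by move=> sI sd'; apply/existsP; exists s; rewrite sI connect0.
rewrite IE !inE -orbA => /or3P[]/eqP->; [|exact: self|exact: self].
have [tI td] : t \in I /\ (e t i || e t i') by move: txy; rewrite !inE => /orP[]/eqP->.
by apply/existsP; exists t; rewrite tI zt.
Qed.

(** Maximality of [I] is used twice: every vertex of [S] off the pair is adjacent to one of its
    members, and the fifth vertex [w] has a neighbour in [I]. Exchanging [x] and [y] relates the two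
    cases for that neighbour. *)
Lemma five_two_class S X Y I c c'' i i' :
  4 < q -> sides e S X Y -> #|S| = 5 -> #|I| = 2 -> I \subset S ->
  (forall u v, u \in I -> v \in I -> ~~ e u v) ->
  (forall K : {set V}, K \subset S -> (forall u v, u \in K -> v \in K -> ~~ e u v) -> #|K| <= #|I|) ->
  colouring e (S :|: X) c -> exact_class S I c ->
  i \in S :\: I -> i' \in S :\: I -> i != i' -> c i = c i' ->
  (forall u v, u \in S :\: I -> v \in S :\: I -> c u = c v ->
    u = v \/ (u \in [set i; i']) && (v \in [set i; i'])) ->
  colouring e (S :|: X) c'' -> c'' i = c'' i' ->
  (forall u v, u \in S -> v \in S -> c'' u = c'' v ->
    u = v \/ (u \in [set i; i']) && (v \in [set i; i'])) ->
  strongly_linked e S X c'' i i' -> False.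
Proof.
move=> q4 sd S5 I2 IS Iind Imax c_col cI iSI i'SI ii' ci conly c2_col c2i c2only link.
have [iI iS] : i \notin I /\ i \in S by move: iSI; rewrite inE => /andP[].
have [i'I i'S] : i' \notin I /\ i' \in S by move: i'SI; rewrite inE => /andP[].
pose J := [set i; i'].
have JS : J \subset S by apply/subsetP => s; rewrite !inE => /orP[]/eqP->.
have IJ s : s \in I -> s \notin J.
  by move=> sI; rewrite !inE negb_or; apply/andP; split; apply: contraTneq sI => ->.
have cJ := exact_pair_off cI iSI i'SI ci conly.
have c2J := exact_pair iS i'S c2i c2only.
have IinS s : s \in I -> s \in S by apply/subsetP.
have nJ u v : u \in J -> v \in J -> ~~ e u v.
  move=> uJ vJ; have [uS vS] := (subsetP JS u uJ, subsetP JS v vJ).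
  apply/negP => uv; have := c_col u v; rewrite !inE uS vS => /(_ isT isT uv).
  by rewrite cJ // vJ.
have dom s : s \in S :\: J -> e s i || e s i'.
  rewrite in_setD => /andP[sJ sS]; apply: contraT; rewrite negb_or => /andP[si si'].
  have : #|s |: J| <= #|I|.
    apply: Imax; first by rewrite subUset sub1set sS JS.
    have sJn t : t \in J -> ~~ e s t by rewrite !inE => /orP[]/eqP->.
    move=> u v; rewrite !(in_setU1 _ _ J) => /orP[/eqP->|uJ] /orP[/eqP->|vJ].
    - by rewrite e_irr.
    - exact: sJn.
    - by rewrite e_sym sJn.
    - exact: nJ.
  by rewrite cardsU1 sJ cards2 ii' I2.
have [x [y [xI yI xy]]] : exists x y, [/\ x \in I, y \in I & x != y].
  by apply/card_gt1P; rewrite I2.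
have IE : I = [set x; y].
  apply/esym/eqP; rewrite eqEcard I2 cards2 xy andbT.
  by apply/subsetP => s; rewrite !inE => /orP[]/eqP->.
have A3 : #|S :\: J| = 3 by rewrite cardsDS // S5 cards2 ii'.
have IA s : s \in I -> s \in S :\: J by move=> sI; rewrite in_setD IJ // IinS.
have [w wA] : exists w, w \in S :\: J :\ x :\ y.
  apply/card_gt0P; have := A3; rewrite (cardsD1 x) IA //.
  by rewrite (cardsD1 y (_ :\ x)) in_setD1 eq_sym xy IA // !add1n => -[->].
have [wy wx wSJ] : [/\ w != y, w != x & w \in S :\: J].
  by move: wA; rewrite !in_setD1 => /and3P[].
have wI : w \notin I by rewrite IE !inE negb_or wx wy.
have wS : w \in S by move: wSJ; rewrite in_setD => /andP[].
have SJ : S :\: J = [set x; y; w].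
  apply/esym/eqP; rewrite eqEcard A3 setUC cardsU1 cards2 !inE negb_or wx wy xy leqnn andbT.
  by apply/subsetP => s; rewrite !in_setU !in_set1 => /or3P[]/eqP->; [exact: wSJ|exact: IA|exact: IA].
have wxy : e x w || e y w.
  apply: contraT; rewrite negb_or => /andP[xw yw].
  have : #|w |: I| <= #|I|.
    apply: Imax; first by rewrite subUset sub1set wS IS.
    have wIn t : t \in I -> ~~ e w t by rewrite IE !inE e_sym => /orP[]/eqP->.
    move=> u v; rewrite !(in_setU1 _ _ I) => /orP[/eqP->|uI] /orP[/eqP->|vI].
    - by rewrite e_irr.
    - exact: wIn.
    - by rewrite e_sym wIn.
    - exact: Iind.
  by rewrite cardsU1 wI add1n ltnn.
have c2inj u v : u \in S :\: J -> v \in S :\: J -> c'' u = c'' v -> u = v.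
  rewrite !in_setD => /andP[uJ uS] /andP[vJ vS] /(c2only u v uS vS)[//|].
  by rewrite -/J (negbTE uJ).
have qS : 2 ^ (#|S| - 3) < q by rewrite S5.
have pairI : only_pair (S :\: J) x y c.
  move=> u v; rewrite -IE !in_setD => /andP[uJ uS] /andP[vJ vS].
  case: (boolP (u \in I)) => uI /=.
    by rewrite cI //; case: (eqVneq u v) => [<-|].
  case: (boolP (v \in I)) => vI.
    rewrite eq_sym cI // (negbTE uI) orbF; apply/esym/eqP => E; by rewrite E vI in uI.
  rewrite orbF; apply/eqP/eqP => [|->//].
  by case/(conly u v); rewrite ?in_setD ?uI ?vI // -/J (negbTE uJ).
case/orP: wxy => ew.
  apply: (five_two e_sym e_irr quot ncol q4 qS sd (x := y) (y := x) (w := w) _ ii' JS _ _ ew dom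
    c_col cJ _ c2_col c2J c2inj link).
  - by rewrite -/J SJ [[set x; y]]setUC.
  - by rewrite eq_sym.
  - by rewrite eq_sym.
  - by move=> u v uS vS; rewrite pairI // [[set x; y]]setUC.
apply: (five_two e_sym e_irr quot ncol q4 qS sd SJ ii' JS xy _ ew dom
  c_col cJ pairI c2_col c2J c2inj link).
by rewrite eq_sym.
Qed.

(** Trading the neighbours of the pair in [I] for the pair itself keeps independence, so by
    maximality the pair has at least two neighbours in [S]. If [#|S| = 5], this leaves only two or
    three vertices for [I]. *)
Lemma pair_false S X Y I c c'' i i' :
  4 < q -> 2 ^ (#|S| - 3) < q -> sides e S X Y -> I \subset S ->
  (forall u v, u \in I -> v \in I -> ~~ e u v) ->
  (forall K : {set V}, K \subset S -> (forall u v, u \in K -> v \in K -> ~~ e u v) -> #|K| <= #|I|) ->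
  colouring e (S :|: X) c -> exact_class S I c ->
  i \in S :\: I -> i' \in S :\: I -> i != i' -> c i = c i' ->
  (forall u v, u \in S :\: I -> v \in S :\: I -> c u = c v ->
    u = v \/ (u \in [set i; i']) && (v \in [set i; i'])) ->
  strongly_linked e S X c i i' ->
  colouring e (S :|: X) c'' -> c'' i = c'' i' ->
  (forall u v, u \in S -> v \in S -> c'' u = c'' v ->
    u = v \/ (u \in [set i; i']) && (v \in [set i; i'])) ->
  (forall u v, u \in S -> v \in S -> c'' u = c'' v -> strongly_linked e S X c'' u v) -> False.
Proof.
move=> q4 qS sd IS Iind Imax c_col cI iSI i'SI ii' ci conly clink c2_col c2i c2only c2link.
have [iI iS] : i \notin I /\ i \in S by move: iSI; rewrite inE => /andP[].
have [i'I i'S] : i' \notin I /\ i' \in S by move: i'SI; rewrite inE => /andP[].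
pose J := [set i; i']; pose N := [set x in S | e x i || e x i'].
have cJ := exact_pair_off cI iSI i'SI ci conly.
have JS : J \subset S by apply/subsetP => s; rewrite !inE => /orP[]/eqP->.
have nJ u v : u \in J -> v \in J -> ~~ e u v.
  move=> uJ vJ; have [uS vS] := (subsetP JS u uJ, subsetP JS v vJ).
  apply/negP => uv; have := c_col u v; rewrite !inE uS vS => /(_ isT isT uv).
  by rewrite cJ // vJ.
have IJ0 : [disjoint I & J].
  rewrite disjoint_sym disjoint_subset; apply/subsetP => s; rewrite !inE.
  by case/orP => /eqP->.
have J2 : #|J| = 2 by rewrite cards2 ii'.
have N2 : 1 < #|N|.
  rewrite ltnNge; apply/negP => N1.
  have : #|(I :\: N) :|: J| <= #|I|.
    apply: Imax; first by rewrite subUset JS (subset_trans (subsetDl _ _) IS).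
    have INJ s t : s \in I :\: N -> t \in J -> ~~ e s t.
      rewrite !inE => /andP[sN sI]; move: sN; rewrite (subsetP IS) //= negb_or => /andP[si si'].
      by case/orP => /eqP->.
    move=> u v; rewrite !(in_setU _ _ J) => /orP[uI|uJ] /orP[vI|vJ].
    - by move: uI vI; rewrite !in_setD => /andP[_ uI] /andP[_ vI]; apply: Iind.
    - exact: INJ.
    - by rewrite e_sym INJ.
    - exact: nJ.
  have -> : #|(I :\: N) :|: J| = #|I :\: N| + 2.
    rewrite cardsU J2 (_ : _ :&: J = set0) ?cards0 ?subn0 //.
    by apply/eqP; rewrite setI_eq0; apply: disjointWl IJ0; apply: subsetDl.
  rewrite -[X in _ <= X](cardsID N I) addnC leq_add2r leqNgt ltnS.
  by rewrite (leq_trans _ N1) // subset_leq_card // subsetIr.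
case: (eqVneq #|S| 5) => S5; last first.
  exact: (linked_pair_false e_sym e_irr quot ncol q4 qS S5 sd c2_col iS i'S ii' c2i c2only c2link N2).
have I2 : 1 < #|I| by rewrite -J2; apply: Imax.
have : #|I| <= 3.
  have : #|I :|: J| <= #|S| by rewrite subset_leq_card // subUset IS.
  have -> : #|I :|: J| = #|I| + 2.
    rewrite cardsU J2 (_ : _ :&: J = set0) ?cards0 ?subn0 //.
    by apply/eqP; rewrite setI_eq0.
  by rewrite S5 addn2 !ltnS.
rewrite leq_eqVlt => /orP[/eqP I3|I3].
  exact: (five_three q4 sd S5 I3 IS c_col cI iSI i'SI ii' ci clink c2_col c2i c2only N2).
have {}I2 : #|I| = 2 by apply/eqP; rewrite eqn_leq -ltnS I3.
apply: (five_two_class q4 sd S5 I2 IS Iind Imax c_col cI iSI i'SI ii' ci conly c2_col c2i c2only).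
exact: c2link.
Qed.

Lemma no_small_separator S X Y :
  4 < q -> 2 ^ (#|S| - 3) < q -> sides e S X Y -> False.
Proof.
move=> q4 qS sd.
pose ind (K : {set V}) := [forall u in K, [forall v in K, ~~ e u v]].
have indP (K : {set V}) : reflect (forall u v, u \in K -> v \in K -> ~~ e u v) (ind K).
  apply: (iffP forall_inP) => [H u v uK vK|H u uK].
    by have /forall_inP := H u uK; apply.
  by apply/forall_inP => v vK; apply: H.
(* With [S] empty there is no class to contract: deleting one side colours the other, and any two
   colourings glue. *)
case: (eqVneq S set0) => [S0|].
  have nobag X' Y' : sides e S X' Y' -> exists f : V -> 'I_q, colouring e (S :|: Y') f.
    move=> sd'; have [||||f [_ f2]] :=
      contract_bags e_sym e_irr quot (bag := fun=> None : option V) sd' => //.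
      by move=> s; rewrite S0 inE.
    exists f => u v; rewrite S0 set0U => uY vY uv.
    by apply/eqP/f2; rewrite ?uY ?vY.
  have [f fY] := nobag X Y sd; have [g gX] := nobag Y X (sidesC e_sym sd).
  by apply: (glue e_sym ncol sd gX fY) => u v; rewrite S0 inE.
case/set0Pn => s0 s0S.
pose P (K : {set V}) := (K \subset S) && ind K.
have P0 : P [set s0].
  rewrite /P sub1set s0S; apply/indP => u v; rewrite !inE => /eqP-> /eqP->.
  by rewrite e_irr.
have [I /andP[IS /indP Iind] Imax] : exists2 I : {set V}, P I & forall K : {set V}, P K -> #|K| <= #|I|.
  by case: (arg_maxnP (fun K : {set V} => #|K|) P0) => I PI maxI; exists I.
have {}Imax (K : {set V}) : K \subset S -> (forall u v, u \in K -> v \in K -> ~~ e u v) -> #|K| <= #|I|.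
  by move=> KS Ki; apply: Imax; rewrite /P KS; apply/indP.
have I0 : I != set0.
  by case/andP: P0 => sS /indP s0ind; rewrite -card_gt0 -(cards1 s0); apply: Imax.
have side X' Y' : sides e S X' Y' -> exists c, [/\ colouring e (S :|: X') c, exact_class S I c &
    forall u v, u \in S :\: I -> v \in S :\: I -> c u = c v -> u = v].
  move=> sd'; have sdC := sidesC e_sym sd'.
  have [c [c_col cI]] := side_class e_sym e_irr quot sdC IS I0 Iind.
  have [c' [c'_col c'I _ [inj|[i [i' [[iS i'S ii' ci] only link [c'' [c2col c2i c2only c2link]]]]]]]]
    := keep e_sym e_irr quot ncol q4 qS sd' c_col IS I0 cI; first by exists c'.
  by have := pair_false q4 qS sd' IS Iind Imax c'_col c'I iS i'S ii' ci only link
    c2col c2i c2only c2link.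
have [c [c_col cI cinj]] := side X Y sd; have [g [g_col gI ginj]] := side Y X (sidesC e_sym sd).
apply: (glue_class e_sym ncol sd c_col g_col cI gI) => u v uS vS.
by apply/eqP/eqP => [/cinj|/ginj] ->.
Qed.

End Separator.

(** * Minimal separators *)

(** Putting [s] back reconnects [x] to [y], and the only way out of the component of [x] is then
    through [s]; so [s] has a neighbour in that component. *)
Lemma minimal_separator_full (V : finType) (e : rel V) (S Z : {set V}) x y
    (X := [set v | connect (inner e (~: S)) x v]) :
  symmetric e -> x \notin S -> ~~ connect (inner e (~: S)) x y -> X \subset Z ->
  (forall s, s \in S -> connect (inner e (~: (S :\ s))) x y) -> full e S Z.
Proof.
move=> e_sym xS nxy XZ link; exists X.
have xX : x \in X by rewrite inE connect0.
split=> //; first by apply/set0Pn; exists x.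
  move=> u v; rewrite !inE => /reach_connect xu /reach_connect xv.
  by apply: connect_trans xv; rewrite inner_csym.
move=> s sS; have yX : y \notin X by rewrite inE.
have [a [b [aX bX /and3P[_ bS ab]]]] :=
  connect_break (P := fun v => v \in X) (link s sS) xX yX.
exists a => //; rewrite e_sym; suff <- : b = s by [].
apply/eqP; apply: contraNT bX => bs.
have aS : a \notin S.
  move: aX; rewrite inE => xa; case: (eqVneq x a) => [<-//|neq].
  by have [_] := inner_connect_in e_sym xa neq; rewrite inE.
move: aX; rewrite !inE => xa; apply: connect_trans xa (connect1 _).
by move: bS; rewrite /inner !inE bs /= aS ab => ->.
Qed.

(** Minimality is taken among the sets separating the fixed pair [x], [y]. The second side is
    everything outside the component of [x]; it need not be connected, and the component of [y] is
    its full part. *)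
Lemma separator_sides (V : finType) (e : rel V) (S : {set V}) x y :
  symmetric e -> x \notin S -> y \notin S -> ~~ connect (inner e (~: S)) x y ->
  exists S0 X Y : {set V}, S0 \subset S /\ sides e S0 X Y.
Proof.
move=> e_sym xS yS nxy.
pose P (T : {set V}) := [&& x \notin T, y \notin T & ~~ connect (inner e (~: T)) x y].
have [S0 /minsetP[/and3P[xS0 yS0 nxy0] minS0] S0S] : exists2 S0 : {set V}, minset P S0 & S0 \subset S.
  have [|S0 [? ?]] := @minset_exists _ P S; first by rewrite /P xS yS.
  by exists S0.
have link s : s \in S0 -> connect (inner e (~: (S0 :\ s))) x y.
  move=> sS; apply: contraT => nc; have := minS0 (S0 :\ s) _ (subsetDl _ _).
  rewrite /P !inE (negbTE xS0) (negbTE yS0) !andbF nc => /(_ isT) E.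
  by move: sS; rewrite -E !inE eqxx.
pose X := [set v | connect (inner e (~: S0)) x v].
have XS v : v \in X -> v \notin S0.
  rewrite inE => xv; case: (eqVneq x v) => [<-//|neq].
  by have [_] := inner_connect_in e_sym xv neq; rewrite inE.
exists S0, X, (~: S0 :\: X); split=> //; split.
- apply/setP => v; rewrite in_setU in_setD in_setC.
  by case: (boolP (v \in X)) => [/XS->|].
- by rewrite disjoint_sym disjoints_subset subDset setUC -subDset setDE setCK subsetIr.
- move=> u v uX; rewrite in_setD in_setC => /andP[vX vS]; apply: contra vX => uv.
  have uS := XS u uX; move: uX; rewrite !inE => xu; apply: connect_trans xu (connect1 _).
  by rewrite /inner !inE uS vS uv.
- exact: minimal_separator_full nxy0 _ link.
- apply: (@minimal_separator_full V e S0 _ y x) => //.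
  + by rewrite inner_csym.
  + apply/subsetP => v; rewrite in_setD in_setC inE => yv; apply/andP; split.
      rewrite inE; apply: contra nxy0 => xv; apply: connect_trans xv _.
      by rewrite inner_csym.
    case: (eqVneq y v) => [<-//|neq].
    by have [_] := inner_connect_in e_sym yv neq; rewrite inE.
  + by move=> s /link; rewrite inner_csym.
Qed.

(** * From separators to connectivity *)

Lemma noncomplete_colorable (G : sgraph) : ~ complete G -> 0 < #|G| /\ colorable #|G|.-1 G.
Proof.
move=> ncomp; case: (boolP [exists x : G, exists y : G, (x != y) && ~~ adj x y]); last first.
  rewrite negb_exists => /forallP H; case: ncomp => x y xy.
  have := H x; rewrite negb_exists => /forallP/(_ y).
  by rewrite xy negbK.
case/existsP=> x /existsP[y /andP[xy nxy]].
have Tc : #|{: {z : G | z != y}}| = #|G|.-1.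
  by rewrite card_sig -(cardC1 y); apply: eq_card => z; rewrite !inE.
split; first by apply/card_gt0P; exists x.
rewrite -Tc; apply/existsP.
(* The default value of [insubd] gives [y] the colour of its non-neighbour [x]. *)
exists [ffun v => enum_rank (insubd (Sub x xy : {z : G | z != y}) v)].
apply/forallP => u; apply/forallP => v; apply/implyP => uv.
rewrite !ffunE (inj_eq enum_rank_inj) -(inj_eq val_inj) !val_insubd /=.
case: (eqVneq u y) => [uy|_]; case: (eqVneq v y) => [vy|_] /=.
- by rewrite uy vy adj_irrefl in uv.
- by apply: contra nxy => /eqP->; rewrite adj_sym -uy.
- by apply: contra nxy => /eqP<-; rewrite -vy.
- by apply: contraTneq uv => ->; rewrite adj_irrefl.
Qed.

Lemma chromatic_min (G : sgraph) k : colorable k G -> chromatic_number G <= k.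
Proof. by rewrite /chromatic_number; case: ex_minnP => m _; apply. Qed.

Lemma connect_delete (G : sgraph) (S : {set G}) (x y : delete S) :
  connect (inner (@adj G) (~: S)) (val x) (val y) -> connect (@adj (delete S)) x y.
Proof.
pose P a := [exists w : delete S, (val w == a) && connect (@adj (delete S)) x w].
move=> xy; suff /existsP[w /andP[/eqP/val_inj<-]] : P (val y) by [].
apply: connect_invariant xy; last by apply/existsP; exists x; rewrite eqxx connect0.
move=> a b /existsP[w /andP[/eqP wa xw]] /and3P[aS bS ab].
have bS' : b \notin S by move: bS; rewrite inE.
apply/existsP; exists (Sub b bS'); rewrite eqxx.
by apply: connect_trans xw (connect1 _); rewrite /= /delete_adj wa.
Qed.

(** Equality holds at [t = 6]. A noncomplete graph has more vertices than its chromatic number, so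
    [t <= k] yields the order that [t]-connectedness demands. *)
Lemma expn_sub4_bound t : 6 <= t -> t <= 2 ^ (t - 4) + 2.
Proof.
move=> /subnK <-; move: (t - 6) => m.
have -> : m + 6 - 4 = m + 2 by lia.
by have := ltn_expl m (isT : 1 < 2); rewrite expnD; lia.
Qed.

Theorem corollary1p7 (t k : nat) (ht : 6 <= t) (hk : 2 ^ (t - 4) + 2 <= k)
    (G : sgraph) (hG : contraction_critical k G) (hnc : ~ complete G) :
  t_connected t G.
Proof.
have [chi _] := hG; have tk := leq_trans (expn_sub4_bound ht) hk.
have [G0 Gcol] := noncomplete_colorable hnc.
have tG : t < #|G|.
  by have := chromatic_min Gcol; rewrite chi => kG; rewrite -(prednK G0) ltnS (leq_trans tk).
split=> // S St; have Sx : 0 < #|delete S|.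
  rewrite card_sig (eq_card (B := ~: S)) => [|z]; last by rewrite !inE.
  by rewrite -(ltn_add2l #|S|) addn0 cardsC (ltn_trans St).
split=> // x y; apply: contraT => nxy.
have [|S0 [X [Y [S0S sd]]]] := @separator_sides G (@adj G) S (val x) (val y) (@adj_sym G)
  (valP x) (valP y).
  by apply: contra nxy; apply: connect_delete.
exfalso; apply: (no_small_separator (q := k.-1) (@adj_sym G) (@adj_irrefl G) _ _ _ _ sd).
- by move=> U h U0 hU hconn prop; apply: critical_quotient hG U0 hU hconn prop.
- move=> c c_col; have : colorable k.-1 G.
    apply/existsP; exists [ffun v => c v].
    apply/forallP => u; apply/forallP => v; apply/implyP => uv.
    by rewrite !ffunE c_col.
  move=> /chromatic_min; rewrite chi; lia.
- lia.
(* [S0] has at most [t - 1] vertices, and [hk] gives [2 ^ (t - 4) < k.-1]. *)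
have : 2 ^ (#|S0| - 3) <= 2 ^ (t - 4).
  by rewrite leq_exp2l //; have := subset_leq_card S0S; lia.
lia.
Qed.
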